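(* Let $\lambda$ be an integrable radial weight on the unit disc $\mathbb{D}\subset\mathbb{C}$ that is non-vanishing (hence strictly positive) and smooth on $\mathbb{D}$. Then the weighted Bergman projection $\mathbf{B}_{\lambda}$ is exactly regular; that is, for every $k\in\mathbb{N}$, $\mathbf{B}_\lambda$ maps the weighted Sobolev space $W^k(\lambda)$ to $W^k(\lambda)$ boundedly: there is a constant $C>0$ (depending on $k$ and $\lambda$) such that for all $f\in W^k(\lambda)$ one has $\mathbf{B}_\lambda f\in W^k(\lambda)$ and $\|\mathbf{B}_\lambda f\|_{k,\lambda}\le C\,\|f\|_{k,\lambda}$.
   Context: $\mathbb{D}$ is the open unit disc in $\mathbb{C}$ and $dA$ is Lebesgue measure on $\mathbb{C}$. A radial weight is a continuous non-negative function $\lambda(r)$ on $[0,1)$, regarded as a function on $\mathbb{D}$ via $\lambda(z)=\lambda(|z|)$; it is integrable if $\int_{\mathbb{D}}\lambda\,dA<\infty$. ''Smooth on $\mathbb{D}$'' means $z\mapsto\lambda(z)$ is $C^\infty$ on the open disc $\mathbb{D}$ (no assumption is made at the boundary). $L^2(\lambda)$ is the Hilbert space of functions on $\mathbb{D}$ that are square integrable with respect to $\lambda\,dA$, with inner product $\langle f,g\rangle_\lambda=\int_{\mathbb{D}} f\,\overline{g}\,\lambda\,dA$. $A^2(\lambda)$ is the subspace of holomorphic functions in $L^2(\lambda)$; it is closed. The weighted Bergman projection $\mathbf{B}_\lambda:L^2(\lambda)\to A^2(\lambda)$ is the orthogonal projection. For $k\in\mathbb{N}$, $W^k(\lambda)$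 is the weighted Sobolev space of functions $f\in L^2(\lambda)$ all of whose (distributional) derivatives of order at most $k$ on $\mathbb{D}$ lie in $L^2(\lambda)$, with norm $$\|f\|_{k,\lambda}^2=\sum_{|\beta|\le k}\int_{\mathbb{D}}\left|\frac{\partial^{\beta}f}{\partial(z,\bar z)^{\beta}}\right|^2\lambda\,dA,$$ where $\beta=(\beta_1,\beta_2)$ ranges over pairs of non-negative integers, $|\beta|=\beta_1+\beta_2$ and $\frac{\partial^\beta}{\partial(z,\bar z)^\beta}=\frac{\partial^{\beta_1}}{\partial z^{\beta_1}}\frac{\partial^{\beta_2}}{\partial\bar z^{\beta_2}}$. *)

(* Defs.v *)
From HB Require Import structures.
From mathcomp Require Import all_boot all_order all_algebra.
From mathcomp Require Import complex.
From mathcomp Require Import all_classical all_reals all_analysis.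

Set Implicit Arguments.
Unset Strict Implicit.
Unset Printing Implicit Defensive.

Import Order.TTheory GRing.Theory Num.Theory.
Import numFieldNormedType.Exports.

Local Open Scope classical_set_scope.
Local Open Scope ring_scope.
Local Open Scope complex_scope.

Local Notation Re := complex.Re.
Local Notation Im := complex.Im.

(* The modulus as an element of R; the norm `|z| of R[i] has values in R[i]. *)
Local Notation cmod := ComplexField.Normc.normc.

Definition disc (R : realType) : set R[i] := [set z | cmod z < 1].
Arguments disc : clear implicits.

(* Lebesgue measure lives on R * R, so integration over the complex plane and
   real partial derivatives go through the identification of R * R with R[i]. *)
Definition of_plane {R : realType} (p : R * R) : R[i] := p.1 +i* p.2.
Definition to_plane {R : realType} (z : R[i]) : R * R := (Re z, Im z).

Local Notation dA R := (@lebesgue_measure R \x @lebesgue_measure R)%E.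

Definition re_plane {R : realType} (f : R[i] -> R[i]) : R * R -> R :=
  fun p => Re (f (of_plane p)).
Definition im_plane {R : realType} (f : R[i] -> R[i]) : R * R -> R :=
  fun p => Im (f (of_plane p)).

Definition cmeasurable {R : realType} (A : set R[i]) (f : R[i] -> R[i]) : Prop :=
  measurable_fun (of_plane @^-1` A) (re_plane f) /\
  measurable_fun (of_plane @^-1` A) (im_plane f).

(* Used for nonnegative integrands only. *)
Definition eint {R : realType} (A : set R[i]) (u : R[i] -> R) : \bar R :=
  (\int[dA R]_(p in of_plane @^-1` A) (u (of_plane p))%:E)%E.

(* Meaningful for absolutely integrable f; Rintegral has junk values otherwise. *)
Definition cint {R : realType} (A : set R[i]) (f : R[i] -> R[i]) : R[i] :=
  Rintegral (dA R) (of_plane @^-1` A) (re_plane f) +i*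
  Rintegral (dA R) (of_plane @^-1` A) (im_plane f).

(* R[i] gets its topology through R[i]^o, the one-dimensional normed space over
   itself; hence the casts to R[i]^o here and below. *)
Definition locally_integrable {R : realType} (f : R[i] -> R[i]) : Prop :=
  cmeasurable (disc R) f /\
  forall K : set R[i], compact (K : set R[i]^o) -> K `<=` disc R ->
    (eint K (fun z => cmod (f z)) < +oo)%E.

Definition pderivable {R : realType} (v : R * R) (f : R[i] -> R[i]) (z : R[i]) : Prop :=
  derivable (re_plane f) (to_plane z) v /\ derivable (im_plane f) (to_plane z) v.

Definition pderive {R : realType} (v : R * R) (f : R[i] -> R[i]) : R[i] -> R[i] :=
  fun z => ('D_v (re_plane f) (to_plane z)) +i* ('D_v (im_plane f) (to_plane z)).

Definition partial_x {R : realType} : (R[i] -> R[i]) -> R[i] -> R[i] := pderive (1, 0).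
Definition partial_y {R : realType} : (R[i] -> R[i]) -> R[i] -> R[i] := pderive (0, 1).

Definition partial_z {R : realType} (f : R[i] -> R[i]) : R[i] -> R[i] :=
  fun z => (partial_x f z - (0 +i* 1) * partial_y f z) / 2.
Definition partial_zbar {R : realType} (f : R[i] -> R[i]) : R[i] -> R[i] :=
  fun z => (partial_x f z + (0 +i* 1) * partial_y f z) / 2.

Definition wirtinger {R : realType} (b1 b2 : nat) (f : R[i] -> R[i]) : R[i] -> R[i] :=
  iter b1 partial_z (iter b2 partial_zbar f).

(* Only meaningful for U open. *)
Fixpoint Cn_on {R : realType} (U : set R[i]) (n : nat) (f : R[i] -> R[i]) : Prop :=
  if n is m.+1 then
    [/\ forall z, U z -> pderivable (1, 0) f z /\ pderivable (0, 1) f z,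
        Cn_on U m (partial_x f) & Cn_on U m (partial_y f)]
  else forall z, U z -> {for z, continuous (f : R[i]^o -> R[i]^o)}.

Definition smooth_on {R : realType} (U : set R[i]) (f : R[i] -> R[i]) : Prop :=
  forall n, Cn_on U n f.

(* Complex differentiability: both the scalars and the spaces are R[i]. *)
Definition holomorphic_on {R : realType} (U : set R[i]) (f : R[i] -> R[i]) : Prop :=
  forall z, U z -> derivable (f : R[i]^o -> R[i]^o) z 1.

Definition test_function {R : realType} (phi : R[i] -> R[i]) : Prop :=
  let supp := closure ([set z | phi z != 0] : set R[i]^o) in
  [/\ smooth_on setT phi, compact supp & supp `<=` disc R].

(* g represents the distributional derivative of f on the disc, of order b1 in
   z and b2 in the conjugate of z. *)
Definition weak_derivative {R : realType} (b1 b2 : nat) (f g : R[i] -> R[i]) : Prop :=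
  [/\ locally_integrable f, locally_integrable g &
      forall phi : R[i] -> R[i], test_function phi ->
        cint (disc R) (fun z => f z * wirtinger b1 b2 phi z) =
        (-1) ^+ (b1 + b2) * cint (disc R) (fun z => g z * phi z)].

Definition radial_weight {R : realType} (lam : R -> R) : Prop :=
  {within [set` `[0, 1[], continuous lam} /\ forall r, 0 <= r < 1 -> 0 <= lam r.

Definition on_disc {R : realType} (lam : R -> R) (z : R[i]) : R := lam (cmod z).

Definition integrable_weight {R : realType} (lam : R -> R) : Prop :=
  (eint (disc R) (on_disc lam) < +oo)%E.

(* Elements of the function spaces below are represented by functions on the
   whole of R[i], of which only the values on the disc matter. *)
Definition L2 {R : realType} (lam : R -> R) (f : R[i] -> R[i]) : Prop :=
  cmeasurable (disc R) f /\
  (eint (disc R) (fun z => cmod (f z) ^+ 2 * on_disc lam z)%R < +oo)%E.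

Definition inner {R : realType} (lam : R -> R) (f g : R[i] -> R[i]) : R[i] :=
  cint (disc R) (fun z => f z * conjc (g z) * (on_disc lam z)%:C).

Definition A2 {R : realType} (lam : R -> R) (f : R[i] -> R[i]) : Prop :=
  L2 lam f /\ holomorphic_on (disc R) f.

Definition orthogonal_projection_on_A2 {R : realType} (lam : R -> R)
    (f g : R[i] -> R[i]) : Prop :=
  A2 lam g /\
  forall h : R[i] -> R[i], A2 lam h -> inner lam (fun z => f z - g z) h = 0.

(* The projection is determined on the disc; the default value is never used
   when an orthogonal projection of f exists. *)
Definition bergman {R : realType} (lam : R -> R) (f : R[i] -> R[i]) : R[i] -> R[i] :=
  xget (fun=> 0) [set g | orthogonal_projection_on_A2 lam f g].

Definition sobolev {R : realType} (k : nat) (lam : R -> R) (f : R[i] -> R[i]) : Prop :=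
  L2 lam f /\
  forall b1 b2 : nat, (b1 + b2 <= k)%N ->
    exists2 g : R[i] -> R[i], weak_derivative b1 b2 f g & L2 lam g.

(* A weak derivative is unique almost everywhere on the disc, so the norm
   below does not depend on the representative that is chosen. *)
Definition wderiv {R : realType} (b1 b2 : nat) (f : R[i] -> R[i]) : R[i] -> R[i] :=
  xget (fun=> 0) [set g | weak_derivative b1 b2 f g].

(* Meaningful for f in W^k(lam) only: otherwise some of the integrals may be
   infinite or some of the weak derivatives may not exist. *)
Definition sobolev_norm {R : realType} (k : nat) (lam : R -> R) (f : R[i] -> R[i]) : R :=
  Num.sqrt (\sum_(b : 'I_k.+1 * 'I_k.+1 | (b.1 + b.2 <= k)%N)
    fine (eint (disc R) (fun z => cmod (wderiv b.1 b.2 f z) ^+ 2 * on_disc lam z))).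

Definition exactly_regular {R : realType} (lam : R -> R) : Prop :=
  forall k : nat, exists2 C : R, 0 < C &
    forall f : R[i] -> R[i], sobolev k lam f ->
      sobolev k lam (bergman lam f) /\
      sobolev_norm k lam (bergman lam f) <= C * sobolev_norm k lam f.

(* Main.v *)
Require Import Defs.
From mathcomp Require Import all_boot all_order all_algebra.
From mathcomp Require Import complex ring lra.
From mathcomp Require Import all_classical all_reals all_analysis measurable_realfun.

(* Write B for the Bergman projection.  Monomials are orthogonal in L2(lam) and complete in
   A2(lam), so B f = sum_n a_n z^n with a_n = <f, z^n> / m_n, where m_n is the squared norm of
   z^n.  Since (zb d/dzb - z d/dz) acts on zb^n rho(|z|^2) as multiplication by n, integrating by
   parts k times against such test functions gives n^k <f, z^n> = <F, z^n> with F a combination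
   of the weak derivatives of f of order at most k with polynomial coefficients.  Bessel's
   inequality for F bounds sum_n n^(2k) |a_n|^2 m_n, and m_n <= C m_(n+1) turns this into a
   bound on the k-th derivative of B f.

   No boundary behaviour of lam enters: lam(|z|) conj(z)^n is cut off smoothly near 0 and near
   the unit circle, and the cut-off is removed by dominated convergence.  That the
   integral of u d(phi)/dzb vanishes for u holomorphic and phi a test function is proved by
   Goursat's bisection argument, which only needs differentiability.  Completeness of the monomials follows since a function u
   orthogonal to them satisfies int u z^a zb^b rho(|z|^2) = 0 for all a, b and rho; the powers of
   1 - |z - p|^2 / 4 are polynomials in z and zb that concentrate at p, whence u(p) = 0. *)

Set Implicit Arguments.
Unset Strict Implicit.
Unset Printing Implicit Defensive.

Import Order.TTheory GRing.Theory Num.Theory.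
Import numFieldNormedType.Exports.

Local Open Scope classical_set_scope.
Local Open Scope ring_scope.
Local Open Scope complex_scope.

Local Notation Re := complex.Re.
Local Notation Im := complex.Im.
Local Notation cmod := ComplexField.Normc.normc.
Local Notation leb2 R := (@lebesgue_measure R \x @lebesgue_measure R)%E.

(** * The modulus as a real number *)

Section Modulus.
Variable R : realType.
Implicit Types z w : R[i].

(** The field zb d/dzb - z d/dz is a multiple of the rotation field: it is tangent to the circles
    about 0 and annihilates every function of |z|. The weight and the cut-off are therefore never
    differentiated, so that neither the derivatives of [lam] nor those of the cut-offs have to be
    controlled when the cut-off is removed. Holomorphic means here complex differentiable at each
    point, with neither Cauchy's formula nor a power series at hand. Hence Green's formula must hold
    for u phi without continuity of u', and an element of A2 is recognised as its own power series
    only at the end, by completeness of the monomials. The inequality m_n <= C m_(n+1) pays for the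
    shift of index under differentiation; it rests on m_n >= c r^(2n) for each r < 1, with c > 0
    depending on r. The Sobolev norm is evaluated on weak derivatives that are selected arbitrarily,
    so their uniqueness almost everywhere has to be established as well. *)

Lemma cjD z w : conjc (z + w) = conjc z + conjc w. Proof. exact: rmorphD. Qed.
Lemma cjB z w : conjc (z - w) = conjc z - conjc w. Proof. exact: rmorphB. Qed.
Lemma cjN z : conjc (- z) = - conjc z. Proof. exact: rmorphN. Qed.
Lemma cjM z w : conjc (z * w) = conjc z * conjc w. Proof. exact: rmorphM. Qed.
Lemma cjX z n : conjc (z ^+ n) = conjc z ^+ n. Proof. exact: rmorphXn. Qed.
Lemma rcD (x y : R) : (x + y)%:C = x%:C + y%:C. Proof. exact: rmorphD. Qed.
Lemma rcB (x y : R) : (x - y)%:C = x%:C - y%:C. Proof. exact: rmorphB. Qed.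
Lemma rcM (x y : R) : (x * y)%:C = x%:C * y%:C. Proof. exact: rmorphM. Qed.
Lemma rcX (x : R) n : (x ^+ n)%:C = x%:C ^+ n. Proof. exact: rmorphXn. Qed.
Lemma rcV (x : R) : (x^-1)%:C = x%:C^-1. Proof. exact: fmorphV. Qed.

Lemma cmodE z : `|z| = (cmod z)%:C.
Proof. by rewrite normc_def; case: z. Qed.

Lemma cmod_ge0 z : 0 <= cmod z.
Proof. by case: z => a b; exact: sqrtr_ge0. Qed.

Lemma cmodM z w : cmod (z * w) = cmod z * cmod w.
Proof. exact: ComplexField.Normc.normcM. Qed.

Lemma cmodN z : cmod (- z) = cmod z.
Proof. by apply: complexI; rewrite -!cmodE normrN. Qed.

Lemma cmodB z w : cmod (z - w) = cmod (w - z).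
Proof. by rewrite -cmodN opprB. Qed.

Lemma cmod0 : cmod (0 : R[i]) = 0.
Proof. exact: ComplexField.Normc.normc0. Qed.

Lemma cmod_eq0 z : (cmod z == 0) = (z == 0).
Proof.
apply/eqP/eqP => [|->]; last exact: cmod0.
exact: ComplexField.Normc.eq0_normc.
Qed.

Lemma cmod_gt0 z : (0 < cmod z) = (z != 0).
Proof. by rewrite lt_def cmod_ge0 andbT cmod_eq0. Qed.

Lemma le_cmodD z w : cmod (z + w) <= cmod z + cmod w.
Proof. by rewrite -lecR rcD -!cmodE; exact: ler_normD. Qed.

Lemma cmodJ z : cmod (conjc z) = cmod z.
Proof. by case: z => a b /=; rewrite sqrrN. Qed.

Lemma cmod_real (x : R) : cmod x%:C = `|x|.
Proof. by rewrite /= expr0n/= addr0 sqrtr_sqr. Qed.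

Lemma cmodX z n : cmod (z ^+ n) = cmod z ^+ n.
Proof.
elim: n => [|n ih]; first by rewrite !expr0; exact: ComplexField.Normc.normc1.
by rewrite !exprS cmodM ih.
Qed.

Lemma cmodV z : cmod z^-1 = (cmod z)^-1.
Proof. exact: ComplexField.Normc.normcV. Qed.

Lemma le_Re_cmod z : `|Re z| <= cmod z.
Proof.
case: z => a b /=; rewrite -sqrtr_sqr ler_wsqrtr// lerDl; exact: sqr_ge0.
Qed.

Lemma le_Im_cmod z : `|Im z| <= cmod z.
Proof.
case: z => a b /=; rewrite -sqrtr_sqr ler_wsqrtr// lerDr; exact: sqr_ge0.
Qed.

Lemma cmod_le z : cmod z <= `|Re z| + `|Im z|.
Proof.
have -> : z = (Re z)%:C + 'i%C * (Im z)%:C by rewrite -complexE.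
apply: le_trans (le_cmodD _ _) _; rewrite cmodM !cmod_real.
have -> : cmod ('i : R[i])%C = 1 by rewrite /= expr0n/= expr1n add0r sqrtr1.
by rewrite mul1r -complexE.
Qed.

Lemma sqr_cmod z : cmod z ^+ 2 = Re z ^+ 2 + Im z ^+ 2.
Proof. by case: z => a b /=; rewrite sqr_sqrtr// addr_ge0// sqr_ge0. Qed.

Lemma mulJ_cmod z : z * conjc z = (cmod z ^+ 2)%:C.
Proof. by rewrite sqr_cmod; case: z => a b /=; simpc; congr (_ +i* _); ring. Qed.

Lemma cmod_sum (I : Type) (s : seq I) (P : pred I) (F : I -> R[i]) :
  cmod (\sum_(i <- s | P i) F i) <= \sum_(i <- s | P i) cmod (F i).
Proof.
elim/big_rec2: _ => [|i x y _ ih]; first by rewrite cmod0.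
by apply: le_trans (le_cmodD _ _) _; rewrite lerD2l.
Qed.

Lemma ReD z w : Re (z + w) = Re z + Re w. Proof. by case: z; case: w. Qed.

Lemma ImD z w : Im (z + w) = Im z + Im w. Proof. by case: z; case: w. Qed.

Lemma ReN z : Re (- z) = - Re z. Proof. by case: z. Qed.

Lemma ImN z : Im (- z) = - Im z. Proof. by case: z. Qed.

Lemma ReB z w : Re (z - w) = Re z - Re w. Proof. by rewrite ReD ReN. Qed.

Lemma ImB z w : Im (z - w) = Im z - Im w. Proof. by rewrite ImD ImN. Qed.

Lemma ReM z w : Re (z * w) = Re z * Re w - Im z * Im w.
Proof. by case: z; case: w. Qed.

Lemma ImM z w : Im (z * w) = Re z * Im w + Im z * Re w.
Proof. by case: z; case: w. Qed.

Lemma ReMr z (x : R) : Re (z * x%:C) = Re z * x.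
Proof. by rewrite ReM /= mulr0 subr0. Qed.

Lemma ImMr z (x : R) : Im (z * x%:C) = Im z * x.
Proof. by rewrite ImM /= mulr0 add0r. Qed.

Lemma ReJ z : Re (conjc z) = Re z. Proof. by case: z. Qed.

Lemma ImJ z : Im (conjc z) = - Im z. Proof. by case: z. Qed.

Lemma eqC z w : Re z = Re w -> Im z = Im w -> z = w.
Proof. by case: z => a b; case: w => c d /= -> ->. Qed.

End Modulus.

(** * Continuity on the complex plane in epsilon-delta form *)

Section Continuity.
Variable R : realType.
Implicit Types (f g : R[i] -> R[i]) (z w : R[i]).

(** Balls of [R[i]^o] have radii in [R[i]]; this form keeps all radii real, as the explicit
    estimates require. *)
Definition ccont f z := forall e : R, 0 < e ->
  exists2 d : R, 0 < d & forall w, cmod (w - z) < d -> cmod (f w - f z) < e.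

Lemma ccontP f z : ccont f z <-> {for z, continuous (f : R[i]^o -> R[i]^o)}.
Proof.
split=> [fz|fz].
  apply/(@cvgrPdist_lt R[i] R[i]^o R[i]^o (nbhs (z : R[i]^o))) => e e0.
  have ee : e = (Re e)%:C by rewrite RRe_real// gtr0_real.
  have [|d d0 dP] := fz (Re e); first by rewrite -ltcR -ee.
  near=> w; rewrite distrC cmodE ee ltcR; apply: dP.
  rewrite -ltcR -cmodE distrC.
  near: w; apply: (@cvgr_dist_lt R[i] R[i]^o R[i]^o (nbhs (z : R[i]^o)) _ id) => //.
  by rewrite ltcR.
move=> e e0; move/(@cvgrPdist_lt R[i] R[i]^o R[i]^o (nbhs (z : R[i]^o))) : fz => /(_ e%:C); rewrite ltcR => /(_ e0).
move=> /nbhs_ballP[d /= d0 dP].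
have dd : d = (Re d)%:C by rewrite RRe_real// gtr0_real.
exists (Re d); first by rewrite -ltcR -dd.
move=> w wd; rewrite -ltcR -cmodE distrC; apply: dP.
by rewrite -ball_normE/= distrC dd cmodE ltcR.
Unshelve. all: by end_near. Qed.

Lemma ccont_cst c z : ccont (fun=> c) z.
Proof. by move=> e e0; exists 1 => // w _; rewrite subrr cmod0. Qed.

Lemma ccont_id z : ccont id z.
Proof. by move=> e e0; exists e. Qed.

Lemma ccontD f g z : ccont f z -> ccont g z -> ccont (fun w => f w + g w) z.
Proof. by move=> /ccontP fz /ccontP gz; apply/ccontP; exact: (@cvgD R[i] R[i]^o R[i]^o (nbhs (z : R[i]^o)) _ f g _ _ fz gz). Qed.

Lemma ccontM f g z : ccont f z -> ccont g z -> ccont (fun w => f w * g w) z.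
Proof. by move=> /ccontP fz /ccontP gz; apply/ccontP; exact: (@cvgM R[i] R[i]^o (nbhs (z : R[i]^o)) _ f g _ _ fz gz). Qed.

Lemma ccontN f z : ccont f z -> ccont (fun w => - f w) z.
Proof. by move=> /ccontP fz; apply/ccontP; exact: (@cvgN R[i] R[i]^o R[i]^o (nbhs (z : R[i]^o)) _ f _ fz). Qed.

Lemma ccontB f g z : ccont f z -> ccont g z -> ccont (fun w => f w - g w) z.
Proof. by move=> fz gz; apply: ccontD => //; exact: ccontN. Qed.

Lemma ccontJ f z : ccont f z -> ccont (fun w => conjc (f w)) z.
Proof.
move=> fz e /fz[d d0 dP]; exists d => // w /dP.
by rewrite -cjB cmodJ.
Qed.

Lemma ccontX f z n : ccont f z -> ccont (fun w => f w ^+ n) z.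
Proof.
move=> fz; elim: n => [|n ih]; first exact: ccont_cst.
by under [X in ccont X]eq_fun do rewrite exprS; exact: ccontM.
Qed.

Lemma ccont_sum (I : Type) (s : seq I) (F : I -> R[i] -> R[i]) z :
  (forall i, ccont (F i) z) -> ccont (fun w => \sum_(i <- s) F i w) z.
Proof.
move=> Fz; elim: s => [|i s ih].
  by under [X in ccont X]eq_fun do rewrite big_nil; exact: ccont_cst.
by under [X in ccont X]eq_fun do rewrite big_cons; exact: ccontD.
Qed.

Definition cnear z (P : R[i] -> Prop) :=
  exists2 d : R, 0 < d & forall w, cmod (w - z) < d -> P w.

Lemma ccont_near f g z : cnear z (fun w => f w = g w) -> ccont f z -> ccont g z.
Proof.
move=> [d d0 dP] fz e /fz[d' d'0 d'P]; exists (Order.min d d').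
  by rewrite lt_min d0.
move=> w; rewrite lt_min => /andP[wd wd'].
by rewrite -!dP ?d'P// subrr cmod0.
Qed.

Lemma ccont_comp (F : R -> R) f z : {for Re (f z), continuous F} -> ccont f z ->
  ccont (fun w => (F (Re (f w)))%:C) z.
Proof.
move=> /cvgrPdist_lt Fc fz e e0.
have /nbhs_ballP[d d0 dP] := Fc _ e0.
have [d' d'0 d'P] := fz _ d0; exists d' => // w /d'P wd.
rewrite -rcB cmod_real distrC; apply: dP; rewrite /ball/= distrC -ReB.
exact: le_lt_trans (le_Re_cmod _) wd.
Qed.

Lemma cnear_mono z (P Q : R[i] -> Prop) :
  (forall w, P w -> Q w) -> cnear z P -> cnear z Q.
Proof. by move=> PQ [d d0 dP]; exists d => // w /dP/PQ. Qed.

Lemma cnear_self z P : cnear z P -> P z.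
Proof. by move=> [d d0]; apply; rewrite subrr cmod0. Qed.

End Continuity.

(** * Calculus of Wirtinger derivatives *)

Section Wirtinger.
Variable R : realType.
Implicit Types (f g : R[i] -> R[i]) (z w a b : R[i]).

(* Caratheodory's form of real differentiability; a and b are the Wirtinger derivatives of f at z. *)
Definition wdiff f z a b := exists A B : R[i] -> R[i],
  [/\ ccont A z, ccont B z, A z = a, B z = b &
      forall w, f w = f z + A w * (w - z) + B w * conjc (w - z)].

Lemma wdiff_cont f z a b : wdiff f z a b -> ccont f z.
Proof.
move=> [A [B [cA cB Aa Bb fE]]].
rewrite (_ : f = fun w => f z + A w * (w - z) + B w * conjc (w - z)); last first.
  by apply/funext => w; exact: fE.
have cz : ccont (fun w => w - z) z.
  by apply: ccontD; [exact: ccont_id|exact: ccont_cst].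
by apply: ccontD; [apply: ccontD; [exact: ccont_cst|exact: ccontM]|
  apply: ccontM => //; exact: ccontJ].
Qed.

Lemma wdiff_cst c z : wdiff (fun=> c) z 0 0.
Proof.
exists (fun=> 0), (fun=> 0); split => //; try exact: ccont_cst.
by move=> w; rewrite !mul0r !addr0.
Qed.

Lemma wdiff_id z : wdiff id z 1 0.
Proof.
exists (fun=> 1), (fun=> 0); split => //; try exact: ccont_cst.
by move=> w; rewrite mul0r mul1r addr0 addrC subrK.
Qed.

Lemma wdiffJ f z a b : wdiff f z a b ->
  wdiff (fun w => conjc (f w)) z (conjc b) (conjc a).
Proof.
move=> [A [B [cA cB Aa Bb fE]]].
exists (fun w => conjc (B w)), (fun w => conjc (A w)).
split; try exact: ccontJ; rewrite ?Aa ?Bb//.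
by move=> w; rewrite fE !(cjD, cjM) !conjcK addrAC.
Qed.

Lemma wdiffD f g z a b c d : wdiff f z a b -> wdiff g z c d ->
  wdiff (fun w => f w + g w) z (a + c) (b + d).
Proof.
move=> [A [B [cA cB Aa Bb fE]]] [C [D [cC cD Cc Dd gE]]].
exists (fun w => A w + C w), (fun w => B w + D w).
split; try exact: ccontD; rewrite ?Aa ?Bb ?Cc ?Dd//.
by move=> w; rewrite fE gE; ring.
Qed.

Lemma wdiffM f g z a b c d : wdiff f z a b -> wdiff g z c d ->
  wdiff (fun w => f w * g w) z (a * g z + f z * c) (b * g z + f z * d).
Proof.
move=> df dg; have cg := wdiff_cont dg.
move: df dg => [A [B [cA cB Aa Bb fE]]] [C [D [cC cD Cc Dd gE]]].
exists (fun w => A w * g w + f z * C w), (fun w => B w * g w + f z * D w).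
split; rewrite ?Aa ?Bb ?Cc ?Dd//.
- by apply: ccontD; apply: ccontM => //; exact: ccont_cst.
- by apply: ccontD; apply: ccontM => //; exact: ccont_cst.
by move=> w; rewrite fE [in X in (f z + _ + _) * X]gE; rewrite (gE w); ring.
Qed.

Lemma wdiffZ c f z a b : wdiff f z a b -> wdiff (fun w => c * f w) z (c * a) (c * b).
Proof.
by move=> df; have := wdiffM (wdiff_cst c z) df; rewrite !mul0r !add0r.
Qed.

(** Caratheodory's identity is required for all [w], also far from [z]. The discrepancy [g w - f w],
    which vanishes near [z], is divided by [w - z] and absorbed into the first factor. *)
Lemma wdiff_near f g z a b : cnear z (fun w => f w = g w) ->
  wdiff f z a b -> wdiff g z a b.
Proof.
move=> fg [A [B [cA cB Aa Bb fE]]].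
have fgz := cnear_self fg.
exists (fun w => if w == z then a else A w + (g w - f w) / (w - z)), B.
have nE : cnear z (fun w => A w =
    if w == z then a else A w + (g w - f w) / (w - z)).
  apply: cnear_mono fg => w ->; case: eqVneq => [->//|_].
  by rewrite subrr mul0r addr0.
split => //; [exact: ccont_near nE cA| by rewrite eqxx |].
move=> w; case: eqVneq => [->|wz].
  by rewrite subrr rmorph0 !mulr0 !addr0.
rewrite mulrDl divfK ?subr_eq0//.
by rewrite {1}[f w]fE -fgz; ring.
Qed.

(** The real part is half the sum of a number and its conjugate, and conjugation exchanges [w - z]
    with its conjugate; this pairs [A] with the conjugate of [B]. *)
Lemma wdiff_comp (F : R -> R) (F' : R) f z a b :
  is_derive (Re (f z)) 1 F F' -> wdiff f z a b ->
  wdiff (fun w => (F (Re (f w)))%:C) z (F'%:C * ((a + conjc b) / 2))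
    (F'%:C * ((b + conjc a) / 2)).
Proof.
move=> dF df; have cf := wdiff_cont df.
move: df => [A [B [cA cB Aa Bb fE]]].
have F'E : 'D_1 F (Re (f z)) = F' by exact: derive_val.
(* [G] is the slope of [F] at [s0], continued by [F']: Caratheodory's form in one real variable. *)
pose s0 := Re (f z).
pose G s := if s == s0 then F' else (F s - F s0) / (s - s0).
have GE s : F s = F s0 + G s * (s - s0).
  rewrite /G; case: eqVneq => [->|ss0]; first by rewrite subrr mulr0 addr0.
  by rewrite divfK ?subr_eq0// addrC subrK.
have cG : {for s0, continuous G}.
  move: (@ex_derive _ _ _ _ _ _ _ dF); rewrite /derivable => /cvg_ex[l hl].
  have lF : l = F'.
    by rewrite -F'E /derive; apply/esym/cvg_lim.
  rewrite lF in hl.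
  apply/cvgrPdist_le => e e0; move/cvgrPdist_le : hl => /(_ e e0).
  move=> /nbhs_ballP[d /= d0 dP].
  apply/nbhs_ballP; exists d => //= s; rewrite /ball/= => s0s.
  rewrite /G eqxx; case: eqVneq => [_|ss0]; first by rewrite subrr normr0 ltW.
  have := dP (s - s0); rewrite /ball/= sub0r normrN distrC => /(_ s0s).
  by rewrite subr_eq0 ss0 => /(_ isT); rewrite /= scaler1 subrK /GRing.scale/= mulrC.
pose K w := (G (Re (f w)))%:C.
have cK : ccont K z by exact: ccont_comp.
exists (fun w => K w * ((A w + conjc (B w)) / 2)),
       (fun w => K w * ((B w + conjc (A w)) / 2)).
split.
- apply: ccontM => //; apply: ccontM; last exact: ccont_cst.
  by apply: ccontD => //; exact: ccontJ.
- apply: ccontM => //; apply: ccontM; last exact: ccont_cst.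
  by apply: ccontD => //; exact: ccontJ.
- by rewrite /K /G eqxx Aa Bb.
- by rewrite /K /G eqxx Aa Bb.
move=> w; rewrite GE rcD rcM -addrA; congr (_ + _).
rewrite -!mulrA -mulrDr; congr (_ * _).
have -> : Re (f w) - s0 = Re (A w * (w - z) + B w * conjc (w - z)).
  by rewrite fE /s0 -ReB; congr (Re _); ring.
rewrite ReJ_add !(cjD, cjM) !conjcK; field; exact: isT.
Qed.

End Wirtinger.

(** * Comparison with the complex derivative and with partial derivatives *)

Section WirtingerDefs.
Variable R : realType.
Implicit Types (f g : R[i] -> R[i]) (z w a b : R[i]).

(** In the converse direction the factor [B] need not be zero, it only tends to 0; its contribution
    to the difference quotient is [B (z + h)] times conj h / h, a number of modulus 1. *)
Lemma holomorphicP f z : derivable (f : R[i]^o -> R[i]^o) z 1 <->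
  exists a, wdiff f z a 0.
Proof.
split=> [/cvg_ex[a /= fa]|[a [A [B [cA cB Aa Bb fE]]]]].
  pose A w := if w == z then a else (f w - f z) / (w - z).
  exists a, A, (fun=> 0); split => //; first last.
  - move=> w; rewrite mul0r addr0 /A; case: eqVneq => [->|wz].
      by rewrite subrr mulr0 addr0.
    by rewrite divfK ?subr_eq0// addrC subrK.
  - by rewrite /A eqxx.
  - exact: ccont_cst.
  apply/ccontP/(@cvgrPdist_le R[i] R[i]^o R[i]^o (nbhs (z : R[i]^o))) => e e0.
  move/(@cvgrPdist_le R[i] R[i]^o) : fa => /(_ e e0)/nbhs_ballP[d d0 dP].
  apply/nbhs_ballP; exists d => //= w; rewrite -ball_normE/= => zw.
  rewrite /A eqxx; case: eqVneq => [_|wz]; first by rewrite subrr normr0 ltW.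
  have := dP (w - z).
  rewrite -ball_normE/= sub0r normrN distrC => /(_ zw).
  by rewrite subr_eq0 wz => /(_ isT); rewrite scaler1 subrK /GRing.scale/= mulrC.
apply/cvg_ex; exists a.
move/ccontP : cA => cA; move/ccontP : cB => cB.
have h0 : (fun h : R[i]^o => h + z : R[i]^o) @ (0 : R[i]^o)^' --> (z : R[i]^o).
  rewrite -[X in _ --> X]add0r; apply: (@cvgD R[i] R[i]^o R[i]^o).
    exact: (@cvg_within _ (nbhs (0 : R[i]^o))).
  exact: cvg_cst.
have hA := cvg_comp _ _ h0 cA.
have hB := cvg_comp _ _ h0 cB.
rewrite Aa in hA; rewrite Bb in hB.
apply/(@cvgrPdist_le R[i] R[i]^o) => e e0.
move/(@cvgrPdist_le R[i] R[i]^o) : hA => /(_ (e/2)); rewrite divr_gt0// => /(_ isT) hA.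
move/(@cvgrPdist_le R[i] R[i]^o) : hB => /(_ (e/2)); rewrite divr_gt0// => /(_ isT) hB.
near=> h.
have hn0 : h != 0 by near: h; exact: nbhs_dnbhs_neq.
have -> : (f \o shift z) (h *: (1 : R[i]^o)) = f (h + z).
  by rewrite /= /GRing.scale/= mulr1.
have -> : f (h + z) - f z = A (h + z) * h + B (h + z) * h^*%C.
  by rewrite [f (h + z)]fE addrK; ring.
rewrite -[_ *: _]/(_ * _).
have -> : h^-1 * (A (h + z) * h + B (h + z) * h^*%C) =
   A (h + z) - ((0 - B (h + z)) * (h^-1 * h^*%C)).
  by rewrite mulrDr mulrCA mulVf// mulr1 sub0r mulNr opprK mulrCA.
rewrite opprB addrCA.
rewrite [e]splitr; apply: le_trans (ler_normD _ _) _.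
apply: lerD; last by near: h.
rewrite normrM.
have -> : `|h^-1 * h^*%C| = 1.
  by rewrite normrM normfV normcJ mulVf// normr_eq0.
by rewrite mulr1; near: h.
Unshelve. all: by end_near. Qed.

(** A real increment [h] factors out of [w - z] and of its conjugate alike, so the difference
    quotient along [v] is exactly the continuous function [Q] at the moved point. *)
Lemma wdiff_dir f z a b (v : R * R) : wdiff f z a b ->
  pderivable v f z /\
  pderive v f z = a * of_plane v + b * conjc (of_plane v).
Proof.
move=> [A [B [cA cB Aa Bb fE]]].
pose V := of_plane v.
pose Q w := A w * V + B w * conjc V.
have cQ : ccont Q z.
  by apply: ccontD; apply: ccontM => //; exact: ccont_cst.
have Qz : Q z = a * V + b * conjc V by rewrite /Q Aa Bb.
have fh h : f (of_plane (h *: v + to_plane z)) = f z + h%:C * Q (of_plane (h *: v + to_plane z)).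
  rewrite {1}fE.
  have -> : of_plane (h *: v + to_plane z) - z = h%:C * V.
    by apply: eqC; rewrite ?ReB ?ImB ?ReM ?ImM /= /GRing.scale/=; ring.
  by rewrite cjM conjc_real /Q; ring.
have lim0 : forall e, 0 < e -> \forall h \near (0:R)^',
    cmod (Q (of_plane (h *: v + to_plane z)) - Q z) < e.
  move=> e /cQ[d d0 dP].
  (* The summand 1 covers the direction [V = 0]. *)
  apply/nbhs_ballP; exists (d / (cmod V + 1)).
    by rewrite /= divr_gt0// ltr_wpDl// cmod_ge0.
  move=> h; rewrite /ball/= sub0r normrN => hd h0; apply: dP.
  have -> : of_plane (h *: v + to_plane z) - z = h%:C * V.
    by apply: eqC; rewrite ?ReB ?ImB ?ReM ?ImM /= /GRing.scale/=; ring.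
  rewrite cmodM cmod_real; apply: le_lt_trans (_ : `|h| * (cmod V + 1) < d).
    by rewrite ler_wpM2l// lerDl.
  by rewrite -ltr_pdivlMr// ltr_wpDl// cmod_ge0.
have key (p : R[i] -> R) : (forall z w, p (z - w) = p z - p w) ->
    (forall z w, p (z + w) = p z + p w) ->
    (forall (x : R) w, p (x%:C * w) = x * p w) -> (forall w, `|p w| <= cmod w) ->
    h^-1 *: (p (f (of_plane (h *: v + to_plane z))) - p (f z)) @[h --> (0:R)^'] --> p (Q z).
  move=> pB pD pM ple; apply/cvgrPdist_lt => e e0.
  have l0 := lim0 _ e0; near=> h.
  have h0 : h != 0 by near: h; exact: nbhs_dnbhs_neq.
  rewrite fh pD addrAC subrr add0r pM /GRing.scale/= mulKf// -pB.
  by apply: le_lt_trans (ple _) _; rewrite cmodB; near: h.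
have fz : f (of_plane (to_plane z)) = f z by case: (z).
have kRe := key (@Re R) (@ReB R) (@ReD R) _ (@le_Re_cmod R).
have kIm := key (@Im R) (@ImB R) (@ImD R) _ (@le_Im_cmod R).
have {}kRe : h^-1 *: (re_plane f (h *: v + to_plane z) - re_plane f (to_plane z)) @[h --> (0:R)^'] --> Re (Q z).
  by rewrite /re_plane fz; apply: kRe => x w; rewrite ReM/= mul0r subr0.
have {}kIm : h^-1 *: (im_plane f (h *: v + to_plane z) - im_plane f (to_plane z)) @[h --> (0:R)^'] --> Im (Q z).
  by rewrite /im_plane fz; apply: kIm => x w; rewrite ImM/= mul0r addr0.
split; first by split; apply/cvg_ex; [exists (Re (Q z))|exists (Im (Q z))].
rewrite -Qz; apply: eqC => /=; exact: cvg_lim.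
Unshelve. all: by end_near. Qed.

Definition Ci : R[i] := 0 +i* 1.

Lemma Ci2 : Ci * Ci = -1.
Proof. by apply: eqC; rewrite ?ReM ?ImM /=; ring. Qed.

Lemma wdiff_x f z a b : wdiff f z a b ->
  pderivable (1, 0) f z /\ partial_x f z = a + b.
Proof.
move=> /(wdiff_dir (1, 0))[fz fE]; split => //; rewrite /partial_x fE.
by apply: eqC; rewrite ?(ReD,ImD,ReM,ImM,ReN,ImN)/=; ring.
Qed.

Lemma wdiff_y f z a b : wdiff f z a b ->
  pderivable (0, 1) f z /\ partial_y f z = Ci * (a - b).
Proof.
move=> /(wdiff_dir (0, 1))[fz fE]; split => //; rewrite /partial_y fE.
by apply: eqC; rewrite ?(ReD,ImD,ReM,ImM,ReN,ImN)/=; ring.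
Qed.

Lemma wdiff_partial_z f z a b : wdiff f z a b -> partial_z f z = a.
Proof.
move=> df; rewrite /partial_z (wdiff_x df).2 (wdiff_y df).2 -/Ci mulrA Ci2; field.
exact: isT.
Qed.

Lemma wdiff_partial_zbar f z a b : wdiff f z a b -> partial_zbar f z = b.
Proof.
move=> df; rewrite /partial_zbar (wdiff_x df).2 (wdiff_y df).2 -/Ci mulrA Ci2; field.
exact: isT.
Qed.

End WirtingerDefs.

(** * Smooth functions of one real variable and smooth windows *)

Section Smooth1.
Variable R : realType.
Implicit Types (F G : R -> R) (U V : set R).

(** Each derivative is constrained on [U] only, and the last one need not be continuous; for all [n]
    together this is smoothness on an open [U]. *)
Fixpoint Cder U n F : Prop := if n is m.+1 then
  exists2 G : R -> R, (forall t, U t -> is_derive t 1 F (G t)) & Cder U m G else True.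

Definition Csmooth U F := forall n, Cder U n F.

Lemma Cder_eq U n F G : open U -> (forall t, U t -> F t = G t) ->
  Cder U n F -> Cder U n G.
Proof.
elim: n F G => [//|n ih] F G oU FG [F' dF CF']; exists F' => // t Ut.
apply: near_eq_is_derive (dF t Ut).
move: oU; rewrite openE => /(_ _ Ut) nU.
by near=> s; rewrite FG//; near: s.
Unshelve. all: by end_near. Qed.

Lemma Cder_le U n F : Cder U n.+1 F -> Cder U n F.
Proof. by elim: n F => [//|n ih] F [F' dF CF']; exists F' => //; exact: ih. Qed.

Lemma Cder_sub U V n F : V `<=` U -> Cder U n F -> Cder V n F.
Proof.
move=> VU; elim: n F => [//|n ih] F [F' dF CF']; exists F'; last exact: ih.
by move=> t /VU; exact: dF.
Qed.

Lemma Cder_cst U n c : Cder U n (fun=> c).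
Proof.
elim: n c => [//|n ih] c; exists (fun=> 0) => // t _.
exact: is_derive_cst.
Qed.

Lemma Cder_id U n : Cder U n (fun t => t).
Proof.
case: n => [//|n]; exists (fun=> 1); last exact: Cder_cst.
by move=> t _; exact: is_derive_id.
Qed.

Lemma CderD U n F G : Cder U n F -> Cder U n G -> Cder U n (fun t => F t + G t).
Proof.
elim: n F G => [//|n ih] F G [F' dF CF'] [G' dG CG'].
exists (fun t => F' t + G' t); last exact: ih.
by move=> t Ut; apply: is_deriveD; [exact: dF|exact: dG].
Qed.

Lemma CderM U n F G : Cder U n F -> Cder U n G -> Cder U n (fun t => F t * G t).
Proof.
elim: n F G => [//|n ih] F G CF CG.
move: (Cder_le CF) (Cder_le CG).
move: CF CG => [F' dF CF'] [G' dG CG'] CF CG.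
exists (fun t => F t * G' t + G t * F' t); last by apply: CderD; exact: ih.
by move=> t Ut; apply: is_deriveM; [exact: dF|exact: dG].
Qed.

Lemma CderZ U n c F : Cder U n F -> Cder U n (fun t => c * F t).
Proof. by move=> CF; apply: CderM => //; exact: Cder_cst. Qed.

Lemma CderB U n F G : Cder U n F -> Cder U n G -> Cder U n (fun t => F t - G t).
Proof.
move=> CF CG; apply: CderD => //.
have : Cder U n (fun t => -1 * G t) by exact: CderZ.
by under [X in Cder _ _ X]eq_fun do rewrite mulN1r.
Qed.

Lemma CderX U n F k : Cder U n F -> Cder U n (fun t => F t ^+ k).
Proof.
move=> CF; elim: k => [|k ih]; first exact: Cder_cst.
by under [X in Cder _ _ X]eq_fun do rewrite exprS; exact: CderM.
Qed.

Lemma Cder_comp U V n F u : (forall t, V t -> U (u t)) ->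
  Cder U n F -> Cder V n u -> Cder V n (fun t => F (u t)).
Proof.
move=> VU; elim: n F => [//|n ih] F CF Cu.
move: (Cder_le CF) (Cder_le Cu) => CFn Cun.
move: CF Cu => [F' dF CF'] [u' du Cu'].
exists (fun t => F' (u t) * u' t); last by apply: CderM => //; exact: ih.
move=> t Vt.
by have := @is_derive1_comp _ F u t _ _ (dF _ (VU _ Vt)) (du _ Vt).
Qed.

(** The derivatives provided on [U] and on [V] may differ elsewhere; [derive1 F] agrees with each of
    them on its own set and replaces both. *)
Lemma Cder_union U V n F : open U -> open V -> U `|` V = setT ->
  Cder U n F -> Cder V n F -> Cder setT n F.
Proof.
move=> oU oV UV; elim: n F => [//|n ih] F [G dG CG] [H dH CH].
exists (derive1 F).
  move=> t _; have : (U `|` V) t by rewrite UV.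
  by case=> [/dG|/dH] [dF Fe]; apply: DeriveDef; rewrite // derive1E.
apply: ih; [apply: Cder_eq CG => // t /dG|apply: Cder_eq CH => // t /dH];
  by move=> [_ <-]; rewrite derive1E.
Qed.

(** The derivative is a polynomial in [t^-1] itself, so the induction closes by the product rule. *)
Lemma Cder_inv n : Cder [set t | 0 < t] n (fun t : R => t^-1).
Proof.
elim: n => [//|n ih].
exists (fun t => -1 * (t^-1 * t^-1)); last by apply/CderZ/CderM.
move=> t /= t0; have tn0 : t != 0 by rewrite gt_eqF.
have := @is_deriveV _ id t 1 1 tn0 (is_derive_id t 1).
by rewrite mulN1r /GRing.scale/= mulr1 expr2 invfM.
Qed.

Lemma Cder_sqrt n : Cder [set t | 0 < t] n (fun t : R => Num.sqrt t).
Proof.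
elim: n => [//|n ih].
exists (fun t => 2^-1 * (Num.sqrt t)^-1).
  by move=> t /= t0; have := is_derive1_sqrt t0; rewrite invfM.
apply: CderZ; apply: (@Cder_comp [set t | 0 < t]) => //.
- by move=> t /=; rewrite sqrtr_gt0.
- exact: Cder_inv.
Qed.

Lemma Cder_cont U F : Cder U 1 F -> forall t, U t -> {for t, continuous F}.
Proof.
move=> [G dG _] t Ut; apply: differentiable_continuous.
by apply/derivable1_diffP; have [] := dG t Ut.
Qed.

Lemma Csmooth_deriv F : Csmooth setT F ->
  exists2 F' : R -> R, (forall t : R, is_derive t 1 F (F' t)) & Csmooth setT F'.
Proof.
move=> CF; have [F' dF' _] := CF 1; exists F'; first by move=> t; exact: dF'.
move=> n; have [G dG CG] := CF n.+1.
apply: Cder_eq CG; first exact: openT.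
move=> t _; have [_ <-] := dG t I.
by have [_ <-] := dF' t I.
Qed.

(** The classical flat function exp(-1/s), together with the powers of 1/s that its derivatives
    produce. *)
Definition flat m (s : R) := if 0 < s then s^-1 ^+ m * expR (- s^-1) else 0.

(** Raise 1 + x <= exp x at x = s^-1 / (m + 2) to the power m + 2: the exponential beats one power
    of 1/s more than [flat m.+1] contains. *)
Lemma flat_lin m (s : R) : 0 < s -> flat m.+1 s <= (m.+2%:R ^+ m.+2) * s.
Proof.
move=> s0; rewrite /flat s0 expRN ler_pdivrMr ?expR_gt0//.
have h : (s^-1 / m.+2%:R) ^+ m.+2 <= expR s^-1.
  rewrite -[X in expR X](@divfK _ m.+2%:R)// expRM_natr lerXn2r ?nnegrE ?expR_ge0//.
    by rewrite divr_ge0// invr_ge0 ltW.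
  by apply: le_trans (expR_ge1Dx _); rewrite lerDr.
move: h; rewrite expr_div_n ler_pdivrMr ?exprn_gt0// => h.
rewrite exprS in h.
rewrite -(@ler_pM2l _ s^-1) ?invr_gt0//; apply: le_trans h _.
rewrite [leRHS](_ : _ = expR s^-1 * m.+2%:R ^+ m.+2)//.
by field; rewrite gt_eqF.
Qed.

Lemma is_derive_flat m (s : R) : is_derive s 1 (flat m) (- m%:R * flat m.+1 s + flat m.+2 s).
Proof.
have [s0|s0|->] := ltgtP s 0.
- rewrite /flat ltNge (ltW s0)/= mulr0 addr0.
  apply: near_eq_is_derive (is_derive_cst (0 : R) s 1).
  near=> t; rewrite /cst/flat ltNge ltW//=; near: t.
  exact: lt_nbhsl.
- have sn0 : s != 0 by rewrite gt_eqF.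
  apply: (@near_eq_is_derive _ _ _ (fun t : R => t^-1 ^+ m * expR (- t^-1))).
    near=> t; rewrite /flat; case: ifPn => // /negP; case; near: t.
    exact: lt_nbhsr.
  have di := @is_deriveV _ id s 1 1 sn0 (is_derive_id s 1).
  have dm := @is_deriveX _ _ _ m _ _ _ di.
  have dn := @is_deriveN _ _ _ _ _ _ _ di.
  have de := @is_derive1_comp _ expR _ s _ _ (is_derive_expR _) dn.
  have := @is_deriveM _ _ _ _ _ _ _ _ dm de.
  congr (is_derive _ _ _ _); first by apply/funext => t; rewrite !fctE.
  rewrite /flat s0 !fctE /GRing.scale/= mulr1.
  case: m {dm} => [|m]; first by rewrite !exprS expr0 /=; field.
  by rewrite /= !exprS expr0; field.
(* At 0 the difference quotient is [flat m.+1 h] for [h > 0], which [flat_lin] bounds by a multiple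
   of [h], and zero for [h < 0]. *)
- rewrite {2 3}/flat ltxx mulr0 addr0.
  have lim : h^-1 *: (flat m (h *: 1 + 0) - flat m 0) @[h --> (0 : R)^'] --> (0 : R).
    pose K : R := m.+2%:R ^+ m.+2.
    have K0 : 0 < K by rewrite exprn_gt0.
    apply/cvgrPdist_lt => e e0; near=> h.
    have h0 : h != 0 by near: h; exact: nbhs_dnbhs_neq.
    rewrite sub0r normrN addr0 /GRing.scale/= mulr1 {2}/flat ltxx subr0.
    have [hp|hn] := ltP 0 h; last by rewrite /flat [0 < h]ltNge hn/= mulr0 normr0.
    rewrite (_ : h^-1 * flat m h = flat m.+1 h); last by rewrite /flat hp exprS mulrA.
    rewrite ger0_norm; last by rewrite /flat hp mulr_ge0 ?expR_ge0// exprn_ge0// invr_ge0 ltW.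
    apply: le_lt_trans (flat_lin m hp) _; rewrite -/K -ltr_pdivlMl//.
    rewrite -[h]ger0_norm ?ltW//; near: h.
    apply: dnbhs0_lt; last by rewrite mulr_gt0 ?invr_gt0.
  by apply: DeriveDef; [apply/cvg_ex; exists 0|exact: cvg_lim].
Unshelve. all: by end_near. Qed.

Lemma Csmooth_flat m : Csmooth setT (flat m).
Proof.
move=> n; elim: n m => [//|n ih] m.
exists (fun s => - m%:R * flat m.+1 s + flat m.+2 s); first by move=> t _; exact: is_derive_flat.
by apply: CderD => //; exact: CderZ.
Qed.

(** A bump with values in [0, 1], positive exactly on ]a, b[ when [c > 0]. The parameter [c]
    sharpens it: as it grows, the bump tends to the indicator of the open interval. *)
Definition win (a b c x : R) := flat 0 (c * (x - a)) * flat 0 (c * (b - x)).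

Lemma Csmooth_win a b c : Csmooth setT (win a b c).
Proof.
move=> n; apply: CderM.
  apply: (@Cder_comp setT) => //; first exact: Csmooth_flat.
  by apply: CderZ; apply: CderB; [exact: Cder_id|exact: Cder_cst].
apply: (@Cder_comp setT) => //; first exact: Csmooth_flat.
by apply: CderZ; apply: CderB; [exact: Cder_cst|exact: Cder_id].
Qed.

Lemma flat0E s : flat 0 s = if 0 < s then expR (- s^-1) else 0.
Proof. by rewrite /flat expr0 mul1r. Qed.

Lemma flat0_ge0 s : 0 <= flat 0 s.
Proof. by rewrite flat0E; case: ifP => // _; exact: expR_ge0. Qed.

Lemma flat0_le1 s : flat 0 s <= 1.
Proof.
by rewrite flat0E; case: ifP => // s0; rewrite -expR0 ler_expR lerNl oppr0 invr_ge0 ltW.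
Qed.

Lemma flat0_le0 s : s <= 0 -> flat 0 s = 0.
Proof. by rewrite flat0E leNgt => /negbTE ->. Qed.

Lemma flat0_gt0 s : (0 < flat 0 s) = (0 < s).
Proof. by rewrite flat0E; case: ifP => // _; rewrite ?expR_gt0 ?ltxx. Qed.

Lemma win_ge0 a b c x : 0 <= win a b c x.
Proof. by rewrite mulr_ge0// flat0_ge0. Qed.

Lemma win_le1 a b c x : win a b c x <= 1.
Proof. by rewrite -[leRHS]mulr1 ler_pM// ?flat0_ge0 ?flat0_le1. Qed.

Lemma win_gt0 a b c x : 0 < c -> (0 < win a b c x) = (a < x < b).
Proof.
move=> c0; apply/idP/idP => [|/andP[ax xb]]; last first.
  by rewrite mulr_gt0// flat0_gt0 mulr_gt0// subr_gt0.
rewrite /win; have [ax|xa] := ltP a x; last first.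
  by rewrite [flat 0 (c * (x - a))]flat0_le0 ?mul0r ?ltxx// pmulr_rle0// subr_le0.
have [xb|bx] := ltP x b; first by [].
by rewrite [flat 0 (c * (b - x))]flat0_le0 ?mulr0 ?ltxx// pmulr_rle0// subr_le0.
Qed.

Lemma win_eq0 a b c x : 0 < c -> ~~ (a < x < b) -> win a b c x = 0.
Proof.
move=> c0; rewrite -(win_gt0 _ _ _ c0) -leNgt => w0.
by apply/eqP; rewrite eq_le w0 win_ge0.
Qed.

Lemma flat0_cvg1 (u : R^nat) : u @ \oo --> +oo -> flat 0 (u n) @[n --> \oo] --> (1 : R).
Proof.
move=> uoo.
have u0 : \forall n \near \oo, 0 < u n by move/cvgryPgt : uoo; exact.
have h : expR (- (u n)^-1) @[n --> \oo] --> (1 : R).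
  rewrite -expR0; apply: continuous_cvg; first exact: continuous_expR.
  by rewrite -oppr0; apply: cvgN; exact/(gtr0_cvgV0 u0).
apply: cvg_trans h; apply: near_eq_cvg; near=> n.
by rewrite flat0E; case: ifPn => //; rewrite -leNgt leNgt => /negP; case; near: n.
Unshelve. all: by end_near. Qed.

(** The end points may move with [n]; at an interior point of the limit interval both arguments of
    [flat 0] tend to infinity. *)
Lemma win_cvg (a b c : R^nat) (a0 b0 x : R) : a @ \oo --> a0 -> b @ \oo --> b0 ->
  c @ \oo --> +oo -> a0 < x < b0 -> win (a n) (b n) (c n) x @[n --> \oo] --> (1 : R).
Proof.
move=> aa bb coo /andP[ax xb]; rewrite -[X in _ --> X]mulr1.
have coo' (d : R^nat) (d0 : R) : 0 < d0 -> d @ \oo --> d0 -> c n * d n @[n --> \oo] --> +oo.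
  move=> dp dd; apply/cvgryPge => A.
  have d2 : \forall n \near \oo, d0 / 2 < d n.
    by move/cvgrPdist_lt : dd => /(_ (d0 / 2)); rewrite divr_gt0// => /(_ isT);
      apply: filterS => n; rewrite ltr_distl => /andP[]; lra.
  have cA : \forall n \near \oo, `|A| / (d0 / 2) <= c n by move/cvgryPge : coo; exact.
  near=> n.
  apply: le_trans (ler_norm A) _.
  have h : `|A| / (d0 / 2) <= c n by near: n.
  have h' : d0 / 2 < d n by near: n.
  rewrite ler_pdivrMr in h; last by rewrite divr_gt0.
  apply: le_trans h _; apply: ler_wpM2l (ltW h').
  suff : `|A| / (d0 / 2) <= c n by apply: le_trans; rewrite divr_ge0// divr_ge0// ltW.
  by near: n.
by apply: cvgM; apply: flat0_cvg1;
  [apply: (coo' _ (x - a0))|apply: (coo' _ (b0 - x))]; rewrite ?subr_gt0//;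
  apply: cvgB => //; exact: cvg_cst.
Unshelve. all: by end_near. Qed.

End Smooth1.

(** * Smooth functions on the plane *)

Section SmoothPlane.
Variable R : realType.
Implicit Types (f g u : R[i] -> R[i]) (z w : R[i]).

(** A syntactic class that contains every test function constructed explicitly below. Structural
    induction keeps the derivatives in the class, so that smoothness never has to be checked by
    hand. *)
Inductive smoothC : (R[i] -> R[i]) -> Prop :=
| smC_cst c : smoothC (fun=> c)
| smC_id : smoothC (fun z => z)
| smC_J f : smoothC f -> smoothC (fun z => conjc (f z))
| smC_D f g : smoothC f -> smoothC g -> smoothC (fun z => f z + g z)
| smC_M f g : smoothC f -> smoothC g -> smoothC (fun z => f z * g z)
| smC_comp F f : Csmooth setT F -> smoothC f -> smoothC (fun z => (F (Re (f z)))%:C).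

Lemma smC_Z c f : smoothC f -> smoothC (fun z => c * f z).
Proof. by move=> sf; apply: smC_M => //; exact: smC_cst. Qed.

Lemma smC_X f n : smoothC f -> smoothC (fun z => f z ^+ n).
Proof.
move=> sf; elim: n => [|n ih]; first exact: smC_cst.
by under [X in smoothC X]eq_fun do rewrite exprS; exact: smC_M.
Qed.

(** Second derivatives are carried through the induction to obtain the symmetry of mixed ones: the
    same [e] is the zb derivative of [a] and the z derivative of [b]. *)
Lemma smC_wdiff f : smoothC f -> exists a b, [/\ smoothC a, smoothC b,
  (forall z, wdiff f z (a z) (b z)) &
  exists c e d, [/\ forall z, wdiff a z (c z) (e z) & forall z, wdiff b z (e z) (d z)]].
Proof.
elim=> {f} [c||f sf [a [b [sa sb df [c [e [d [da db]]]]]]]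
  |f g sf [a [b [sa sb df [c [e [d [da db]]]]]]] sg [a' [b' [sa' sb' dg [c' [e' [d' [da' db']]]]]]]
  |f g sf [a [b [sa sb df [c [e [d [da db]]]]]]] sg [a' [b' [sa' sb' dg [c' [e' [d' [da' db']]]]]]]
  |F f CF sf [a [b [sa sb df [c [e [d [da db]]]]]]]].
- exists (fun=> 0), (fun=> 0); split; try exact: smC_cst.
    by move=> z; exact: wdiff_cst.
  by exists (fun=> 0), (fun=> 0), (fun=> 0); split => z; exact: wdiff_cst.
- exists (fun=> 1), (fun=> 0); split; try exact: smC_cst.
    by move=> z; exact: wdiff_id.
  by exists (fun=> 0), (fun=> 0), (fun=> 0); split => z; exact: wdiff_cst.
- exists (fun z => conjc (b z)), (fun z => conjc (a z)); split; try exact: smC_J.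
    by move=> z; exact: wdiffJ.
  by exists (fun z => conjc (d z)), (fun z => conjc (e z)), (fun z => conjc (c z)); split=> z; exact: wdiffJ.
- exists (fun z => a z + a' z), (fun z => b z + b' z); split; try exact: smC_D.
    by move=> z; exact: wdiffD.
  exists (fun z => c z + c' z), (fun z => e z + e' z), (fun z => d z + d' z).
  by split => z; exact: wdiffD.
- exists (fun z => a z * g z + f z * a' z), (fun z => b z * g z + f z * b' z); split.
  + by apply: smC_D; exact: smC_M.
  + by apply: smC_D; exact: smC_M.
  + by move=> z; exact: wdiffM.
  exists (fun z => (c z * g z + a z * a' z) + (a z * a' z + f z * c' z)),
    (fun z => (e z * g z + a z * b' z) + (b z * a' z + f z * e' z)),
    (fun z => (d z * g z + b z * b' z) + (b z * b' z + f z * d' z)).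
  split => z.
    by apply: wdiffD; exact: wdiffM.
  have -> : e z * g z + a z * b' z + (b z * a' z + f z * e' z) =
            e z * g z + b z * a' z + (a z * b' z + f z * e' z) by ring.
  by apply: wdiffD; exact: wdiffM.
- have [F1 dF CF1] := Csmooth_deriv CF.
  have [F2 dF1 CF2] := Csmooth_deriv CF1.
  pose A z := (a z + conjc (b z)) / 2; pose B z := (b z + conjc (a z)) / 2.
  have sA : smoothC A by apply: smC_M; [apply: smC_D => //; exact: smC_J|exact: smC_cst].
  have sB : smoothC B by apply: smC_M; [apply: smC_D => //; exact: smC_J|exact: smC_cst].
  exists (fun z => (F1 (Re (f z)))%:C * A z), (fun z => (F1 (Re (f z)))%:C * B z).
  split; try by apply: smC_M => //; exact: smC_comp.
    by move=> z; apply: wdiff_comp.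
  have dA z : wdiff A z ((c z + conjc (d z)) / 2) ((e z + conjc (e z)) / 2).
    have -> : A = (fun w => 2^-1 * (a w + conjc (b w))).
      by apply/funext => w; rewrite /A mulrC.
    by rewrite mulrC [X in wdiff _ _ _ X]mulrC; apply/wdiffZ/wdiffD => //; exact: wdiffJ.
  have dB z : wdiff B z ((e z + conjc (e z)) / 2) ((d z + conjc (c z)) / 2).
    have -> : B = (fun w => 2^-1 * (b w + conjc (a w))).
      by apply/funext => w; rewrite /B mulrC.
    by rewrite mulrC [X in wdiff _ _ _ X]mulrC; apply/wdiffZ/wdiffD => //; exact: wdiffJ.
  have dF1f z : wdiff (fun w => (F1 (Re (f w)))%:C) z ((F2 (Re (f z)))%:C * A z) ((F2 (Re (f z)))%:C * B z).
    by apply: wdiff_comp.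
  eexists (fun z => (F2 (Re (f z)))%:C * A z * A z + (F1 (Re (f z)))%:C * _),
    (fun z => (F2 (Re (f z)))%:C * B z * A z + (F1 (Re (f z)))%:C * _),
    (fun z => (F2 (Re (f z)))%:C * B z * B z + (F1 (Re (f z)))%:C * _).
  split => z; first exact: wdiffM.
  rewrite [(F2 _)%:C * B z * A z]mulrAC.
  exact: wdiffM.
Qed.

Lemma smC_partial f : smoothC f ->
  [/\ smoothC (partial_z f), smoothC (partial_zbar f),
      forall z, wdiff f z (partial_z f z) (partial_zbar f z) &
      partial_zbar (partial_z f) = partial_z (partial_zbar f)].
Proof.
move=> /smC_wdiff[a [b [sa sb df [c [e [d [da db]]]]]]].
have -> : partial_z f = a by apply/funext => z; exact: wdiff_partial_z (df z).
have -> : partial_zbar f = b by apply/funext => z; exact: wdiff_partial_zbar (df z).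
split => //; apply/funext => z.
by rewrite (wdiff_partial_zbar (da z)) (wdiff_partial_z (db z)).
Qed.

Lemma smC_cont f z : smoothC f -> ccont f z.
Proof. by move=> /smC_partial[_ _ df _]; exact: wdiff_cont (df z). Qed.

Lemma smC_Cn f n : smoothC f -> Cn_on setT n f.
Proof.
elim: n f => [|n ih] f sf /=; first by move=> z _; apply/ccontP; exact: smC_cont.
have [sz szb df _] := smC_partial sf.
split.
- by move=> z _; split; [case: (wdiff_x (df z))|case: (wdiff_y (df z))].
- rewrite (_ : partial_x f = fun z => partial_z f z + partial_zbar f z).
    by apply: ih; exact: smC_D.
  by apply/funext => z; case: (wdiff_x (df z)).
- rewrite (_ : partial_y f = fun z => Ci R * (partial_z f z + -1 * partial_zbar f z)).
    by apply: ih; apply/smC_Z/smC_D => //; exact: smC_Z.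
  by apply/funext => z; rewrite mulN1r; case: (wdiff_y (df z)).
Qed.

Lemma pderive_lin (v : R * R) f g a b z : pderivable v f z -> pderivable v g z ->
  pderivable v (fun w => a * f w + b * g w) z /\
  pderive v (fun w => a * f w + b * g w) z = a * pderive v f z + b * pderive v g z.
Proof.
move=> [rf jf] [rg jg].
have Ree : re_plane (fun w => a * f w + b * g w) =
    (Re a *: re_plane f - Im a *: im_plane f) + (Re b *: re_plane g - Im b *: im_plane g).
  by apply/funext => p; rewrite !fctE /re_plane /im_plane ReD !ReM.
have Ime : im_plane (fun w => a * f w + b * g w) =
    (Re a *: im_plane f + Im a *: re_plane f) + (Re b *: im_plane g + Im b *: re_plane g).
  by apply/funext => p; rewrite !fctE /re_plane /im_plane ImD !ImM.
have drf := @derivableP _ _ _ _ _ _ rf; have djf := @derivableP _ _ _ _ _ _ jf.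
have drg := @derivableP _ _ _ _ _ _ rg; have djg := @derivableP _ _ _ _ _ _ jg.
have [rd rv] := is_deriveD (is_deriveB (is_deriveZ (Re a) drf) (is_deriveZ (Im a) djf))
  (is_deriveB (is_deriveZ (Re b) drg) (is_deriveZ (Im b) djg)).
have [jd jv] := is_deriveD (is_deriveD (is_deriveZ (Re a) djf) (is_deriveZ (Im a) drf))
  (is_deriveD (is_deriveZ (Re b) djg) (is_deriveZ (Im b) drg)).
split; first by split; [rewrite Ree|rewrite Ime].
apply: eqC; rewrite ?(ReD,ImD,ReM,ImM)/=; first by rewrite Ree.
by rewrite Ime.
Qed.

(** An arbitrary test function is known to be [Cn_on] but not to lie in [smoothC]. Wirtinger
    derivatives are combinations of partial derivatives, so this makes them test functions again. *)
Lemma Cn_lin n f g a b : Cn_on setT n f -> Cn_on setT n g ->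
  Cn_on setT n (fun z => a * f z + b * g z).
Proof.
elim: n f g => [|n ih] f g /=.
  move=> cf cg z _; apply/ccontP; apply: ccontD; apply: ccontM; try exact: ccont_cst.
    by apply/ccontP; exact: cf.
  by apply/ccontP; exact: cg.
move=> [df fx fy] [dg gx gy].
split.
- move=> z _; have [fxz fyz] := df z I; have [gxz gyz] := dg z I.
  by split; [have [] := pderive_lin a b fxz gxz|have [] := pderive_lin a b fyz gyz].
- rewrite (_ : partial_x _ = fun z => a * partial_x f z + b * partial_x g z); first exact: ih.
  apply/funext => z; have [fxz _] := df z I; have [gxz _] := dg z I.
  by have [] := pderive_lin a b fxz gxz.
- rewrite (_ : partial_y _ = fun z => a * partial_y f z + b * partial_y g z); first exact: ih.
  apply/funext => z; have [_ fyz] := df z I; have [_ gyz] := dg z I.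
  by have [] := pderive_lin a b fyz gyz.
Qed.

Lemma Cn_partial_z n f : Cn_on setT n.+1 f -> Cn_on setT n (partial_z f).
Proof.
move=> [_ fx fy].
rewrite (_ : partial_z f = fun z => 2^-1 * partial_x f z + (- Ci R / 2) * partial_y f z).
  exact: Cn_lin.
by apply/funext => z; rewrite /partial_z -/(Ci R); field; exact: isT.
Qed.

Lemma Cn_partial_zbar n f : Cn_on setT n.+1 f -> Cn_on setT n (partial_zbar f).
Proof.
move=> [_ fx fy].
rewrite (_ : partial_zbar f = fun z => 2^-1 * partial_x f z + (Ci R / 2) * partial_y f z).
  exact: Cn_lin.
by apply/funext => z; rewrite /partial_zbar -/(Ci R); field; exact: isT.
Qed.

End SmoothPlane.

(** * Green's formula on squares by bisection *)

Lemma max_of_four (R : realFieldType) (F x1 x2 x3 x4 : R) : F <= x1 + x2 + (x3 + x4) ->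
  4 * x1 < F -> 4 * x2 < F -> 4 * x3 < F -> 4 * x4 < F -> False.
Proof. lra. Qed.

Section GreenGoursat.
Variable R : realType.
Notation mu := (@lebesgue_measure R).
Notation mu2 := (leb2 R).
Implicit Types (a b c s t : R) (f g : R -> R).

(** Measurability refers to the product sigma-algebra. Rounding the first coordinate down to a
    multiple of 1/(n + 1) gives [fn], which is measurable on each of countably many strips and tends
    to [f] pointwise. *)
Lemma measurable_continuous2 (f : R * R -> R) : continuous f -> measurable_fun setT f.
Proof.
move=> cf.
pose k (n : nat) (x : R) := Num.floor (n.+1%:R * x).
pose fn (n : nat) (p : R * R) := f ((k n p.1)%:~R / n.+1%:R, p.2).
have c2 x : continuous (fun y => f (x, y)).
  move=> y; apply: (@continuous_comp _ _ _ (fun y => (x, y)) f); last exact: cf.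
  exact: (cvg_pair (cvg_cst x) (@cvg_id _ (nbhs y))).
apply: (@measurable_fun_cvg _ _ _ _ fn) => [n _ Y mY|[x y] _].
  rewrite setTI.
  have -> : fn n @^-1` Y = \bigcup_(j : int)
      ([set x | k n x = j] `*` [set y | Y (f (j%:~R / n.+1%:R, y))]).
    apply/seteqP; split=> [[x y] /= Yf|[x y] /= [j _ []] /= <- //].
    by exists (k n x).
  apply: countable_bigcupT_measurable => [|j]; first exact: countableP.
  apply: measurableX.
    rewrite (_ : [set x | _] = [set` `[j%:~R / n.+1%:R, (j+1)%:~R / n.+1%:R[]).
      exact: measurable_itv.
    apply/seteqP; split=> x; rewrite /k /= in_itv/=.
      move=> <-; rewrite ler_pdivrMr// ltr_pdivlMr// mulrC.
      exact: floor_itv.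
    rewrite ler_pdivrMr// ltr_pdivlMr// mulrC => h.
    by apply: floor_def.
  rewrite -[X in measurable X]setTI.
  exact: (continuous_measurable_fun (c2 (j%:~R / n.+1%:R))).
rewrite /fn/=; apply: (@continuous_cvg _ _ _ _ _ _ f); first exact: cf.
apply: (@cvg_pair _ _ _ _ (nbhs x) (nbhs y)); last exact: cvg_cst.
apply/cvgrPdist_le => e e0; near=> n.
rewrite -[X in X - _](@mulfK _ n.+1%:R)// -mulrBl normrM normfV [`|n.+1%:R|]ger0_norm//.
have /andP[h1 h2] := floor_itv (n.+1%:R * x).
rewrite ler_pdivrMr// ler_norml.
have en : 1 <= e * n.+1%:R.
  rewrite mulrC -ler_pdivrMr// div1r -natr1 -lerBlDr; near: n.
  by apply: nbhs_infty_ger.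
rewrite intrD in h2; rewrite /k [x * _]mulrC.
apply/andP; split; lra.
Unshelve. all: by end_near. Qed.

Lemma bounded_continuous2 (f : R * R -> R) a b c d : continuous f ->
  exists M, forall x y, a <= x <= b -> c <= y <= d -> `|f (x, y)| <= M.
Proof.
move=> cf.
have cp : compact (f @` ([set` `[a, b]] `*` [set` `[c, d]])).
  apply: continuous_compact; first exact: continuous_subspaceT.
  by apply: compact_setX; exact: segment_compact.
have [M [_ MP]] := compact_bounded cp.
exists (M + 1) => x y xab ycd; apply: (MP (M + 1)); first by rewrite ltrDl.
by exists (x, y) => //; split; rewrite /= in_itv.
Qed.

(** Half-open, so that bisection yields disjoint pieces with nothing left over. *)
Definition hitv a s : set R := [set` `[a, a + s[].

Lemma measurable_hitv a s : measurable (hitv a s). Proof. exact: measurable_itv. Qed.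

Lemma hitv_split a s t : 0 < s -> 0 < t -> hitv a (s + t) = hitv a s `|` hitv (a + s) t.
Proof.
move=> s0 t0; apply/seteqP; split=> x; rewrite /hitv/= !in_itv/=.
  move=> /andP[ax xs]; have [xas|asx] := ltP x (a + s); [left|right].
    by rewrite ax.
  by rewrite -addrA xs.
move=> [/andP[ax xs]|/andP[asx xs]].
  by rewrite ax (lt_trans xs)// addrA ltrDl.
by rewrite addrA xs andbT (le_trans _ asx)// lerDl ltW.
Qed.

Lemma hitv_disj a s t : hitv a s `&` hitv (a + s) t = set0.
Proof.
apply/seteqP; split=> x //; rewrite /hitv/= !in_itv/= => -[/andP[_ h] /andP[h' _]].
by move: h; rewrite ltNge h'.
Qed.

Lemma hitv_measure a s : 0 < s -> mu (hitv a s) = s%:E.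
Proof.
move=> s0; rewrite /hitv lebesgue_measure_itv/= lte_fin ltrDl s0.
by rewrite -EFinB addrAC subrr add0r.
Qed.

Lemma integrable_hitv f a s : continuous f -> mu.-integrable (hitv a s) (EFin \o f).
Proof.
move=> cf; have h : mu.-integrable [set` `[a, a + s]] (EFin \o f).
  apply: continuous_compact_integrable; first exact: segment_compact.
  exact: continuous_subspaceT.
apply: integrableS h; try exact: measurable_itv.
by apply: subset_itvl; rewrite bnd_simp.
Qed.

Lemma Rint_hitv_split f a s t : continuous f -> 0 < s -> 0 < t ->
  \int[mu]_(x in hitv a (s + t)) f x =
  \int[mu]_(x in hitv a s) f x + \int[mu]_(x in hitv (a + s) t) f x.
Proof.
move=> cf s0 t0; have := @integrable_hitv f a (s + t) cf.
rewrite hitv_split// => h; rewrite Rintegral_setU//; try exact: measurable_hitv.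
by apply/disj_setPS; rewrite hitv_disj.
Qed.

Lemma square_measure a b s t : 0 < s -> 0 < t -> mu2 (hitv a s `*` hitv b t) = (s * t)%:E.
Proof.
move=> s0 t0; transitivity (mu (hitv a s) * mu (hitv b t))%E; last first.
  by rewrite !hitv_measure// -EFinM.
by apply: product_measure1E; exact: measurable_hitv.
Qed.

Lemma setUXl (S T : Type) (A B : set S) (C : set T) : (A `|` B) `*` C = A `*` C `|` B `*` C.
Proof.
apply/seteqP; split => -[x y] /=; first by move=> [[Ax|Bx] Cy]; [left|right].
by move=> [[Ax Cy]|[Bx Cy]]; split => //; [left|right].
Qed.

Lemma setUXr (S T : Type) (A B : set S) (C : set T) : C `*` (A `|` B) = C `*` A `|` C `*` B.
Proof.
apply/seteqP; split => -[x y] /=; first by move=> [Cx [Ay|By]]; [left|right].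
by move=> [[Cx Ay]|[Cx By]]; split => //; [left|right].
Qed.

Lemma integrable_square (f : R * R -> R) a b s t : continuous f -> 0 < s -> 0 < t ->
  mu2.-integrable (hitv a s `*` hitv b t) (EFin \o f).
Proof.
move=> cf s0 t0; have [M MP] := @bounded_continuous2 f a (a + s) b (b + t) cf.
apply: measurable_bounded_integrable.
- by apply: measurableX; exact: measurable_hitv.
- rewrite (_ : _ (_ `*` _) = (s * t)%:E) ?ltry//; exact: square_measure.
- by apply: measurable_funTS; exact: measurable_continuous2.
- exists M; split; first by rewrite num_real.
  move=> N MN [x y] /= []; rewrite /hitv/= !in_itv/= => /andP[ax xs] /andP[by_ yt].
  by apply: le_trans (ltW MN); apply: MP; rewrite ?ax ?by_/= ltW.
Qed.

Lemma Rint_square_splitl (f : R * R -> R) a b s s' t : continuous f ->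
  0 < s -> 0 < s' -> 0 < t ->
  \int[mu2]_(x in hitv a (s + s') `*` hitv b t) f x =
  \int[mu2]_(x in hitv a s `*` hitv b t) f x + \int[mu2]_(x in hitv (a + s) s' `*` hitv b t) f x.
Proof.
move=> cf s0 s'0 t0; have := @integrable_square f a b (s + s') t cf.
rewrite hitv_split// setUXl => h; rewrite Rintegral_setU//.
- by apply: measurableX; exact: measurable_hitv.
- by apply: measurableX; exact: measurable_hitv.
- by apply: h => //; rewrite addr_gt0.
- by apply/disj_setPS; rewrite -setXI hitv_disj set0X.
Qed.

Lemma Rint_square_splitr (f : R * R -> R) a b s t t' : continuous f ->
  0 < s -> 0 < t -> 0 < t' ->
  \int[mu2]_(x in hitv a s `*` hitv b (t + t')) f x =
  \int[mu2]_(x in hitv a s `*` hitv b t) f x + \int[mu2]_(x in hitv a s `*` hitv (b + t) t') f x.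
Proof.
move=> cf s0 t0 t'0; have := @integrable_square f a b s (t + t') cf.
rewrite hitv_split// setUXr => h; rewrite Rintegral_setU//.
- by apply: measurableX; exact: measurable_hitv.
- by apply: measurableX; exact: measurable_hitv.
- by apply: h => //; rewrite addr_gt0.
- by apply/disj_setPS; rewrite -setXI hitv_disj setX0.
Qed.

Lemma Rint_near d (T : measurableType d) (nu : {measure set T -> \bar R}) (D : set T)
    (f : T -> R) (k e m : R) : measurable D -> nu D = m%:E -> 0 <= m ->
  nu.-integrable D (EFin \o f) -> (forall x, D x -> `|f x - k| <= e) ->
  `|\int[nu]_(x in D) f x - k * m| <= e * m.
Proof.
move=> mD nuD m0 fi fk.
have ci (r : R) : nu.-integrable D (EFin \o cst r).
  apply: measurable_bounded_integrable => //; first by rewrite nuD ltry.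
  exists `|r|; split; first exact: num_real.
  by move=> M /ltW rM x _.
have cE (r : R) : \int[nu]_(x in D) r = r * m by rewrite Rintegral_cst// nuD.
have im : nu.-integrable D (EFin \o (fun x => f x - k)).
  have -> : EFin \o (fun x => f x - k) = (fun x => (EFin \o f) x - (EFin \o cst k) x)%E.
    by apply/funext.
  exact: integrableB.
rewrite -!cE -RintegralB//; last exact: (ci k).
apply: le_trans (le_normr_Rintegral mD im) _.
apply: le_Rintegral => //; last exact: (ci e).
by have := integrable_norm im; exact.
Qed.

Variables P Q w : R * R -> R.
Hypotheses (cP : continuous P) (cQ : continuous Q) (cw : continuous w).

(** The outward flux of the field [(P, Q)] through the boundary of a square with lower left corner
    [(a, c)], minus the integral of the expected divergence [w]. Green's formula is its
    vanishing. *)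
Definition flux a c s :=
  \int[mu]_(y in hitv c s) P (a + s, y) - \int[mu]_(y in hitv c s) P (a, y) +
  (\int[mu]_(x in hitv a s) Q (x, c + s) - \int[mu]_(x in hitv a s) Q (x, c)) -
  \int[mu2]_(p in hitv a s `*` hitv c s) w p.

Lemma continuous_pairl (f : R * R -> R) x : continuous f -> continuous (fun y => f (x, y)).
Proof.
move=> cf y; apply: (@continuous_comp _ _ _ (fun y => (x, y)) f); last exact: cf.
exact: (cvg_pair (cvg_cst x) (@cvg_id _ (nbhs y))).
Qed.

Lemma continuous_pairr (f : R * R -> R) y : continuous f -> continuous (fun x => f (x, y)).
Proof.
move=> cf x; apply: (@continuous_comp _ _ _ (fun x => (x, y)) f); last exact: cf.
exact: (cvg_pair (@cvg_id _ (nbhs x)) (cvg_cst y)).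
Qed.

Lemma flux_split a c s : 0 < s -> flux a c (s + s) =
  flux a c s + flux (a + s) c s + (flux a (c + s) s + flux (a + s) (c + s) s).
Proof.
move=> s0; rewrite /flux.
have cPx x := @continuous_pairl P x cP; have cQy y := @continuous_pairr Q y cQ.
rewrite (Rint_hitv_split _ (cPx _))// (Rint_hitv_split _ (cPx _))//.
rewrite (Rint_hitv_split _ (cQy _))// (Rint_hitv_split _ (cQy _))//.
rewrite Rint_square_splitl ?addr_gt0// !Rint_square_splitr// !addrA; ring.
Qed.

(** An affine field with divergence [A1 + B2] satisfies Green's formula exactly, so only the errors
    of the first-order expansions at the point and the oscillation of [w] remain. *)
Lemma flux_small (p1 p2 A1 A2 B1 B2 : R) : A1 + B2 = w (p1, p2) ->
  (forall e : R, 0 < e -> exists2 d : R, 0 < d & forall x y, `|x - p1| < d -> `|y - p2| < d ->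
    `|P (x, y) - P (p1, p2) - A1 * (x - p1) - A2 * (y - p2)| <= e * (`|x - p1| + `|y - p2|) /\
    `|Q (x, y) - Q (p1, p2) - B1 * (x - p1) - B2 * (y - p2)| <= e * (`|x - p1| + `|y - p2|)) ->
  forall e : R, 0 < e -> exists2 d : R, 0 < d & forall a c s, 0 < s -> s < d ->
    a <= p1 <= a + s -> c <= p2 <= c + s -> `|flux a c s| <= e * (s * s).
Proof.
move=> AB dPQ e e0.
(* 9 = 4 + 4 + 1: each pair of opposite edges contributes two errors of size 2 s times this, the
   integral of [w] contributes one. *)
have e9 : 0 < e / 9 by rewrite divr_gt0.
have [d1 d10 d1P] := dPQ _ e9.
have [d2 d20 d2P] : exists2 d : R, 0 < d & forall x y, `|x - p1| < d -> `|y - p2| < d ->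
    `|w (x, y) - w (p1, p2)| <= e / 9.
  have /cvgrPdist_le/(_ _ e9) : {for (p1, p2), continuous w} by exact: cw.
  move=> /nbhs_ballP[d /= d0 dP]; exists d => // x y xp yp.
  by rewrite distrC; apply: dP; split; rewrite /ball/= distrC.
exists (Order.min d1 d2); first by rewrite lt_min d10.
move=> a c s s0; rewrite lt_min => /andP[sd1 sd2] /andP[ap pa] /andP[cp pc].
have near1 x : a <= x <= a + s -> `|x - p1| <= s by rewrite ler_norml; lra.
have near2 y : c <= y <= c + s -> `|y - p2| <= s by rewrite ler_norml; lra.
have cPx x := @continuous_pairl P x cP; have cQy y := @continuous_pairr Q y cQ.
have inx x : hitv a s x -> a <= x <= a + s by rewrite /hitv/= in_itv/= => /andP[-> /ltW].
have iny y : hitv c s y -> c <= y <= c + s by rewrite /hitv/= in_itv/= => /andP[-> /ltW].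
have ax0 : a <= a <= a + s by rewrite lexx lerDl ltW.
have ax1 : a <= a + s <= a + s by rewrite lexx lerDl ltW.
have cy0 : c <= c <= c + s by rewrite lexx lerDl ltW.
have cy1 : c <= c + s <= c + s by rewrite lexx lerDl ltW.
have PQ x y : a <= x <= a + s -> c <= y <= c + s ->
    `|P (x, y) - P (p1, p2) - A1 * (x - p1) - A2 * (y - p2)| <= e / 9 * (s + s) /\
    `|Q (x, y) - Q (p1, p2) - B1 * (x - p1) - B2 * (y - p2)| <= e / 9 * (s + s).
  move=> /near1 xs /near2 ys.
  have [h1 h2] := d1P x y (le_lt_trans xs sd1) (le_lt_trans ys sd1).
  by split; [apply: le_trans h1 _|apply: le_trans h2 _]; (apply: ler_wpM2l; first exact: ltW); exact: lerD.
have EP : `|\int[mu]_(y in hitv c s) P (a + s, y) - \int[mu]_(y in hitv c s) P (a, y)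
     - (A1 * s) * s| <= (e / 9 * 4 * s) * s.
  rewrite -RintegralB; [|exact: measurable_hitv|exact: integrable_hitv|exact: integrable_hitv].
  apply: Rint_near; [exact: measurable_hitv|exact: hitv_measure|exact: ltW| |].
    by apply: (@integrable_hitv (fun y => P (a + s, y) - P (a, y))) => y; apply: cvgB; exact: cPx.
  move=> y /iny cy; have [] := PQ _ _ ax0 cy; have [] := PQ _ _ ax1 cy.
  rewrite !ler_norml; lra.
have EQ : `|\int[mu]_(x in hitv a s) Q (x, c + s) - \int[mu]_(x in hitv a s) Q (x, c)
     - (B2 * s) * s| <= (e / 9 * 4 * s) * s.
  rewrite -RintegralB; [|exact: measurable_hitv|exact: integrable_hitv|exact: integrable_hitv].
  apply: Rint_near; [exact: measurable_hitv|exact: hitv_measure|exact: ltW| |].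
    by apply: (@integrable_hitv (fun x => Q (x, c + s) - Q (x, c))) => x; apply: cvgB; exact: cQy.
  move=> x /inx cx; have [_] := PQ _ _ cx cy0; have [_] := PQ _ _ cx cy1.
  rewrite !ler_norml; lra.
have Ew : `|\int[mu2]_(p in hitv a s `*` hitv c s) w p - w (p1, p2) * (s * s)| <= e / 9 * (s * s).
  apply: Rint_near; [|exact: square_measure|by rewrite mulr_ge0// ltW|exact: integrable_square|].
    by apply: measurableX; exact: measurable_hitv.
  by move=> [x y] [/= /inx/near1 xs /iny/near2 ys]; apply: d2P; exact: le_lt_trans sd2.
move: EP EQ Ew; rewrite -AB /flux.
set X := (X in `|X - A1 * s * s|); set Y := (X in `|X - B2 * s * s|).
set Z := Rintegral mu2 _ _; rewrite !ler_norml -!mulrA; set S := s * s.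
rewrite -/X -/Y; move: X Y Z S {cPx cQy PQ ax0 ax1 cy0 cy1 inx iny near1 near2} => X Y Z S.
by clear; lra.
Qed.

(** Differentiability at each point, with a continuous divergence but possibly discontinuous partial
    derivatives. This is what the product of a complex differentiable function and a test function
    offers. *)
Hypothesis dPQ : forall p1 p2 : R, exists A1 A2 B1 B2 : R, A1 + B2 = w (p1, p2) /\
  (forall e : R, 0 < e -> exists2 d : R, 0 < d & forall x y, `|x - p1| < d -> `|y - p2| < d ->
    `|P (x, y) - P (p1, p2) - A1 * (x - p1) - A2 * (y - p2)| <= e * (`|x - p1| + `|y - p2|) /\
    `|Q (x, y) - Q (p1, p2) - B1 * (x - p1) - B2 * (y - p2)| <= e * (`|x - p1| + `|y - p2|)).

Lemma flux_quarter a c s : 0 < s -> exists ac' : R * R,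
  [/\ a <= ac'.1, ac'.1 + s / 2 <= a + s, c <= ac'.2, ac'.2 + s / 2 <= c + s &
      `|flux a c s| <= 4 * `|flux ac'.1 ac'.2 (s / 2)|].
Proof.
move=> s0; have s20 : 0 < s / 2 by rewrite divr_gt0.
have := flux_split a c s20; rewrite -splitr => fE.
apply: contrapT => /forallNP H.
have H' a' c' : a <= a' -> a' + s / 2 <= a + s -> c <= c' -> c' + s / 2 <= c + s ->
    4 * `|flux a' c' (s / 2)| < `|flux a c s|.
  by move=> h1 h2 h3 h4; rewrite ltNge; apply/negP => h; apply: (H (a', c')).
have q1 (x : R) : x + s / 2 <= x + s by rewrite lerD2l ler_pdivrMr// ler_peMr// ?ler1n// ltW.
have q2 (x : R) : x <= x + s / 2 by rewrite lerDl ltW.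
have q3 (x : R) : x + s / 2 + s / 2 <= x + s by rewrite -addrA -splitr.
have h1 := H' a c (lexx _) (q1 _) (lexx _) (q1 _).
have h2 := H' _ c (q2 a) (q3 _) (lexx _) (q1 _).
have h3 := H' a _ (lexx _) (q1 _) (q2 c) (q3 _).
have h4 := H' _ _ (q2 a) (q3 _) (q2 c) (q3 _).
have h0 : `|flux a c s| <= `|flux a c (s / 2)| + `|flux (a + s / 2) c (s / 2)| +
    (`|flux a (c + s / 2) (s / 2)| + `|flux (a + s / 2) (c + s / 2) (s / 2)|).
  rewrite fE; apply: le_trans (ler_normD _ _) _; apply: lerD; exact: ler_normD.
exact: max_of_four h0 h1 h2 h3 h4.
Qed.

(** Along nested quarter squares the flux loses at most a factor 4 per step, whereas at their common
    point [flux_small] bounds it by a small multiple of the area, which shrinks by exactly 4 per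
    step. *)
Lemma flux_eq0 a c s : 0 < s -> flux a c s = 0.
Proof.
move=> s0.
(* Choice is made for all triples at once; the value [(0, 0)] for nonpositive sides is never
   reached. *)
have /choice[T TP] : forall x : R * R * R, exists ac' : R * R, 0 < x.2 ->
  [/\ x.1.1 <= ac'.1, ac'.1 + x.2 / 2 <= x.1.1 + x.2, x.1.2 <= ac'.2,
    ac'.2 + x.2 / 2 <= x.1.2 + x.2 &
      `|flux x.1.1 x.1.2 x.2| <= 4 * `|flux ac'.1 ac'.2 (x.2 / 2)|].
  move=> [[a' c'] s'] /=; have [s'0|s'0] := ltP 0 s'; last by exists (0, 0).
  by have [ac' h] := flux_quarter a' c' s'0; exists ac'.
pose U n := iter n (fun x => (T x, x.2 / 2)) ((a, c), s).
have U2 n : (U n).2 = s / 2 ^+ n.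
  elim: n => [|n ih]; first by rewrite /U /= expr0 divr1.
  by rewrite /U iterS -/(U n) /= ih exprSr invfM mulrA.
have U2p n : 0 < (U n).2 by rewrite U2 divr_gt0// exprn_gt0.
have US n : U n.+1 = (T (U n), (U n).2 / 2) by [].
have UF n : `|flux a c s| <= 4 ^+ n * `|flux (U n).1.1 (U n).1.2 (U n).2|.
  elim: n => [|n ih]; first by rewrite expr0 mul1r.
  apply: le_trans ih _; rewrite exprSr -mulrA ler_wpM2l ?exprn_ge0//.
  by rewrite US /=; have [] := TP _ (U2p n).
have Um1 n m : (U n).1.1 <= (U (m + n)%N).1.1 /\ (U (m + n)%N).1.1 + (U (m + n)%N).2 <= (U n).1.1 + (U n).2.
  elim: m => [//|m [h1 h2]]; rewrite addSn US/=; have [h3 h4 _ _ _] := TP _ (U2p (m + n)%N).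
  by split; [exact: le_trans h3|exact: le_trans h2].
have Um2 n m : (U n).1.2 <= (U (m + n)%N).1.2 /\ (U (m + n)%N).1.2 + (U (m + n)%N).2 <= (U n).1.2 + (U n).2.
  elim: m => [//|m [h1 h2]]; rewrite addSn US/=; have [_ _ h3 h4 _] := TP _ (U2p (m + n)%N).
  by split; [exact: le_trans h3|exact: le_trans h2].
(* In each coordinate the common point is the supremum of the lower corners. *)
have nest (v : R^nat) : (forall n m, v n <= v (m + n)%N /\ v (m + n)%N + (U (m + n)%N).2 <= v n + (U n).2) ->
    exists p : R, forall n, v n <= p <= v n + (U n).2.
  move=> vm; exists (sup (range v)) => n.
  have vub k m : v m <= v k + (U k).2.
    have [km|mk] := leqP k m.
      have [_] := vm k (m - k)%N; rewrite subnK// => h; apply: le_trans h; rewrite lerDl; exact: ltW.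
    have [h _] := vm m (k - m)%N; rewrite subnK ?(ltnW mk)// in h.
    by apply: le_trans h _; rewrite lerDl; exact: ltW.
  apply/andP; split.
    apply: ub_le_sup; last by exists n.
    by exists (v 0 + (U 0).2) => _ [m _ <-]; exact: vub.
  apply: ge_sup; first by exists (v 0), 0%N.
  by move=> _ [m _ <-]; exact: vub.
have [p1 p1P] := nest _ Um1; have [p2 p2P] := nest _ Um2.
have [A1 [A2 [B1 [B2 [AB dP]]]]] := dPQ p1 p2.
apply/eqP; rewrite -normr_eq0 eq_le normr_ge0 andbT.
apply/ler_addgt0Pr => e e0; rewrite add0r.
have e's : 0 < e / (s * s) by rewrite divr_gt0// mulr_gt0.
have [d d0 dfl] := flux_small AB dP e's.
have [n nd] : exists n, s / 2 ^+ n < d.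
  have : s / 2 ^+ n @[n --> \oo] --> (0 : R).
    rewrite -[X in _ --> X](mulr0 s); apply: cvgMr.
    under eq_cvg do rewrite -exprVn; apply: cvg_expr.
    by rewrite ger0_norm ?invr_ge0//; lra.
  move/cvgrPdist_lt => /(_ _ d0)[n _ /(_ n (leqnn n))].
  rewrite sub0r normrN ger0_norm ?divr_ge0 ?exprn_ge0// ?ltW// => h.
  by exists n.
apply: le_trans (UF n) _.
have := dfl _ _ _ (U2p n) _ (p1P n) (p2P n); rewrite U2 => /(_ nd) h.
apply: (@le_trans _ _ (4 ^+ n * (e / (s * s) * (s / 2 ^+ n * (s / 2 ^+ n))))).
  by rewrite ler_wpM2l ?exprn_ge0.
have -> : (4 : R) = 2 * 2 by rewrite -natrM.
rewrite exprMn; set k := 2 ^+ n; have k0 : k != 0 by rewrite expf_neq0.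
rewrite [leLHS](_ : _ = e)//; field; by rewrite k0 gt_eqF.
Qed.

End GreenGoursat.

(** * Integration of complex-valued functions over subsets of the plane *)

Section ComplexIntegral.
Variable R : realType.
Notation mu2 := (leb2 R).
Notation P2 := (measurableTypeR R * measurableTypeR R)%type.
Implicit Types (A : set R[i]) (f g : R[i] -> R[i]) (z w c : R[i]) (h : R[i] -> R).
Local Notation pre A := (of_plane @^-1` A).

Lemma ccont_plane f : (forall z, ccont f z) ->
  continuous (re_plane f) /\ continuous (im_plane f).
Proof.
move=> cf.
have key (e : R) (p : R * R) : 0 < e -> \forall q \near p, cmod (f (of_plane q) - f (of_plane p)) < e.
  move=> e0; have [d d0 dP] := cf (of_plane p) _ e0.
  apply/nbhs_ballP; exists (d / 2); first by rewrite /= divr_gt0.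
  move=> q [/=]; rewrite /ball/= => h1 h2; apply: dP.
  apply: le_lt_trans (cmod_le _) _; rewrite ReB ImB /= [`|q.1 - _|]distrC [`|q.2 - _|]distrC.
  by rewrite [d]splitr ltrD.
split=> p; apply/cvgrPdist_lt => e e0; have := key e p e0; apply: filterS => q.
  by apply: le_lt_trans; rewrite distrC /re_plane -ReB; exact: le_Re_cmod.
by apply: le_lt_trans; rewrite distrC /im_plane -ImB; exact: le_Im_cmod.
Qed.

Lemma ccont_cmod f z : ccont f z -> ccont (fun w => (cmod (f w))%:C) z.
Proof.
move=> fz e /fz[d d0 dP]; exists d => // w /dP; apply: le_lt_trans.
rewrite -rcB cmod_real ler_distl lerBlDr; apply/andP; split.
  by rewrite cmodB -[X in cmod X <= _](subrK (f w)) addrC; exact: le_cmodD.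
by rewrite -[X in cmod X <= _](subrK (f z)) addrC; exact: le_cmodD.
Qed.

Lemma cmeas_cont A f : (forall z, ccont f z) -> cmeasurable A f.
Proof.
move=> /ccont_plane[c1 c2].
by split; apply: measurable_funTS; exact: measurable_continuous2.
Qed.

Lemma measurable_cmod : measurable_fun setT (fun p : R * R => cmod (of_plane p)).
Proof.
have [] : continuous (re_plane (fun z => (cmod z)%:C)) /\ continuous (im_plane (fun z : R[i] => (cmod z)%:C)).
  by apply: ccont_plane => z; apply: ccont_cmod; exact: ccont_id.
by move=> /measurable_continuous2.
Qed.

Lemma measurable_ball r : measurable (pre [set z : R[i] | cmod z < r]).
Proof.
rewrite [X in measurable X](_ : _ = (fun p : R * R => cmod (of_plane p)) @^-1` [set` `]-oo, r[]).
  by rewrite -[X in measurable X]setTI; apply: measurable_cmod => //; exact: measurable_itv.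
by apply/seteqP; split=> p; rewrite /= in_itv.
Qed.

Lemma measurable_disc : @measurable _ P2 (pre (disc R)).
Proof. exact: measurable_ball. Qed.

Lemma cmeas_cst A c : cmeasurable A (fun=> c).
Proof. by split; exact: measurable_cst. Qed.

Lemma cmeasD A f g : cmeasurable A f -> cmeasurable A g -> cmeasurable A (fun z => f z + g z).
Proof.
move=> [rf jf] [rg jg]; split.
  apply: eq_measurable_fun (measurable_funD rf rg) => p _.
  by rewrite /= /re_plane ReD.
apply: eq_measurable_fun (measurable_funD jf jg) => p _.
by rewrite /= /im_plane ImD.
Qed.

Lemma cmeasM A f g : cmeasurable A f -> cmeasurable A g -> cmeasurable A (fun z => f z * g z).
Proof.
move=> [rf jf] [rg jg]; split.
  apply: eq_measurable_fun (measurable_funB (measurable_funM rf rg) (measurable_funM jf jg)) => p _.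
  by rewrite /= /re_plane ReM.
apply: eq_measurable_fun (measurable_funD (measurable_funM rf jg) (measurable_funM jf rg)) => p _.
by rewrite /= /im_plane ImM.
Qed.

Lemma cmeasZ A c f : cmeasurable A f -> cmeasurable A (fun z => c * f z).
Proof. by move=> mf; apply: cmeasM => //; exact: cmeas_cst. Qed.

Lemma cmeasB A f g : cmeasurable A f -> cmeasurable A g -> cmeasurable A (fun z => f z - g z).
Proof.
move=> mf mg; have : cmeasurable A (fun z => f z + (-1) * g z) by apply: cmeasD => //; exact: cmeasZ.
by under [X in cmeasurable _ X]eq_fun do rewrite mulN1r.
Qed.

Lemma cmeasJ A f : cmeasurable A f -> cmeasurable A (fun z => conjc (f z)).
Proof.
move=> [rf jf]; split.
  by rewrite [X in measurable_fun _ X](_ : _ = re_plane f)//; apply/funext => p; rewrite /re_plane ReJ.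
apply: eq_measurable_fun (measurable_funM (measurable_cst (-1 : R)) jf) => p _.
by rewrite /= /im_plane ImJ mulN1r.
Qed.

Lemma cmeas_real A h : measurable_fun (pre A) (fun p => h (of_plane p)) ->
  cmeasurable A (fun z => (h z)%:C).
Proof. by move=> mh; split => //; exact: measurable_cst. Qed.

Lemma cmeas_sqr A f : cmeasurable A f -> measurable_fun (pre A) (fun p => cmod (f (of_plane p)) ^+ 2).
Proof.
move=> [rf jf]; rewrite [X in measurable_fun _ X](_ : _ = fun p => re_plane f p ^+ 2 + im_plane f p ^+ 2).
  by apply: measurable_funD; exact: measurable_funX.
by apply/funext => p; rewrite sqr_cmod.
Qed.

Lemma cmeas_cmod A f : cmeasurable A f -> measurable_fun (pre A) (fun p => cmod (f (of_plane p))).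
Proof.
move=> mf; rewrite [X in measurable_fun _ X](_ : _ = (@Num.sqrt R) \o fun p => cmod (f (of_plane p)) ^+ 2).
  apply: measurableT_comp; last exact: cmeas_sqr.
  by apply: continuous_measurable_fun; exact: sqrt_continuous.
by apply/funext => p /=; rewrite sqrtr_sqr ger0_norm// cmod_ge0.
Qed.

Lemma eq_cmeas A f g : (forall z, A z -> f z = g z) -> cmeasurable A f -> cmeasurable A g.
Proof.
move=> fg [rf jf]; split.
  by apply: eq_measurable_fun rf => p; rewrite inE /re_plane => /fg ->.
by apply: eq_measurable_fun jf => p; rewrite inE /im_plane => /fg ->.
Qed.

Lemma cmeasS A B f : measurable (pre B) -> A `<=` B -> cmeasurable B f -> cmeasurable A f.
Proof.
move=> mB AB [rf jf]; split; [apply: measurable_funS rf|apply: measurable_funS jf] => // p /=;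
  exact: AB.
Qed.

Lemma cmeas_lim A (f : nat -> R[i] -> R[i]) g : (forall n, cmeasurable A (f n)) ->
  (forall z, A z -> cmod (f n z - g z) @[n --> \oo] --> (0 : R)) -> cmeasurable A g.
Proof.
move=> mf fg; split.
  apply: (@measurable_fun_cvg _ _ _ _ (fun n => re_plane (f n))).
    by move=> n; case: (mf n).
  move=> p Ap; apply/cvgrPdist_lt => e e0.
  have /cvgrPdist_lt/(_ e e0) := fg _ Ap; apply: filterS => n.
  rewrite sub0r normrN ger0_norm ?cmod_ge0//; apply: le_lt_trans.
  by rewrite distrC /re_plane -ReB; exact: le_Re_cmod.
apply: (@measurable_fun_cvg _ _ _ _ (fun n => im_plane (f n))).
  by move=> n; case: (mf n).
move=> p Ap; apply/cvgrPdist_lt => e e0.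
have /cvgrPdist_lt/(_ e e0) := fg _ Ap; apply: filterS => n.
rewrite sub0r normrN ger0_norm ?cmod_ge0//; apply: le_lt_trans.
by rewrite distrC /im_plane -ImB; exact: le_Im_cmod.
Qed.

(* Lebesgue measure lives on a type whose sigma-algebra is only convertible to that of R. *)
Lemma cmeas_leb A f : cmeasurable A f ->
  @measurable_fun _ _ P2 R (pre A) (re_plane f) /\ @measurable_fun _ _ P2 R (pre A) (im_plane f).
Proof. by move=> [rf jf]; split; [exact: rf|exact: jf]. Qed.

Lemma leb_cmeas A f : @measurable_fun _ _ P2 R (pre A) (re_plane f) ->
  @measurable_fun _ _ P2 R (pre A) (im_plane f) -> cmeasurable A f.
Proof. by move=> rf jf; split; [exact: rf|exact: jf]. Qed.

Lemma cmeas_cmod_leb A f : cmeasurable A f ->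
  @measurable_fun _ _ P2 R (pre A) (fun p => cmod (f (of_plane p))).
Proof. by move=> mf; exact: (cmeas_cmod mf). Qed.

Definition cintble A f := mu2.-integrable (pre A) (EFin \o re_plane f) /\
  mu2.-integrable (pre A) (EFin \o im_plane f).

Variable A : set R[i].
Hypothesis mA : @measurable _ P2 (pre A).

Lemma eq_cint f g : (forall z, A z -> f z = g z) -> cint A f = cint A g.
Proof.
move=> fg; congr (_ +i* _); apply: eq_Rintegral => p; rewrite inE => /= Ap.
  by rewrite /re_plane fg.
by rewrite /im_plane fg.
Qed.

Lemma cintble_meas f : cintble A f -> cmeasurable A f.
Proof.
by move=> [/measurable_int/measurable_EFinP ? /measurable_int/measurable_EFinP ?]; exact: leb_cmeas.
Qed.

Lemma cintble_dom f h : cmeasurable A f ->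
  mu2.-integrable (pre A) (fun p => (h (of_plane p))%:E) ->
  (forall z, A z -> cmod (f z) <= h z) -> cintble A f.
Proof.
move=> /cmeas_leb[rf jf] ih fh; split; apply: (le_integrable mA _ _ ih).
- exact/measurable_EFinP.
- move=> p Ap /=; rewrite lee_fin; apply: le_trans (le_Re_cmod _) _.
  by apply: le_trans (fh _ Ap) _; exact: ler_norm.
- exact/measurable_EFinP.
- move=> p Ap /=; rewrite lee_fin; apply: le_trans (le_Im_cmod _) _.
  by apply: le_trans (fh _ Ap) _; exact: ler_norm.
Qed.

Lemma cintble_cmod f : cintble A f ->
  mu2.-integrable (pre A) (fun p => (cmod (f (of_plane p)))%:E).
Proof.
move=> fi; have [ri ji] := fi.
apply: (le_integrable mA _ _ (integrableD mA (integrable_abse ri) (integrable_abse ji))).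
  by apply/measurable_EFinP; apply: cmeas_cmod_leb; exact: cintble_meas.
move=> p Ap; rewrite /= lee_fin.
rewrite ger0_norm ?cmod_ge0// ger0_norm ?addr_ge0//.
exact: cmod_le.
Qed.

Lemma cintble_dom_fin f h : cmeasurable A f ->
  @measurable_fun _ _ P2 R (pre A) (fun p => h (of_plane p)) ->
  (forall z, A z -> cmod (f z) <= h z) -> (eint A h < +oo)%E -> cintble A f.
Proof.
move=> mf mh fh hfin; apply: (cintble_dom mf _ fh).
apply/integrableP; split; first exact/measurable_EFinP.
rewrite (le_lt_trans _ hfin)//; apply: ge0_le_integral => //.
- by apply/measurable_EFinP; exact: measurableT_comp.
- exact/measurable_EFinP.
- by move=> p Ap; rewrite lee_fin ger0_norm// (le_trans (cmod_ge0 _) (fh _ Ap)).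
Qed.

Lemma cintbleD f g : cintble A f -> cintble A g -> cintble A (fun z => f z + g z).
Proof.
move=> [rf jf] [rg jg]; split.
  rewrite [X in _.-integrable _ X](_ : _ = fun p => (re_plane f p)%:E + (re_plane g p)%:E)%E.
    exact: integrableD.
  by apply/funext => p /=; rewrite /re_plane ReD.
rewrite [X in _.-integrable _ X](_ : _ = fun p => (im_plane f p)%:E + (im_plane g p)%:E)%E.
  exact: integrableD.
by apply/funext => p /=; rewrite /im_plane ImD.
Qed.

Lemma cintD f g : cintble A f -> cintble A g ->
  cint A (fun z => f z + g z) = cint A f + cint A g.
Proof.
move=> [rf jf] [rg jg]; apply: eqC => /=; rewrite -RintegralD//;
  by apply: eq_Rintegral => p _; rewrite /re_plane /im_plane ?ReD ?ImD.
Qed.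

Lemma cintbleZ c f : cintble A f -> cintble A (fun z => c * f z).
Proof.
move=> fi; apply: (@cintble_dom _ (fun z => cmod c * cmod (f z))).
- by apply: cmeasZ; exact: cintble_meas.
- have := integrableZl mA (cmod c) (cintble_cmod fi).
  by apply: eq_integrable => // p _; rewrite -EFinM.
- by move=> z _; rewrite cmodM.
Qed.

Lemma cintZ c f : cintble A f -> cint A (fun z => c * f z) = c * cint A f.
Proof.
move=> [rf jf].
have rfz r : mu2.-integrable (pre A) (EFin \o fun p => r * re_plane f p).
  by have := integrableZl mA r rf; apply: eq_integrable.
have jfz r : mu2.-integrable (pre A) (EFin \o fun p => r * im_plane f p).
  by have := integrableZl mA r jf; apply: eq_integrable.
apply: eqC; rewrite ?ReM ?ImM /= -!RintegralZl//.
  rewrite -RintegralB//.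
  by apply: eq_Rintegral => p _; rewrite /re_plane ReM.
rewrite -RintegralD//.
by apply: eq_Rintegral => p _; rewrite /im_plane ImM.
Qed.

Lemma cintbleN f : cintble A f -> cintble A (fun z => - f z).
Proof.
by move=> fi; have := cintbleZ (-1) fi; under [X in cintble _ X]eq_fun do rewrite mulN1r.
Qed.

Lemma cintN f : cintble A f -> cint A (fun z => - f z) = - cint A f.
Proof.
move=> fi; rewrite -mulN1r -cintZ//; apply: eq_cint => z _; by rewrite mulN1r.
Qed.

Lemma cintB f g : cintble A f -> cintble A g ->
  cint A (fun z => f z - g z) = cint A f - cint A g.
Proof. by move=> fi gi; rewrite cintD// ?cintN//; exact: cintbleN. Qed.

Lemma cintJ f : cintble A f -> cint A (fun z => conjc (f z)) = conjc (cint A f).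
Proof.
move=> [rf jf]; apply: eqC; rewrite ?ReJ ?ImJ /=.
  by apply: eq_Rintegral => p _; rewrite /re_plane ReJ.
rewrite -mulN1r -RintegralZl//; apply: eq_Rintegral => p _.
by rewrite /im_plane ImJ mulN1r.
Qed.

Lemma cint0 : cint A (fun=> 0) = 0.
Proof. by apply: eqC => /=; rewrite /Rintegral integral0_eq. Qed.

(** The factor 2 is the price of estimating the real and the imaginary part separately. *)
Lemma cmod_cint f h : cintble A f -> mu2.-integrable (pre A) (fun p => (h (of_plane p))%:E) ->
  (forall z, A z -> cmod (f z) <= h z) ->
  cmod (cint A f) <= 2 * Rintegral mu2 (pre A) (fun p => h (of_plane p)).
Proof.
move=> [rf jf] ih fh; apply: le_trans (cmod_le _) _ => /=.
rewrite mulrDl mul1r; apply: lerD; apply: le_trans (le_normr_Rintegral mA _) _ => //;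
  apply: le_Rintegral => //.
- exact: integrable_norm.
- by move=> p Ap; apply: le_trans (fh _ Ap); exact: le_Re_cmod.
- exact: integrable_norm.
- by move=> p Ap; apply: le_trans (fh _ Ap); exact: le_Im_cmod.
Qed.

Definition ccvg (u : nat -> R[i]) (l : R[i]) := cmod (u n - l) @[n --> \oo] --> (0 : R).

(** The exceptional set [N] serves for the origin, where the cut-offs of the weight do not tend to
    1. *)
Lemma cint_dct (f : nat -> R[i] -> R[i]) g h (N : set (R * R)) :
  mu2.-negligible N ->
  (forall n, cmeasurable A (f n)) -> cmeasurable A g ->
  mu2.-integrable (pre A) (fun p => (h (of_plane p))%:E) ->
  (forall n z, A z -> cmod (f n z) <= h z) ->
  (forall z, A z -> ~ N (to_plane z) -> ccvg (f^~ z) (g z)) ->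
  ccvg (fun n => cint A (f n)) (cint A g).
Proof.
move=> N0 mf' /cmeas_leb mg ih fh fg.
have mf n := cmeas_leb (mf' n).
have key (p : R[i] -> R) (pl : (R[i] -> R[i]) -> R * R -> R) :
    (forall f x, pl f x = p (f (of_plane x))) -> (forall z w, p (z - w) = p z - p w) ->
    (forall w, `|p w| <= cmod w) ->
    (forall n, @measurable_fun _ _ P2 R (pre A) (pl (f n))) -> @measurable_fun _ _ P2 R (pre A) (pl g) ->
    Rintegral mu2 (pre A) (pl (f n)) @[n --> \oo] --> Rintegral mu2 (pre A) (pl g).
  move=> plE pB ple mpf mpg.
  have [] := @dominated_convergence _ _ _ mu2 (pre A) mA (fun n x => (pl (f n) x)%:E)
    (EFin \o pl g) (fun x => (h (of_plane x))%:E).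
  - by move=> n; exact/measurable_EFinP.
  - exact/measurable_EFinP.
  - apply: negligibleS N0 => x /=; apply: contra_notP => Nx Ax.
    apply: cvg_EFin; first exact: nearW.
    apply/cvgrPdist_lt => e e0.
    have toof : to_plane (of_plane x) = x by case: x {Nx Ax}.
    have := fg (of_plane x) Ax; rewrite toof => /(_ Nx)/cvgrPdist_lt/(_ e e0).
    apply: filterS => n; rewrite sub0r normrN ger0_norm ?cmod_ge0//=; apply: le_lt_trans.
    by rewrite !plE distrC -pB.
  - exact: ih.
  - apply/aeW => x n Ax; rewrite abse_EFin lee_fin plE; apply: le_trans (ple _) _.
    exact: fh.
  move=> gi _ hl; rewrite /Rintegral; apply: fine_cvg.
  by rewrite fineK//; exact: integrable_fin_num.
have k1 := key (@Re R) re_plane (fun _ _ => erefl) (@ReB R) (@le_Re_cmod R)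
  (fun n => (mf n).1) mg.1.
have k2 := key (@Im R) im_plane (fun _ _ => erefl) (@ImB R) (@le_Im_cmod R)
  (fun n => (mf n).2) mg.2.
apply/cvgrPdist_lt => e e0.
have e2 : 0 < e / 2 by rewrite divr_gt0.
move/cvgrPdist_lt/(_ _ e2) : k1 => k1; move/cvgrPdist_lt/(_ _ e2) : k2 => k2.
near=> n; rewrite sub0r normrN ger0_norm ?cmod_ge0//.
apply: le_lt_trans (cmod_le _) _; rewrite ReB ImB/= [e]splitr.
by apply: ltrD; rewrite distrC; near: n.
Unshelve. all: by end_near. Qed.

End ComplexIntegral.
Arguments measurable_disc : clear implicits.

(** * Green's formula for the zb derivative on the disc *)

Section GreenComplex.
Variable R : realType.
Notation mu := (@lebesgue_measure R).
Notation mu2 := (leb2 R).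
Implicit Types (f g u v : R[i] -> R[i]) (z w : R[i]).
Local Notation pre A := (of_plane @^-1` A).

Lemma wdiff_eps f z a b :
  (forall e : R, 0 < e -> exists2 d : R, 0 < d & forall w, cmod (w - z) < d ->
    cmod (f w - f z - a * (w - z) - b * conjc (w - z)) <= e * cmod (w - z)) ->
  wdiff f z a b.
Proof.
move=> fz; pose E w := f w - f z - a * (w - z) - b * conjc (w - z).
exists (fun w => if w == z then a else a + E w / (w - z)), (fun=> b).
split; first last.
- move=> w; case: eqVneq => [->|wz]; first by rewrite subrr rmorph0 !mulr0 !addr0.
  by rewrite mulrDl divfK ?subr_eq0// /E; ring.
- by [].
- by rewrite eqxx.
- exact: ccont_cst.
move=> e e0; have e2 : 0 < e / 2 by rewrite divr_gt0.
have [d d0 dP] := fz _ e2; exists d => // w /dP; rewrite -/(E w) eqxx.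
case: eqVneq => [_ _|wz h]; first by rewrite subrr cmod0.
rewrite addrAC subrr add0r cmodM cmodV.
rewrite ltr_pdivrMr ?cmod_gt0 ?subr_eq0//; apply: le_lt_trans h _.
by rewrite ltr_pM2r ?cmod_gt0 ?subr_eq0//; rewrite ltr_pdivrMr//; lra.
Qed.

Lemma MVT_bound (f df : R -> R) (k e a b : R) : (forall t : R, is_derive t 1 f (df t)) ->
  (forall t, `|t - a| <= `|b - a| -> `|df t - k| <= e) ->
  `|f b - f a - k * (b - a)| <= e * `|b - a|.
Proof.
move=> fd.
have cf : continuous f.
  by move=> t; apply: differentiable_continuous; apply/derivable1_diffP; have [] := fd t.
wlog ab : f df k a b fd cf / a < b.
  move=> H; have [ab|ba|->] := ltgtP a b; first exact: H.
    move=> dk.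
    have fd' (t : R) : is_derive t 1 (fun x => f (- x)) (df (- t) * -1).
      exact: (@is_derive1_comp _ f (-%R) t _ _ (fd (- t)) _).
    have := H (fun x => f (- x)) (fun t => df (- t) * -1) (- k) (- a) (- b) fd'.
    have EE : - b + a = - (b - a) by rewrite opprB addrC.
    rewrite !opprK ltrN2 EE normrN mulrNN => h; apply: h => //.
      by move=> t; apply: continuous_comp; [exact: opp_continuous|exact: cf].
    move=> t; have -> : `|t + a| = `|- t - a| by rewrite -normrN opprD.
    move=> ta.
    by rewrite mulrN1 -normrN opprD opprK; exact: dk.
  by move=> _; rewrite !subrr mulr0 subr0 normr0 mulr0.
move=> dk; have [c] := MVT ab (fun t _ => fd t) (continuous_subspaceT cf).
rewrite in_itv/= => /andP[ac cb] ->; rewrite -mulrBl normrM ler_wpM2r//.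
by apply: dk; rewrite !ger0_norm ?subr_ge0 ?(ltW ac) ?(ltW ab)// lerD2r ltW.
Qed.

(** Go from [p] to [(x, y)] along two axis-parallel segments and use the mean value theorem on each;
    both stay where the partial derivatives differ by at most [e] from their values at [p]. *)
Lemma C1_frechet (u D1 D2 : R * R -> R) :
  (forall p : R * R, is_derive p ((1, 0) : R * R) u (D1 p)) ->
  (forall p : R * R, is_derive p ((0, 1) : R * R) u (D2 p)) ->
  continuous D1 -> continuous D2 -> forall p (e : R), 0 < e ->
  exists2 d : R, 0 < d & forall x y, `|x - p.1| < d -> `|y - p.2| < d ->
    `|u (x, y) - u p - D1 p * (x - p.1) - D2 p * (y - p.2)| <= e * (`|x - p.1| + `|y - p.2|).
Proof.
move=> d1 d2 c1 c2 p e e0.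
have cc (D : R * R -> R) : continuous D -> exists2 d : R, 0 < d & forall x y,
    `|x - p.1| < d -> `|y - p.2| < d -> `|D (x, y) - D p| <= e.
  move=> cD; have /cvgrPdist_le/(_ _ e0) : {for p, continuous D} by exact: cD.
  move=> /nbhs_ballP[d /= d0 dP]; exists d => // x y xp yp.
  by rewrite distrC; apply: dP; split; rewrite /ball/= distrC.
have [r1 r10 r1P] := cc _ c1; have [r2 r20 r2P] := cc _ c2.
exists (Order.min r1 r2); first by rewrite lt_min r10.
move=> x y; rewrite !lt_min => /andP[xr1 xr2] /andP[yr1 yr2].
have px y' (t : R) : is_derive t 1 (fun s => u (s, y')) (D1 (t, y')).
  have fE : (fun h : R => h^-1 *: ((u \o shift (t, y')) (h *: ((1, 0) : R * R)) - u (t, y'))) =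
     (fun h : R => h^-1 *: (((fun s => u (s, y')) \o shift t) (h *: (1 : R)) - u (t, y'))).
    apply/funext => h /=; congr (_ *: (u _ - _)).
    by apply/pair_equal_spec; split; rewrite /= /GRing.scale/= ?mulr0 ?add0r.
  have [h hv] := d1 (t, y'); apply: DeriveDef; first by rewrite /derivable -fE; exact: h.
  by rewrite /derive -fE; exact: hv.
have py x' (t : R) : is_derive t 1 (fun s => u (x', s)) (D2 (x', t)).
  have fE : (fun h : R => h^-1 *: ((u \o shift (x', t)) (h *: ((0, 1) : R * R)) - u (x', t))) =
     (fun h : R => h^-1 *: (((fun s => u (x', s)) \o shift t) (h *: (1 : R)) - u (x', t))).
    apply/funext => h /=; congr (_ *: (u _ - _)).
    by apply/pair_equal_spec; split; rewrite /= /GRing.scale/= ?mulr0 ?add0r.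
  have [h hv] := d2 (x', t); apply: DeriveDef; first by rewrite /derivable -fE; exact: h.
  by rewrite /derive -fE; exact: hv.
have h1 := @MVT_bound _ _ (D1 p) e p.1 x (px y).
have h2 := @MVT_bound _ _ (D2 p) e p.2 y (py p.1).
have {}h1 : `|u (x, y) - u (p.1, y) - D1 p * (x - p.1)| <= e * `|x - p.1|.
  by apply: h1 => t tx; apply: r1P => //; exact: le_lt_trans xr1.
have {}h2 : `|u (p.1, y) - u (p.1, p.2) - D2 p * (y - p.2)| <= e * `|y - p.2|.
  apply: h2 => t tx; apply: r2P => //; first by rewrite subrr normr0.
  exact: le_lt_trans yr2.
rewrite [leRHS]mulrDr; apply: le_trans (lerD h1 h2).
apply: le_trans (ler_normD _ _); rewrite le_eqVlt; apply/orP; left; apply/eqP; congr `|_|.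
by clear; case: (p) => p1 p2 /=; ring.
Qed.

Lemma wirtinger_real (X Y h : R[i]) :
  (X - Ci R * Y) / 2 * h + (X + Ci R * Y) / 2 * conjc h = X * (Re h)%:C + Y * (Im h)%:C.
Proof.
have hE : h = (Re h)%:C + Ci R * (Im h)%:C.
  by apply: eqC; rewrite ?(ReD,ImD,ReM,ImM)/=; ring.
have hJ : conjc h = (Re h)%:C - Ci R * (Im h)%:C.
  by apply: eqC; rewrite ?(ReD,ImD,ReM,ImM,ReN,ImN,ReJ,ImJ)/=; ring.
rewrite hJ [in X in X + _]hE.
transitivity (X * (Re h)%:C - (Ci R * Ci R) * (Y * (Im h)%:C)).
  by field; exact: isT.
by rewrite Ci2; ring.
Qed.

Lemma Cn1_wdiff f z : Cn_on setT 1 f -> wdiff f z (partial_z f z) (partial_zbar f z).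
Proof.
move=> [df fx fy].
have cfx : forall w, ccont (partial_x f) w by move=> w; apply/ccontP; exact: fx.
have cfy : forall w, ccont (partial_y f) w by move=> w; apply/ccontP; exact: fy.
have [c1 c2] := ccont_plane cfx; have [c3 c4] := ccont_plane cfy.
have toof (p : R * R) : to_plane (of_plane p) = p by case: p.
have dr1 (p : R * R) : is_derive p ((1, 0) : R * R) (re_plane f) (re_plane (partial_x f) p).
  have [[h _] _] := df (of_plane p) I; rewrite toof in h.
  by apply: DeriveDef => //; rewrite /re_plane /partial_x /pderive/= toof.
have dj1 (p : R * R) : is_derive p ((1, 0) : R * R) (im_plane f) (im_plane (partial_x f) p).
  have [[_ h] _] := df (of_plane p) I; rewrite toof in h.
  by apply: DeriveDef => //; rewrite /im_plane /partial_x /pderive/= toof.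
have dr2 (p : R * R) : is_derive p ((0, 1) : R * R) (re_plane f) (re_plane (partial_y f) p).
  have [_ [h _]] := df (of_plane p) I; rewrite toof in h.
  by apply: DeriveDef => //; rewrite /re_plane /partial_y /pderive/= toof.
have dj2 (p : R * R) : is_derive p ((0, 1) : R * R) (im_plane f) (im_plane (partial_y f) p).
  have [_ [_ h]] := df (of_plane p) I; rewrite toof in h.
  by apply: DeriveDef => //; rewrite /im_plane /partial_y /pderive/= toof.
(* A quarter each: the real and the imaginary part both leave an error proportional to |dx| + |dy|,
   which is at most twice the modulus. *)
apply: wdiff_eps => e e0; have e4 : 0 < e / 4 by rewrite divr_gt0.
have [d d0 dP] := C1_frechet dr1 dr2 c1 c3 (to_plane z) e4.
have [d' d'0 d'P] := C1_frechet dj1 dj2 c2 c4 (to_plane z) e4.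
exists (Order.min d d'); first by rewrite lt_min d0.
move=> w; rewrite lt_min => /andP[wd wd'].
have wr : `|Re w - Re z| <= cmod (w - z) by rewrite -ReB le_Re_cmod.
have wi : `|Im w - Im z| <= cmod (w - z) by rewrite -ImB le_Im_cmod.
have h1 := dP (Re w) (Im w) (le_lt_trans wr wd) (le_lt_trans wi wd).
have h2 := d'P (Re w) (Im w) (le_lt_trans wr wd') (le_lt_trans wi wd').
have oft : of_plane (to_plane z) = z by case: (z).
have ofw : of_plane (Re w, Im w) = w by case: (w).
rewrite /re_plane oft ofw in h1; rewrite /im_plane oft ofw in h2.
apply: le_trans (cmod_le _) _.
have -> : f w - f z - partial_z f z * (w - z) - partial_zbar f z * conjc (w - z) =
   f w - f z - (partial_x f z * (Re (w - z))%:C + partial_y f z * (Im (w - z))%:C).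
  by rewrite -wirtinger_real opprD addrA.
set X := partial_x f z in h1 h2 *; set Y := partial_y f z in h1 h2 *.
have rr : Re (f w - f z - (X * (Re (w - z))%:C + Y * (Im (w - z))%:C)) =
    Re (f w) - Re (f z) - Re X * (Re w - Re z) - Re Y * (Im w - Im z).
  by rewrite (ReB (f w - f z)) (ReB (f w)) (ReD (X * _)) !ReMr ReB ImB opprD addrA.
have ri : Im (f w - f z - (X * (Re (w - z))%:C + Y * (Im (w - z))%:C)) =
    Im (f w) - Im (f z) - Im X * (Re w - Re z) - Im Y * (Im w - Im z).
  by rewrite (ImB (f w - f z)) (ImB (f w)) (ImD (X * _)) !ImMr ReB ImB opprD addrA.
rewrite rr ri.
apply: le_trans (lerD h1 h2) _; rewrite -mulrDr.
apply: (@le_trans _ _ (e / 4 * (cmod (w - z) + cmod (w - z) + (cmod (w - z) + cmod (w - z))))).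
  by apply: ler_wpM2l; [exact: ltW|rewrite !lerD].
by rewrite [leLHS](_ : _ = e * cmod (w - z))//; field.
Qed.

Lemma disc_square : pre (disc R) `<=` hitv (-1) 2 `*` hitv (-1) 2.
Proof.
have m12 : (-1 + 2 : R) = 1 by ring.
move=> [x y]; rewrite /disc/= => xd; split; rewrite /hitv/= in_itv/=.
  have := le_lt_trans (le_Re_cmod (of_plane (x, y))) xd; rewrite ltr_norml => /andP[x1 x2].
  by apply/andP; split; [exact: ltW|rewrite m12].
have := le_lt_trans (le_Im_cmod (of_plane (x, y))) xd; rewrite ltr_norml => /andP[x1 x2].
by apply/andP; split; [exact: ltW|rewrite m12].
Qed.

(** The field (Re v, - Im v) has divergence 2 Re b. Bisection is applied on the square of side 2
    about the disc, whose edges miss the open disc, so that [v] vanishes on them. *)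
Lemma green_re v a b : (forall z, wdiff v z (a z) (b z)) -> (forall z, ccont b z) ->
  (forall z, ~ disc R z -> v z = 0 /\ b z = 0) ->
  Rintegral mu2 (pre (disc R)) (re_plane b) = 0.
Proof.
move=> dv cb v0.
have cv z := wdiff_cont (dv z).
have [cP cQ] := ccont_plane cv; have [crb _] := ccont_plane cb.
pose Q : R * R -> R := fun p => - im_plane v p.
have {}cQ : continuous Q by move=> p; apply: cvgN; exact: cQ.
pose w : R * R -> R := fun p => 2 * re_plane b p.
have cw : continuous w by move=> p; apply: cvgM; [exact: cvg_cst|exact: crb].
have dPQ : forall p1 p2 : R, exists A1 A2 B1 B2 : R, A1 + B2 = w (p1, p2) /\
  (forall e : R, 0 < e -> exists2 d : R, 0 < d & forall x y, `|x - p1| < d -> `|y - p2| < d ->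
    `|re_plane v (x, y) - re_plane v (p1, p2) - A1 * (x - p1) - A2 * (y - p2)| <= e * (`|x - p1| + `|y - p2|) /\
    `|Q (x, y) - Q (p1, p2) - B1 * (x - p1) - B2 * (y - p2)| <= e * (`|x - p1| + `|y - p2|)).
  move=> p1 p2; pose z := of_plane (p1, p2).
  exists (Re (a z + b z)), (- Im (a z - b z)), (- Im (a z + b z)), (- Re (a z - b z)); split.
    by rewrite /w ReD ReB /re_plane -/z; ring.
  move=> e e0; have e2 : 0 < e / 2 by rewrite divr_gt0.
  have [A [B [cA cB Aa Bb vE]]] := dv z.
  have [d1 d10 d1P] := cA _ e2; have [d2 d20 d2P] := cB _ e2.
  pose d := Order.min d1 d2; have d0 : 0 < d by rewrite lt_min d10.
  exists (d / 2); first by rewrite divr_gt0.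
  move=> x y xp yp; pose q := of_plane (x, y).
  have Re_qz : Re (q - z) = x - p1 by [].
  have Im_qz : Im (q - z) = y - p2 by [].
  have : cmod (q - z) < d.
    apply: le_lt_trans (cmod_le _) _; rewrite Re_qz Im_qz [d]splitr; exact: ltrD.
  rewrite lt_min => /andP[/d1P qA /d2P qB].
  pose r := v q - v z - (a z * (q - z) + b z * conjc (q - z)).
  have rE : r = (A q - A z) * (q - z) + (B q - B z) * conjc (q - z).
    by rewrite /r (vE q) Aa Bb; ring.
  have rle : cmod r <= e * (`|x - p1| + `|y - p2|).
    rewrite rE; apply: le_trans (le_cmodD _ _) _; rewrite !cmodM cmodJ -mulrDl.
    apply: ler_pM; rewrite ?addr_ge0 ?cmod_ge0//; first by rewrite [e]splitr ltW// ltrD.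
    by apply: le_trans (cmod_le _) _; rewrite Re_qz Im_qz.
  have rr : Re r = Re (v q) - Re (v z) - (Re (a z) * (x - p1) - Im (a z) * (y - p2) +
      (Re (b z) * (x - p1) + Im (b z) * (y - p2))).
    by rewrite /r 2!ReB ReD !ReM ReJ ImJ Re_qz Im_qz mulrN opprK.
  have ri : Im r = Im (v q) - Im (v z) - (Re (a z) * (y - p2) + Im (a z) * (x - p1) +
      (- (Re (b z) * (y - p2)) + Im (b z) * (x - p1))).
    by rewrite /r 2!ImB ImD !ImM ReJ ImJ Re_qz Im_qz mulrN.
  have -> : re_plane v (x, y) - re_plane v (p1, p2) - Re (a z + b z) * (x - p1)
     - (- Im (a z - b z)) * (y - p2) = Re r.
    by rewrite rr /re_plane -/q -/z ReD ImB; ring.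
  have -> : Q (x, y) - Q (p1, p2) - (- Im (a z + b z)) * (x - p1)
     - (- Re (a z - b z)) * (y - p2) = - Im r.
    by rewrite ri /Q /im_plane -/q -/z ReB ImD; ring.
  rewrite normrN; split; apply: le_trans rle; [exact: le_Re_cmod|exact: le_Im_cmod].
have t2 : (0 : R) < 2 by [].
have := flux_eq0 cP cQ cw dPQ (-1) (-1) t2.
have out x y : 1 <= `|x| \/ 1 <= `|y| -> v (of_plane (x, y)) = 0.
  move=> h; have nd : ~ disc R (of_plane (x, y)).
    rewrite /disc/=; apply/negP; rewrite -leNgt.
    by case: h => h; apply: le_trans h _; [exact: (le_Re_cmod (of_plane (x, y)))|exact: (le_Im_cmod (of_plane (x, y)))].
  by have [] := v0 _ nd.
rewrite /flux.
have z1 (s : R) : `|s| = 1 -> \int[mu]_(y in hitv (-1) 2) re_plane v (s, y) = 0.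
  move=> s1; rewrite /Rintegral integral0_eq// => y _.
  by rewrite /re_plane out// s1; left.
have m12 : (-1 + 2 : R) = 1 by ring.
have z2 (s : R) : `|s| = 1 -> \int[mu]_(x in hitv (-1) 2) Q (x, s) = 0.
  move=> s1; rewrite /Rintegral integral0_eq// => y _.
  by rewrite /Q /im_plane out ?oppr0// s1; right.
have -> : (-1 + 2 : R) = 1 by ring.
rewrite !z1 ?z2 ?normrN1 ?normr1// !subr0 add0r => /eqP; rewrite sub0r oppr_eq0 => /eqP h.
have : \int[mu2]_(p in pre (disc R)) w p = 0.
  rewrite -h Rintegral_mkcond [in RHS]Rintegral_mkcond; congr (Rintegral _ _ _).
  apply/funext => -[x y]; rewrite !patchE.
  have [xd|xd] := boolP ((x, y) \in pre (disc R)).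
    by rewrite mem_set//; apply: disc_square; move: xd; rewrite inE.
  case: ifP => // _; rewrite /w /re_plane (v0 _ _).2 ?mulr0//.
  by move: xd; rewrite notin_setE.
rewrite /w RintegralZl; first by move/eqP; rewrite mulf_eq0 pnatr_eq0/= => /eqP.
  exact: (measurable_disc R).
have := @integrable_square _ (re_plane b) (-1) (-1) 2 2 crb t2 t2.
apply: integrableS; try exact: (measurable_disc R).
  by apply: measurableX; exact: measurable_hitv.
exact: disc_square.
Qed.

Lemma green v a b : (forall z, wdiff v z (a z) (b z)) -> (forall z, ccont b z) ->
  (forall z, ~ disc R z -> v z = 0 /\ b z = 0) -> cint (disc R) b = 0.
Proof.
move=> dv cb v0; apply: eqC => /=; first exact: green_re dv cb v0.
(* Multiplication by -i turns the imaginary part into a real part. *)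
have dv' z : wdiff (fun w => - Ci R * v w) z (- Ci R * a z) (- Ci R * b z).
  exact: wdiffZ.
have cb' z : ccont (fun w => - Ci R * b w) z by apply: ccontM => //; exact: ccont_cst.
have v0' z : ~ disc R z -> - Ci R * v z = 0 /\ - Ci R * b z = 0.
  by move=> /v0[-> ->]; rewrite mulr0.
rewrite -(green_re dv' cb' v0'); apply: eq_Rintegral => p _.
by rewrite /re_plane /im_plane ReM ReN ImN /=; ring.
Qed.

Lemma cintble_cont f : (forall z, ccont f z) -> cintble (disc R) f.
Proof.
move=> /ccont_plane[cr ci]; have t2 : (0 : R) < 2 by [].
by split; [have := @integrable_square _ _ (-1) (-1) 2 2 cr t2 t2|
  have := @integrable_square _ _ (-1) (-1) 2 2 ci t2 t2];
  (apply: integrableS; [by apply: measurableX; exact: measurable_hitv|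
    exact: (measurable_disc R)|exact: disc_square]).
Qed.

End GreenComplex.

(** * Test functions and integration by parts against holomorphic functions *)

Section TestFunctions.
Variable R : realType.
Notation P2 := (measurableTypeR R * measurableTypeR R)%type.
Implicit Types (f g u v phi : R[i] -> R[i]) (z w : R[i]).
Local Notation pre A := (of_plane @^-1` A).

Lemma nbhsC (z : R[i]) (B : set R[i]) : nbhs (z : R[i]^o) B <-> cnear z B.
Proof.
split=> [/nbhs_ballP[d /= d0 dP]|[d d0 dP]].
  have dd : d = (Re d)%:C by rewrite RRe_real// gtr0_real.
  exists (Re d); first by rewrite -ltcR -dd.
  by move=> w wd; apply: dP; rewrite -ball_normE/= distrC cmodE dd ltcR.
apply/nbhs_ballP; exists d%:C; first by rewrite /= ltcR.
by move=> w; rewrite -ball_normE/= distrC cmodE ltcR; exact: dP.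
Qed.

Lemma compact_disk r : compact ([set z | cmod z <= r] : set R[i]^o).
Proof.
have cof : continuous (of_plane : R * R -> R[i]^o).
  move=> p B /nbhsC[d d0 dP]; apply/nbhs_ballP; exists (d / 2); first by rewrite /= divr_gt0.
  move=> q [/=]; rewrite /ball/= => h1 h2; apply: dP.
  apply: le_lt_trans (cmod_le _) _; rewrite ReB ImB /= [`|q.1 - _|]distrC [`|q.2 - _|]distrC.
  by rewrite [d]splitr ltrD.
have cpt : compact ((of_plane : R * R -> R[i]^o) @` ([set` `[- r, r]] `*` [set` `[- r, r]])).
  apply: continuous_compact; first exact: continuous_subspaceT.
  by apply: compact_setX; exact: segment_compact.
apply: (subclosed_compact _ cpt).
  move=> z zcl; rewrite /= leNgt; apply/negP => rz.
  have nz : nbhs (z : R[i]^o) [set w | r < cmod w].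
    apply/nbhsC; exists (cmod z - r); first by rewrite subr_gt0.
    move=> w wz /=; rewrite ltrBrDl addrC -ltrBrDl in wz.
    apply: lt_le_trans wz _; rewrite lerBlDr.
    by rewrite -[X in cmod X <= _](subrK w) addrC cmodB; exact: le_cmodD.
  have [w [/= h1 h2]] := zcl _ nz.
  by move: h1; rewrite leNgt h2.
move=> z /= zr; exists (Re z, Im z); last by case: z zr.
split; rewrite /= in_itv/= -ler_norml; apply: le_trans zr.
  exact: le_Re_cmod.
exact: le_Im_cmod.
Qed.

Lemma compact_radius (K : set R[i]) : compact (K : set R[i]^o) -> K `<=` disc R ->
  exists2 r, 0 <= r < 1 & forall z, K z -> cmod z <= r.
Proof.
move=> cK KD; have [K0|/set0P/negP/negPn/eqP ->] := pselect ((K : set R[i]^o) !=set0); last first.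
  by exists 0; [rewrite lexx ltr01|].
have cc : {within (K : set R[i]^o), continuous (fun z : R[i]^o => cmod z)}.
  apply: continuous_subspaceT => z B /nbhs_ballP[e e0 eB].
  have [d d0 dP] := ccont_cmod (@ccont_id R z) e0.
  apply/nbhsC; exists d => // w /dP; rewrite -rcB cmod_real => wz.
  by apply: eB; rewrite /ball/= distrC.
have [c Kc cP] := compact_EVT_max K0 cK cc.
exists (cmod c); first by rewrite cmod_ge0; apply: KD; move: Kc; rewrite inE.
by move=> z Kz; apply: cP; rewrite inE.
Qed.

Lemma tf_radius phi : test_function phi ->
  exists2 r, 0 <= r < 1 & forall z, r < cmod z -> phi z = 0.
Proof.
move=> [_ cpt sub]; have [r r01 rP] := compact_radius cpt sub.
exists r => // z rz; apply: contrapT => /eqP pz.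
by have /rP := @subset_closure _ ([set z | phi z != 0] : set R[i]^o) z pz; rewrite leNgt rz.
Qed.

Lemma close_enough (x q p e d : R) : q - e < x < q + e -> p - e < q -> q < p + e ->
  e < d / 4 -> `|x - p| < d / 2.
Proof. by move=> /andP[x1 x2] q1 q2 ed; rewrite ltr_norml; apply/andP; split; lra. Qed.

(** An open set is the union of the countably many rational boxes inside it. Local integrability is
    tested on arbitrary compact sets, whose preimages must be measurable for the product
    sigma-algebra. *)
Lemma measurable_openC (U : set R[i]) : (forall z, U z -> cnear z U) ->
  @measurable _ P2 (pre U).
Proof.
move=> oU.
pose box (q : rat * rat * nat) : set (R * R) :=
  [set` `]ratr q.1.1 - q.2.+1%:R^-1, ratr q.1.1 + q.2.+1%:R^-1[] `*`
  [set` `]ratr q.1.2 - q.2.+1%:R^-1, ratr q.1.2 + q.2.+1%:R^-1[].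
have mbox q : @measurable _ P2 (box q) by apply: measurableX; exact: measurable_itv.
pose B q : set P2 := if `[< box q `<=` pre U >] then box q else set0.
rewrite (_ : pre U = \bigcup_q B q).
  apply: countable_bigcupT_measurable => [|q]; first exact: countableP.
  by rewrite /B; case: ifP => _; [exact: mbox|exact: measurable0].
apply/seteqP; split=> [p Up|p [q _]]; last by rewrite /B; case: ifP => // /asboolP; apply.
have [d d0 dP] := oU _ Up.
have [n n4] : exists n : nat, (n.+1%:R^-1 : R) < d / 4.
  have /cvgrPdist_lt/(_ (d / 4)) := @cvg_harmonic R.
  rewrite divr_gt0// => /(_ isT)[n _ /(_ n (leqnn n))]; rewrite /harmonic sub0r normrN ger0_norm ?invr_ge0//.
  by exists n.
have nz : 0 < (n.+1%:R^-1 : R) by rewrite invr_gt0.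
have itvP (x : R) : exists q : rat, ratr q \in `]x - n.+1%:R^-1, x + n.+1%:R^-1[.
  by apply: rat_in_itvoo; rewrite ltrBlDr -addrA ltrDl addr_gt0.
have [q1] := itvP p.1; have [q2] := itvP p.2; rewrite !in_itv/= => /andP[q21 q22] /andP[q11 q12].
exists (q1, q2, n) => //; rewrite /B ifT.
  by split; (rewrite /= in_itv/=; apply/andP; split; [rewrite ltrBlDr|rewrite -ltrBlDr]).
apply/asboolP => -[x y] [/=]; rewrite !in_itv/= => xq yq; apply: dP.
apply: le_lt_trans (cmod_le _) _; rewrite ReB ImB/=.
have -> : d = d / 2 + d / 2 by rewrite -splitr.
by apply: ltrD; [exact: (close_enough xq q11 q12 n4)|exact: (close_enough yq q21 q22 n4)].
Qed.

Lemma measurable_compactC (K : set R[i]) : compact (K : set R[i]^o) -> @measurable _ P2 (pre K).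
Proof.
move=> cK; rewrite -[K]setCK preimage_setC; apply: measurableC; apply: (@measurable_openC (~` K)) => z nKz.
have clK : closed (K : set R[i]^o) by apply: compact_closed => //; exact: norm_hausdorff.
by have /closed_openC := clK; rewrite openE => /(_ _ nKz)/nbhsC.
Qed.

Lemma tf_of_radius phi r : r < 1 -> (forall z, r < cmod z -> phi z = 0) ->
  (forall n, Cn_on setT n phi) -> test_function phi.
Proof.
move=> r1 phi0 sphi; rewrite /test_function/=; set S := closure _.
have Sr : S `<=` [set z | cmod z <= r].
  move=> z Sz; rewrite /= leNgt; apply/negP => rz.
  have nz : nbhs (z : R[i]^o) [set w | r < cmod w].
    apply/nbhsC; exists (cmod z - r); first by rewrite subr_gt0.
    move=> w wz /=; rewrite ltrBrDl addrC -ltrBrDl in wz.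
    apply: lt_le_trans wz _; rewrite lerBlDr.
    by rewrite -[X in cmod X <= _](subrK w) addrC cmodB; exact: le_cmodD.
  by have [w [/= /eqP h1 h2]] := Sz _ nz; apply: h1; exact: phi0.
split => //; first by apply: subclosed_compact (compact_disk (r := r)) Sr; exact: closed_closure.
by move=> z /Sr /=; rewrite /disc/= => /le_lt_trans; apply.
Qed.

Lemma cnear_gt r z : r < cmod z -> cnear z (fun w => r < cmod w).
Proof.
move=> rz; exists (cmod z - r); first by rewrite subr_gt0.
move=> w wz /=; rewrite ltrBrDl addrC -ltrBrDl in wz.
apply: lt_le_trans wz _; rewrite lerBlDr.
by rewrite -[X in cmod X <= _](subrK w) addrC cmodB; exact: le_cmodD.
Qed.

Lemma partial_near0 f z : cnear z (fun w => f w = 0) ->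
  partial_z f z = 0 /\ partial_zbar f z = 0.
Proof.
move=> f0; have df : wdiff f z 0 0.
  by apply: wdiff_near (wdiff_cst 0 z); apply: cnear_mono f0 => w ->.
by rewrite (wdiff_partial_z df) (wdiff_partial_zbar df).
Qed.

Lemma tf_partial_z phi : test_function phi -> test_function (partial_z phi).
Proof.
move=> tphi; have [r /andP[r0 r1] phi0] := tf_radius tphi; apply: (tf_of_radius r1).
  move=> z /cnear_gt rz; apply: (partial_near0 _).1; exact: cnear_mono rz.
by move=> n; apply: Cn_partial_z; case: tphi.
Qed.

Lemma tf_partial_zbar phi : test_function phi -> test_function (partial_zbar phi).
Proof.
move=> tphi; have [r /andP[r0 r1] phi0] := tf_radius tphi; apply: (tf_of_radius r1).
  move=> z /cnear_gt rz; apply: (partial_near0 _).2; exact: cnear_mono rz.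
by move=> n; apply: Cn_partial_zbar; case: tphi.
Qed.

Lemma tf_wdiff phi z : test_function phi -> wdiff phi z (partial_z phi z) (partial_zbar phi z).
Proof. by move=> [sphi _ _]; apply: Cn1_wdiff; exact: sphi. Qed.

Lemma tf_cont phi z : test_function phi -> ccont phi z.
Proof. by move=> tphi; exact: wdiff_cont (tf_wdiff z tphi). Qed.

Lemma tf_mulcont u phi : (forall z, disc R z -> ccont u z) -> test_function phi ->
  forall z, ccont (fun w => u w * phi w) z.
Proof.
move=> cu tphi z; have [zd|zd] := pselect (disc R z).
  by apply: ccontM; [exact: cu|exact: tf_cont].
have [r /andP[r0 r1] phi0] := tf_radius tphi.
have rz : r < cmod z by apply: lt_le_trans r1 _; rewrite leNgt; apply/negP.
apply: ccont_near (ccont_cst 0 z); apply: cnear_mono (cnear_gt rz) => w rw.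
by rewrite phi0 ?mulr0.
Qed.

(** [u] is arbitrary off the disc, but there [phi] vanishes in a neighbourhood; the product rule
    thus holds on the whole plane, as Green's formula demands. *)
Lemma tf_mul_wdiff u u' phi : (forall z, disc R z -> wdiff u z (u' z) 0) -> test_function phi ->
  forall z, wdiff (fun w => u w * phi w) z (u' z * phi z + u z * partial_z phi z)
                                         (u z * partial_zbar phi z).
Proof.
move=> du tphi z; have [zd|zd] := pselect (disc R z).
  by have := wdiffM (du z zd) (tf_wdiff z tphi); rewrite mul0r add0r.
have [r /andP[r0 r1] phi0] := tf_radius tphi.
have rz : r < cmod z by apply: lt_le_trans r1 _; rewrite leNgt; apply/negP.
have near0 : cnear z (fun w => phi w = 0) by apply: cnear_mono (cnear_gt rz).
have [-> ->] := partial_near0 near0; rewrite phi0// !mulr0 addr0.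
by apply: wdiff_near (wdiff_cst 0 z); apply: cnear_mono near0 => w ->; rewrite mulr0.
Qed.

Lemma tf_out phi z : test_function phi -> ~ disc R z ->
  [/\ phi z = 0, partial_z phi z = 0 & partial_zbar phi z = 0].
Proof.
move=> tphi zd; have [r /andP[r0 r1] phi0] := tf_radius tphi.
have rz : r < cmod z by apply: lt_le_trans r1 _; rewrite leNgt; apply/negP.
have near0 : cnear z (fun w => phi w = 0) by apply: cnear_mono (cnear_gt rz).
by have [-> ->] := partial_near0 near0; rewrite phi0.
Qed.

(** For holomorphic [u] the integrand is the full zb derivative of [u * phi]. It is continuous
    whatever [u'] is, so Green's formula applies. *)
Lemma weak_zbar u u' phi : (forall z, disc R z -> wdiff u z (u' z) 0) -> test_function phi ->
  cint (disc R) (fun z => u z * partial_zbar phi z) = 0.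
Proof.
move=> du tphi; apply: (green (tf_mul_wdiff du tphi)).
  by apply: tf_mulcont; [move=> z /du/wdiff_cont|exact: tf_partial_zbar].
by move=> z /(tf_out tphi)[-> _ ->]; rewrite !mulr0.
Qed.

(** Conjugation turns the z derivative of [u * phi] into a zb derivative, to which Green's formula
    applies. *)
Lemma weak_z u u' phi : (forall z, disc R z -> wdiff u z (u' z) 0) ->
  (forall z, disc R z -> ccont u' z) -> test_function phi ->
  cint (disc R) (fun z => u z * partial_z phi z) = - cint (disc R) (fun z => u' z * phi z).
Proof.
move=> du cu' tphi.
have c1 := tf_mulcont cu' tphi.
have c2 : forall z, ccont (fun w => u w * partial_z phi w) z.
  by apply: tf_mulcont; [move=> z /du/wdiff_cont|exact: tf_partial_z].
have i1 := cintble_cont c1; have i2 := cintble_cont c2.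
apply/eqP; rewrite eq_sym -subr_eq0 -opprD oppr_eq0 -cintD//; last exact: (measurable_disc R).
have mD := measurable_disc R.
rewrite -[_ == _](inj_eq (can_inj (@conjcK R))) conjc0 -(cintJ mD); last exact: cintbleD.
apply/eqP; apply: (green (fun z => wdiffJ (tf_mul_wdiff du tphi z))).
  by move=> z; apply: ccontJ; apply: ccontD.
by move=> z /(tf_out tphi)[-> -> _]; rewrite !mulr0 addr0 conjc0.
Qed.

(** [g] is integrable on the closed disc of radius [r] outside which [phi] vanishes, and [phi] is
    bounded; the majorant [h] is therefore set to 0 beyond that radius. *)
Lemma cintble_tf g phi : Defs.locally_integrable g -> test_function phi ->
  cintble (disc R) (fun z => g z * phi z).
Proof.
move=> [mg lg] tphi; have [r /andP[r0 r1] phi0] := tf_radius tphi.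
pose K := [set z : R[i] | cmod z <= r].
have KD : K `<=` disc R by move=> z /= zr; exact: le_lt_trans r1.
have mD := measurable_disc R.
have mK : @measurable _ P2 (pre K).
  rewrite [X in measurable X](_ : _ = (fun p : R * R => cmod (of_plane p)) @^-1` [set` `]-oo, r]]).
    by rewrite -[X in measurable X]setTI; apply: (@measurable_cmod R) => //; exact: measurable_itv.
  by apply/seteqP; split=> p; rewrite /= in_itv.
have [M MP] : exists M, forall z, disc R z -> cmod (phi z) <= M.
  have [c1 c2] := ccont_plane (fun z => tf_cont z tphi).
  have [M1 M1P] := @bounded_continuous2 _ _ (-1) 1 (-1) 1 c1.
  have [M2 M2P] := @bounded_continuous2 _ _ (-1) 1 (-1) 1 c2.
  exists (M1 + M2) => z zd; apply: le_trans (cmod_le _) _.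
  have h1 : -1 <= Re z <= 1 by rewrite -ler_norml (le_trans (le_Re_cmod z))// ltW.
  have h2 : -1 <= Im z <= 1 by rewrite -ler_norml (le_trans (le_Im_cmod z))// ltW.
  have := M1P _ _ h1 h2; have := M2P _ _ h1 h2.
  rewrite /re_plane /im_plane (_ : of_plane (Re z, Im z) = z); last by case: (z).
  by move=> a1 a2; exact: lerD.
have iK : cintble K g.
  have mgK : cmeasurable K g by apply: cmeasS mg; [exact: mD|].
  apply: (@cintble_dom_fin _ _ mK g (fun z => cmod (g z)) mgK (cmeas_cmod_leb mgK)) => //.
  by apply: lg => //; exact: compact_disk.
pose h z := if cmod z <= r then M * cmod (g z) else 0.
apply: (@cintble_dom _ _ mD _ h).
- by apply: cmeasM => //; apply: cmeas_cont => z; exact: tf_cont.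
- have := integrableZl mK M (cintble_cmod mK iK); move/integrable_mkcond => /(_ mK).
  have -> : (fun x => M%:E * (cmod (g (of_plane x)))%:E)%E \_ (pre K) = (fun p => (h (of_plane p))%:E).
    apply/funext => p; rewrite patchE /h; case: ifPn.
      by rewrite inE /K/= => ->.
    by rewrite notin_setE /K/= => /negP/negbTE ->.
  by apply: integrableS => //.
- move=> z zd; rewrite cmodM /h; case: (leP (cmod z) r) => rz; last by rewrite phi0// cmod0 mulr0.
  by rewrite mulrC ler_wpM2r ?cmod_ge0// MP.
Qed.

Lemma smC_tf phi r : r < 1 -> (forall z, r < cmod z -> phi z = 0) -> smoothC phi ->
  test_function phi.
Proof. by move=> r1 phi0 sphi; apply: (tf_of_radius r1 phi0) => n; exact: smC_Cn. Qed.

End TestFunctions.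

(** * Monomials with a radial factor, and radial cut-offs *)

Section Radial.
Variable R : realType.
Notation mu2 := (leb2 R).
Local Notation D := (disc R).
Let mD := measurable_disc R.
Implicit Types (f g : R[i] -> R[i]) (z w c : R[i]) (F G rho : R -> R) (u v : nat -> R[i]).

Lemma ccvgP u (l : R[i]) : ccvg u l <->
  forall e : R, 0 < e -> \forall n \near \oo, cmod (u n - l) < e.
Proof.
split=> [/cvgrPdist_lt ul e e0|ul]; last first.
  apply/cvgrPdist_lt => e e0; near=> n; rewrite sub0r normrN ger0_norm ?cmod_ge0//.
  by near: n; exact: ul.
near=> n; have : `|0 - cmod (u n - l)| < e by near: n; exact: ul.
by rewrite sub0r normrN ger0_norm ?cmod_ge0.
Unshelve. all: by end_near. Qed.

Lemma ccvg_uniq u (l l' : R[i]) : ccvg u l -> ccvg u l' -> l = l'.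
Proof.
move=> /ccvgP ul /ccvgP ul'; apply/eqP; rewrite -subr_eq0 -cmod_eq0; apply/negPn/negP => l0.
have e0 : 0 < cmod (l - l') / 2 by rewrite divr_gt0// lt_def l0 cmod_ge0.
suff : \forall n \near \oo, False by move=> /filter_ex[].
near=> n; have h1 : cmod (u n - l) < cmod (l - l') / 2 by near: n; exact: ul.
have h2 : cmod (u n - l') < cmod (l - l') / 2 by near: n; exact: ul'.
have := le_cmodD (l - u n) (u n - l'); rewrite addrA subrK (cmodB l); lra.
Unshelve. all: by end_near. Qed.

Lemma ccvg_cst (l : R[i]) : ccvg (fun=> l) l.
Proof. by apply/ccvgP => e e0; near=> n; rewrite subrr cmod0.
Unshelve. all: by end_near. Qed.

Lemma ccvgZ c u l : ccvg u l -> ccvg (fun n => c * u n) (c * l).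
Proof.
rewrite /ccvg => ul; under eq_fun do rewrite -mulrBr cmodM.
by rewrite -(mulr0 (cmod c)); exact: cvgZr.
Qed.

Lemma ccvg_ext u v l : (forall n, u n = v n) -> ccvg u l -> ccvg v l.
Proof. by move=> /funext ->. Qed.

Lemma wdiffX n z : wdiff (fun w => w ^+ n) z (n%:R * z ^+ n.-1) 0.
Proof.
elim: n => [|n ih]; first by rewrite mul0r; exact: wdiff_cst.
have := wdiffM (wdiff_id z) ih.
rewrite mul0r mulr0 addr0 mul1r.
have -> : z ^+ n + z * (n%:R * z ^+ n.-1) = n.+1%:R * z ^+ n.
  case: n {ih} => [|n]; first by rewrite mul0r mulr0 addr0 mul1r.
  by rewrite /= mulrCA -exprS -[n.+2]addn1 natrD mulrDl mul1r addrC.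
by move=> h; apply: wdiff_near h; exists 1 => // w _; rewrite -exprS.
Qed.

(** The radial factor is a function of |z|^2 and not of |z|, since z conj z is smooth at the origin:
    for smooth [rho] the product lies in [smoothC]. *)
Definition mono a b rho z : R[i] := z ^+ a * conjc z ^+ b * (rho (Re (z * conjc z)))%:C.

Lemma sqE z : Re (z * conjc z) = cmod z ^+ 2.
Proof. by rewrite mulJ_cmod. Qed.

Lemma monoE a b rho z : mono a b rho z = z ^+ a * conjc z ^+ b * (rho (cmod z ^+ 2))%:C.
Proof. by rewrite /mono sqE. Qed.

Lemma mono_mul a b (c d : nat) rho z : z ^+ a * conjc z ^+ b * mono c d rho z = mono (a + c) (b + d) rho z.
Proof. by rewrite /mono !exprD; ring. Qed.

Lemma smC_mono a b rho : Csmooth setT rho -> smoothC (mono a b rho).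
Proof.
move=> srho; apply: smC_M.
  by apply: smC_M; apply: smC_X; [exact: smC_id|exact: smC_J (smC_id R)].
by apply: smC_comp => //; apply: smC_M; [exact: smC_id|exact: smC_J (smC_id R)].
Qed.

Lemma tf_mono a b rho beta : beta < 1 -> (forall t, beta <= t -> rho t = 0) ->
  Csmooth setT rho -> test_function (mono a b rho).
Proof.
move=> b1 rho0 srho; apply: (@smC_tf _ _ (Num.sqrt beta)).
- by rewrite -sqrtr1 ltr_sqrt.
- move=> z zb; rewrite monoE rho0 ?mulr0//.
  have [b0|b0] := leP 0 beta; last by rewrite (le_trans (ltW b0))// sqr_ge0.
  by rewrite -(sqr_sqrtr b0) lerXn2r ?nnegrE ?sqrtr_ge0 ?cmod_ge0// ltW.
- exact: smC_mono.
Qed.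

(** The truncated exponents [a.-1] and [b.-1] are harmless at 0, where their coefficient
    vanishes. *)
Lemma wdiff_mono a b rho rho' z : (forall t : R, is_derive t 1 rho (rho' t)) ->
  wdiff (mono a b rho) z (a%:R * mono a.-1 b rho z + mono a b.+1 rho' z)
                         (b%:R * mono a b.-1 rho z + mono a.+1 b rho' z).
Proof.
move=> drho.
have dz := wdiff_id z; have dJ := wdiffJ dz.
have dX := wdiffX a z; have dY := wdiffJ (wdiffX b z).
have dzz : wdiff (fun w => w * conjc w) z _ _ := wdiffM dz dJ.
have dr := @wdiff_comp _ rho (rho' (Re (z * conjc z))) (fun w => w * conjc w) z _ _ (drho _) dzz.
have := wdiffM (wdiffM dX dY) dr.
rewrite /mono !conjc0 !cjM conjc_nat !cjX !conjc1 !(mul0r, mulr0, mul1r, addr0, add0r, mulr1) conjcK.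
set rr := (rho _)%:C; set rr' := (rho' _)%:C => h.
have -> : a%:R * (z ^+ a.-1 * conjc z ^+ b * rr) + z ^+ a * conjc z ^+ b.+1 * rr' =
   a%:R * z ^+ a.-1 * conjc z ^+ b * rr + z ^+ a * conjc z ^+ b * (rr' * ((conjc z + conjc z) / 2)).
  by rewrite exprS; field; exact: isT.
have -> : b%:R * (z ^+ a * conjc z ^+ b.-1 * rr) + z ^+ a.+1 * conjc z ^+ b * rr' =
   z ^+ a * (b%:R * conjc z ^+ b.-1) * rr + z ^+ a * conjc z ^+ b * (rr' * ((z + z) / 2)).
  by rewrite exprS; field; exact: isT.
by apply: wdiff_near h; exists 1 => // w _; rewrite cjX.
Qed.

(* The left-hand side is [zb d/dzb - z d/dz] applied to [z^a zb^b rho(|z|^2)]. *)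
Lemma rotation_mono a b rho z : Csmooth setT rho ->
  partial_zbar (mono a b.+1 rho) z - partial_z (mono a.+1 b rho) z = (b%:R - a%:R) * mono a b rho z.
Proof.
move=> /Csmooth_deriv[rho' drho _].
rewrite (wdiff_partial_zbar (wdiff_mono a b.+1 z drho)) (wdiff_partial_z (wdiff_mono a.+1 b z drho)) /=.
by rewrite -(natr1 a) -(natr1 b); ring.
Qed.

(** Off [[alpha, beta]] the product is locally zero, on [U] both factors are smooth, and these two
    open sets cover the line; [F] may be anything outside [U]. *)
Lemma Csmooth_cutoff U F rho alpha beta : open U -> `[alpha, beta]%classic `<=` U ->
  (forall n, Cder U n F) -> Csmooth setT rho -> (forall t, ~~ (alpha < t < beta) -> rho t = 0) ->
  Csmooth setT (fun t => F t * rho t).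
Proof.
move=> oU abU CF Crho rho0 n.
pose V := ~` `[alpha, beta]%classic.
have oV : open V by apply: closed_openC; exact: interval_closed.
apply: (Cder_union oU oV).
- by apply/seteqP; split => // t _; have [|] := pselect (`[alpha, beta]%classic t); [left; exact: abU|right].
- by apply: CderM => //; apply: Cder_sub (Crho n).
- apply: (@Cder_eq _ _ _ (fun=> 0)) => //; last exact: Cder_cst.
  move=> t Vt; rewrite rho0 ?mulr0//; apply/negP => /andP[at_ tb]; apply: Vt.
  by rewrite /= in_itv/= !ltW.
Qed.

(** A cut-off in t = |z|^2. It vanishes near 1, and also near 0, where smoothness of
    [lam (Num.sqrt t)] in [t] would call for a separate argument on even functions. *)
Definition chi (j : nat) : R -> R := win j.+2%:R^-1 (1 - j.+2%:R^-1) j.+1%:R.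

Lemma chi_bounds j : 0 < (j.+2%:R^-1 : R) /\ 1 - j.+2%:R^-1 < (1 : R).
Proof. by split; [rewrite invr_gt0|rewrite gtrBl invr_gt0]. Qed.

Lemma chi_supp j t : ~~ (j.+2%:R^-1 < t < 1 - j.+2%:R^-1) -> chi j t = 0.
Proof. exact: win_eq0. Qed.

Lemma chi_cvg t : 0 < t < 1 -> chi j t @[j --> \oo] --> (1 : R).
Proof.
have i2 : (n.+2%:R^-1 : R) @[n --> \oo] --> (0 : R).
  by have := @cvg_harmonic R; rewrite -(cvg_shiftS (@harmonic R)).
apply: win_cvg => //.
- rewrite -[X in _ --> X]subr0; apply: cvgB => //; exact: cvg_cst.
- by rewrite (cvg_shiftS (fun n => n%:R : R)); exact: cvgr_idn.
Qed.

Lemma smC_rad rho : Csmooth setT rho -> smoothC (fun z => (rho (Re (z * conjc z)))%:C).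
Proof. by move=> s; apply: smC_comp => //; apply: smC_M; [exact: smC_id|exact: smC_J (smC_id R)]. Qed.

Lemma origin_negligible : mu2.-negligible [set ((0, 0) : R * R)].
Proof.
have m0 : @measurable _ (measurableTypeR R) [set (0 : R)] by exact: measurable_set1.
exists ([set (0 : R)] `*` [set (0 : R)]); split.
- exact: measurableX.
- transitivity (@lebesgue_measure R [set 0%R] * @lebesgue_measure R [set 0%R])%E.
    exact: product_measure1E.
  by rewrite !lebesgue_measure_set1 mule0.
- by move=> [x y] [-> ->].
Qed.

Lemma cutoff_lim f : cintble D f ->
  ccvg (fun j => cint D (fun z => f z * (chi j (cmod z ^+ 2))%:C)) (cint D f).
Proof.
move=> fi; have mf := cintble_meas fi.
apply: (@cint_dct _ _ mD _ f (fun z => cmod (f z)) _ origin_negligible _ mf (cintble_cmod mD fi)).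
- move=> j; apply: cmeasM => //; apply: cmeas_cont => z.
  apply: (@ccont_near _ (fun z => (chi j (Re (z * conjc z)))%:C)).
    by exists 1 => // w _; rewrite sqE.
  by apply/smC_cont/smC_rad; exact: Csmooth_win.
- move=> j z _; rewrite cmodM cmod_real ger0_norm ?win_ge0//.
  by rewrite ler_piMr ?cmod_ge0// win_le1.
- move=> z zd z0; rewrite -[X in ccvg _ X]mulr1; apply: ccvgZ.
  have z00 : cmod z != 0.
    by apply: contra_not_neq z0 => /eqP; rewrite cmod_eq0 => /eqP ->.
  have zpos : 0 < cmod z ^+ 2 < 1.
    by rewrite exprn_even_gt0//= z00 expr_lt1// ?cmod_ge0.
  apply/ccvgP => e e0; have /cvgrPdist_lt/(_ _ e0) := chi_cvg zpos.
  by apply: filterS => j; rewrite -rcB cmod_real distrC.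
Qed.

(** Smoothness of a radial function on the plane passes to its profile by restriction to the
    positive real axis, along which the x derivative is the ordinary one. *)
Lemma Cn_axis n f : Cn_on D n f -> Cder [set t : R | 0 < t < 1] n (fun t => Re (f t%:C)).
Proof.
elim: n f => [//|n ih] f [df fx _]; exists (fun t => Re (partial_x f t%:C)); last exact: ih.
move=> t /andP[t0 t1].
have tD : D t%:C by rewrite /disc/mkset cmod_real gtr0_norm.
have [[dr _] _] := df _ tD.
have E : (fun h => h^-1 *: ((re_plane f \o shift (to_plane t%:C)) (h *: ((1, 0) : R * R)) -
      re_plane f (to_plane t%:C))) =
    (fun h => h^-1 *: (((fun t => Re (f t%:C)) \o shift t) (h *: (1 : R)) - Re (f t%:C))).
  apply/funext => h; congr (_ *: (Re (f _) - _)).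
  by rewrite /of_plane/= scaler0 addr0.
by apply: DeriveDef; [move: dr; rewrite /derivable E|rewrite /partial_x /pderive /derive E].
Qed.

(** Orthogonality in the angle without polar coordinates: both derivatives in [rotation_mono]
    integrate to 0, which leaves (b - a) times the integral. *)
Lemma mono_int0 a b rho beta : beta < 1 -> (forall t, beta <= t -> rho t = 0) ->
  Csmooth setT rho -> a != b -> cint D (mono a b rho) = 0.
Proof.
move=> b1 rho0 srho ab.
have t1 := tf_mono a b.+1 b1 rho0 srho; have t2 := tf_mono a.+1 b b1 rho0 srho.
have d1 z : D z -> wdiff (fun=> 1) z 0 0 by move=> _; exact: wdiff_cst.
have := weak_zbar d1 t1; have := weak_z d1 (fun z _ => ccont_cst 0 z) t2.
rewrite [X in _ = - X](_ : _ = 0) ?oppr0; last first.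
  by rewrite -[RHS](@cint0 R D); apply: eq_cint => z _; rewrite mul0r.
have [_ i1' _ _] := smC_partial (smC_mono a b.+1 srho).
have [i2' _ _ _] := smC_partial (smC_mono a.+1 b srho).
have i1 := cintble_cont (fun z => smC_cont z i1').
have i2 := cintble_cont (fun z => smC_cont z i2').
move=> h2 h1.
have := cintB mD i1 i2.
have -> : cint D (partial_zbar (mono a b.+1 rho)) = 0.
  by rewrite -h1; apply: eq_cint => z _; rewrite mul1r.
have -> : cint D (partial_z (mono a.+1 b rho)) = 0.
  by rewrite -h2; apply: eq_cint => z _; rewrite mul1r.
rewrite subrr; under eq_cint do rewrite rotation_mono//.
rewrite cintZ//; last by apply: cintble_cont => z; apply: smC_cont; exact: smC_mono.
move/eqP; rewrite mulf_eq0 subr_eq0 eqr_nat eq_sym (negbTE ab)/= => /eqP//.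
Qed.

End Radial.

(** * Power series on the disc and their termwise differentiation *)

Section PowerSeries.
Variable R : realType.
Local Notation D := (disc R).
Implicit Types (a u v : nat -> R[i]) (z w : R[i]) (r q : R).

Lemma ccvg_le u (l : R[i]) K : ccvg u l -> (forall n, cmod (u n) <= K) -> cmod l <= K.
Proof.
move=> /ccvgP ul uK; apply/ler_addgt0Pr => e e0.
have /filter_ex[n hn] := ul e e0; rewrite -[l](subrK (u n)) addrC.
by apply: le_trans (le_cmodD _ _) _; rewrite cmodB lerD// ltW.
Qed.

Lemma ccvgD u v (l l' : R[i]) : ccvg u l -> ccvg v l' -> ccvg (fun n => u n + v n) (l + l').
Proof.
move=> /ccvgP ul /ccvgP vl; apply/ccvgP => e e0.
have e2 : 0 < e / 2 by rewrite divr_gt0.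
near=> n; rewrite opprD addrACA [e]splitr; apply: le_lt_trans (le_cmodD _ _) _.
by apply: ltrD; near: n; [exact: ul|exact: vl].
Unshelve. all: by end_near. Qed.

Lemma ccvg_shift u (l : R[i]) k : ccvg u l -> ccvg (fun n => u (n + k)%N) l.
Proof.
by rewrite /ccvg => ul; rewrite (cvg_shiftn k (fun n => cmod (u n - l))).
Qed.

Definition psum a N z := \sum_(i < N) a i * z ^+ i.
Definition ps a z : R[i] := limn (fun n => Re (psum a n z)) +i* limn (fun n => Im (psum a n z)).

(** Abel's condition: a power series whose radius of convergence is at least 1. *)
Definition admissible a := forall r, 0 <= r < 1 -> exists M, forall n, cmod (a n) * r ^+ n <= M.

Lemma geometric_sum_le q N : 0 <= q < 1 -> \sum_(i < N) q ^+ i <= (1 - q)^-1.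
Proof.
move=> /andP[q0 q1]; have q1' : 0 < 1 - q by rewrite subr_gt0.
rewrite -[leRHS]mulr1 ler_pdivlMl//.
have := subrX1 q N; rewrite -opprB -[q - 1]opprB mulNr => /oppr_inj <-.
by rewrite gerBl exprn_ge0.
Qed.

(** Each of the n + 1 terms of the geometric sum up to q^n is at least q^n. *)
Lemma succ_geometric_le q n : 0 <= q < 1 -> n.+1%:R * q ^+ n <= (1 - q)^-1.
Proof.
move=> q01; apply: le_trans (geometric_sum_le n.+1 q01); case/andP: q01 => q0 q1.
rewrite -[n.+1 in X in X <= _]card_ord mulr_natl -sumr_const; apply: ler_sum => i _.
by apply: ler_wiXn2l; [exact: q0|exact: ltW|exact: (ltn_ord i)].
Qed.

Lemma admissible_sum a r : admissible a -> 0 <= r < 1 ->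
  exists2 K, 0 <= K & forall N, \sum_(i < N) cmod (a i) * r ^+ i <= K.
Proof.
(* Boundedness of the terms at the midpoint [r'] of [r] and 1 gives at [r] a geometric majorant of
   ratio [r / r']. *)
move=> adm /andP[r0 r1]; pose r' := (1 + r) / 2.
have r'0 : 0 < r' by rewrite /r'; lra.
have rr' : r < r' by rewrite /r'; lra.
have r'1 : r' < 1 by rewrite /r'; lra.
have [M aM] : exists M, forall n, cmod (a n) * r' ^+ n <= M by apply: adm; rewrite r'1 ltW.
have M0 : 0 <= M by apply: le_trans (aM 0%N); rewrite mulr_ge0 ?cmod_ge0 ?exprn_ge0// ltW.
have q01 : 0 <= r / r' < 1 by rewrite divr_ge0 ?(ltW r'0)//= ltr_pdivrMr// mul1r.
exists (M * (1 - r / r')^-1); first by rewrite mulr_ge0// invr_ge0 subr_ge0 ltW//; case/andP: q01.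
move=> N; apply: (@le_trans _ _ (\sum_(i < N) M * (r / r') ^+ i)).
  have rE : r = r / r' * r' by rewrite divfK ?gt_eqF.
  apply: ler_sum => i _.
  have -> : cmod (a i) * r ^+ i = cmod (a i) * r' ^+ i * (r / r') ^+ i by rewrite {1}rE exprMn; ring.
  by rewrite ler_wpM2r ?exprn_ge0//; case/andP: q01.
by rewrite -mulr_sumr ler_wpM2l// geometric_sum_le.
Qed.

Lemma bounded_series_cvg (u : R^nat) K : (forall N, \sum_(i < N) `|u i| <= K) -> cvgn (series u).
Proof.
move=> uK; apply: normed_cvg; apply: nondecreasing_is_cvgn.
  by apply/nondecreasing_seqP => n; rewrite /normed_series_of /series/= !big_mkord big_ord_recr/= lerDl.
by exists K => _ [N _ <-]; rewrite /normed_series_of /series/= big_mkord; exact: uK.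
Qed.

Lemma Re_sum (I : Type) (s : seq I) (F : I -> R[i]) :
  Re (\sum_(i <- s) F i) = \sum_(i <- s) Re (F i).
Proof. by elim: s => [|i s ih]; rewrite ?big_nil ?big_cons// ReD ih. Qed.

Lemma Im_sum (I : Type) (s : seq I) (F : I -> R[i]) :
  Im (\sum_(i <- s) F i) = \sum_(i <- s) Im (F i).
Proof. by elim: s => [|i s ih]; rewrite ?big_nil ?big_cons// ImD ih. Qed.

Lemma ps_cvg a z : admissible a -> D z -> ccvg (fun N => psum a N z) (ps a z).
Proof.
move=> adm zd; have z01 : 0 <= cmod z < 1 by rewrite cmod_ge0.
have [K K0 aK] := admissible_sum adm z01.
have cr : cvgn (fun n => Re (psum a n z)).
  have : cvgn (series (fun i => Re (a i * z ^+ i))).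
    apply: (@bounded_series_cvg _ K) => N; apply: le_trans (aK N); apply: ler_sum => i _.
    by rewrite -cmodX -cmodM le_Re_cmod.
  by congr (cvgn _); apply/funext => N; rewrite /series/= big_mkord Re_sum.
have ci : cvgn (fun n => Im (psum a n z)).
  have : cvgn (series (fun i => Im (a i * z ^+ i))).
    apply: (@bounded_series_cvg _ K) => N; apply: le_trans (aK N); apply: ler_sum => i _.
    by rewrite -cmodX -cmodM le_Im_cmod.
  by congr (cvgn _); apply/funext => N; rewrite /series/= big_mkord Im_sum.
apply/ccvgP => e e0; have e2 : 0 < e / 2 by rewrite divr_gt0.
move/cvgrPdist_lt : cr => /(_ _ e2) cr; move/cvgrPdist_lt : ci => /(_ _ e2) ci.
near=> n; apply: le_lt_trans (cmod_le _) _; rewrite ReB ImB [e]splitr; apply: ltrD; rewrite distrC.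
  by near: n; exact: cr.
by near: n; exact: ci.
Unshelve. all: by end_near. Qed.

Definition pder a n := n.+1%:R * a n.+1.

Lemma cmod_nat n : cmod (n%:R : R[i]) = n%:R.
Proof.
rewrite (_ : n%:R = (n%:R : R)%:C) ?cmod_real ?normr_nat//; exact/esym/rmorph_nat.
Qed.

(** The factor n + 1 is absorbed by the passage from [r] to a larger radius, since (n + 1) q^n stays
    bounded for q = r / r' < 1. *)
Lemma admissible_pder a : admissible a -> admissible (pder a).
Proof.
move=> adm r /andP[r0 r1]; pose r' := (1 + r) / 2.
have r'0 : 0 < r' by rewrite /r'; lra.
have rr' : r < r' by rewrite /r'; lra.
have r'1 : r' < 1 by rewrite /r'; lra.
have [M aM] : exists M, forall n, cmod (a n) * r' ^+ n <= M by apply: adm; rewrite r'1 ltW.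
have q01 : 0 <= r / r' < 1 by rewrite divr_ge0 ?(ltW r'0)//= ltr_pdivrMr// mul1r.
have q0 : 0 <= r / r' by case/andP: q01.
exists ((1 - r / r')^-1 * (M / r')) => n.
have rE : r = r / r' * r' by rewrite divfK ?gt_eqF.
rewrite /pder cmodM cmod_nat [X in _ * X ^+ _]rE exprMn.
rewrite mulrACA; apply: ler_pM.
- by rewrite mulr_ge0 ?exprn_ge0.
- by rewrite mulr_ge0 ?cmod_ge0 ?exprn_ge0// ltW.
- exact: succ_geometric_le.
- by rewrite ler_pdivlMr// -mulrA -exprSr.
Qed.

Lemma admissible_iter a b : admissible a -> admissible (iter b pder a).
Proof. by move=> adm; elim: b => [//|b ih]; exact: admissible_pder. Qed.

Let T n w z := w ^+ n - z ^+ n - n%:R * z ^+ n.-1 * (w - z).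

(** The remainders obey T (m + 2) = w T (m + 1) + (m + 1) z^m (w - z)^2, and T 0 and T 1 vanish,
    whence the shift of the index by 2. *)
Lemma taylor2_monomial n w z r : cmod w <= r -> cmod z <= r ->
  cmod (T n.+2 w z) <= n.+2%:R * n.+1%:R * r ^+ n * cmod (w - z) ^+ 2.
Proof.
move=> wr zr; have r0 : 0 <= r by exact: le_trans (cmod_ge0 z) zr.
have TS m : T m.+2 w z = w * T m.+1 w z + m.+1%:R * z ^+ m * (w - z) ^+ 2.
  by rewrite /T/= !exprS -(natr1 m.+1); ring.
have bd m : cmod (m.+1%:R * z ^+ m * (w - z) ^+ 2) <= m.+1%:R * r ^+ m * cmod (w - z) ^+ 2.
  rewrite cmodM cmodX cmodM cmodX cmod_nat ler_wpM2r ?sqr_ge0// ler_wpM2l//.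
  by apply: lerXn2r; rewrite ?nnegrE ?cmod_ge0.
elim: n => [|n ih].
  have T1 : T 1 w z = 0 by rewrite /T/= !expr1 expr0; ring.
  rewrite TS T1 mulr0 add0r; apply: le_trans (bd 0%N) _.
  by rewrite ler_wpM2r ?sqr_ge0// expr0 !mulr1 ler_nat.
rewrite TS; apply: le_trans (le_cmodD _ _) _; rewrite cmodM.
apply: (@le_trans _ _ (r * (n.+2%:R * n.+1%:R * r ^+ n * cmod (w - z) ^+ 2) +
    n.+2%:R * r ^+ n.+1 * cmod (w - z) ^+ 2)).
  by apply: lerD => //; apply: ler_pM => //; exact: cmod_ge0.
rewrite [leLHS](_ : _ = (n.+2%:R * (n.+1%:R + 1)) * (r ^+ n.+1 * cmod (w - z) ^+ 2)); last first.
  by rewrite (exprS r n); ring.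
rewrite -[leRHS]mulrA ler_wpM2r ?mulr_ge0 ?exprn_ge0 ?sqr_ge0 ?cmod_ge0//.
by rewrite natr1 ler_wpM2r// ler_nat.
Qed.

Lemma taylor2_psum a N w z r : cmod w <= r -> cmod z <= r ->
  cmod (psum a N.+2 w - psum a N.+2 z - psum (pder a) N.+1 z * (w - z)) <=
  (\sum_(i < N) cmod (pder (pder a) i) * r ^+ i) * cmod (w - z) ^+ 2.
Proof.
move=> wr zr.
have -> : psum a N.+2 w - psum a N.+2 z - psum (pder a) N.+1 z * (w - z) =
    \sum_(i < N.+2) a i * T i w z.
  have -> : psum (pder a) N.+1 z = \sum_(i < N.+2) a i * (i%:R * z ^+ i.-1).
    rewrite [RHS]big_ord_recl mul0r mulr0 add0r; apply: eq_bigr => i _.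
    by rewrite /pder !lift0/=; ring.
  rewrite /psum mulr_suml -!sumrB; apply: eq_bigr => i _; rewrite /T; ring.
rewrite !big_ord_recl.
have -> : T (ord0 : 'I_N.+2) w z = 0 by rewrite /T/= !expr0; ring.
have -> : T (lift ord0 (ord0 : 'I_N.+1)) w z = 0 by rewrite /T !lift0/= !expr1 expr0; ring.
rewrite !mulr0 !add0r mulr_suml; apply: le_trans (cmod_sum _ _ _) _; apply: ler_sum => i _.
rewrite cmodM !lift0; apply: le_trans (ler_wpM2l (cmod_ge0 _) (taylor2_monomial i wr zr)) _.
rewrite /pder !cmodM !cmod_nat le_eqVlt; apply/orP; left; apply/eqP; ring.
Qed.

(** The Taylor remainder of a partial sum is bounded by the absolute sum of the twice differentiated
    series times |w - z|^2. That constant does not depend on the number of terms, so the bound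
    survives in the limit. *)
Lemma wdiff_ps a z : admissible a -> D z -> wdiff (ps a) z (ps (pder a) z) 0.
Proof.
move=> adm zd; apply: wdiff_eps => e e0.
have z1 : cmod z < 1 := zd; have z0 := cmod_ge0 z.
pose r := (1 + cmod z) / 2.
have r01 : 0 <= r < 1 by rewrite /r; apply/andP; split; lra.
have zr : cmod z <= r by rewrite /r; lra.
have [K K0 aK] := admissible_sum (admissible_pder (admissible_pder adm)) r01.
have K1 : 0 < K + 1 by rewrite ltr_wpDl.
(* The first bound keeps [w] within radius [r], the second makes K |w - z| at most [e]; K + 1 is
   used because K may be 0. *)
exists (Order.min ((1 - cmod z) / 2) (e / (K + 1))).
  by rewrite lt_min !divr_gt0// subr_gt0.
move=> w; rewrite lt_min => /andP[w1 w2].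
have wr : cmod w <= r.
  rewrite -[w](subrK z); apply: le_trans (le_cmodD _ _) _; rewrite /r; lra.
have wd : D w by apply: le_lt_trans wr _; case/andP: r01.
rewrite mul0r subr0; apply: (@le_trans _ _ (K * cmod (w - z) ^+ 2)); last first.
  rewrite expr2 mulrA ler_wpM2r ?cmod_ge0//.
  apply: le_trans (_ : (K + 1) * cmod (w - z) <= _); first by rewrite ler_wpM2r ?cmod_ge0// lerDl.
  by rewrite mulrC -ler_pdivlMr// ltW.
apply: (@ccvg_le (fun N => psum a N.+2 w - psum a N.+2 z - psum (pder a) N.+1 z * (w - z))); last first.
  move=> N; apply: le_trans (taylor2_psum _ _ wr zr) _.
  by rewrite ler_wpM2r ?sqr_ge0.
have h1 := ccvg_shift 2 (ps_cvg adm wd); have h2 := ccvg_shift 2 (ps_cvg adm zd).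
have h3 := ccvg_shift 1 (ps_cvg (admissible_pder adm) zd).
have := ccvgD (ccvgD h1 (ccvgZ (-1) h2)) (ccvgZ (- (w - z)) h3).
rewrite !mulN1r mulNr [_ * ps _ _]mulrC; apply: ccvg_ext => n.
by rewrite addn2 addn1 mulN1r mulNr [_ * psum _ _ _]mulrC.
Qed.

Lemma ps_cont a z : admissible a -> D z -> ccont (ps a) z.
Proof. by move=> adm zd; exact: wdiff_cont (wdiff_ps adm zd). Qed.

Lemma psum_cont a N z : ccont (psum a N) z.
Proof.
by apply: ccont_sum => i; apply: ccontM; [exact: ccont_cst|apply: ccontX; exact: ccont_id].
Qed.

Lemma cmeas_ps a : admissible a -> cmeasurable D (ps a).
Proof.
move=> adm; apply: (@cmeas_lim _ D (psum a)) => [N|z zd]; last exact: ps_cvg.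
by apply: cmeas_cont => z; exact: psum_cont.
Qed.

End PowerSeries.

(** * Holomorphic functions against radial test functions, and the Landau kernel *)

Section Moments.
Variable R : realType.
Notation mu := (@lebesgue_measure R).
Notation mu2 := (leb2 R).
Notation P2 := (measurableTypeR R * measurableTypeR R)%type.
Local Notation pre A := (of_plane @^-1` A).
Local Notation D := (disc R).
Let mD := measurable_disc R.
Implicit Types (u v : R[i] -> R[i]) (z w p : R[i]) (F G rho tau : R -> R) (alpha beta : R).

Definition supported rho alpha beta := forall t, ~~ (alpha < t < beta) -> rho t = 0.

Lemma derive0_cst F F' (a b : R) : a <= b -> (forall t : R, is_derive t 1 F (F' t)) ->
  (forall t, a <= t <= b -> F' t = 0) -> F a = F b.
Proof.
move=> ab dF F0; have cF : continuous F.
  by move=> t; apply: differentiable_continuous; apply/derivable1_diffP; have [] := dF t.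
have [c cab] := MVT_segment ab (fun x _ => dF x) (continuous_subspaceT cF).
by rewrite F0 ?mul0r; [move/eqP; rewrite subr_eq0 => /eqP|move: cab; rewrite in_itv].
Qed.

Lemma antiderivative rho alpha beta : Csmooth setT rho -> supported rho alpha beta ->
  exists G, [/\ forall t : R, is_derive t 1 G (rho t), forall t, t <= alpha -> G t = 0 &
    forall t, beta <= t -> G t = G beta].
Proof.
move=> srho rho0.
have crho : continuous rho by move=> t; exact: (Cder_cont (srho 1%N)).
pose G t := \int[mu]_(x in `]-oo, t]) rho x.
have irho : mu.-integrable setT (EFin \o rho).
  have iab : mu.-integrable `[alpha, beta] (EFin \o rho).
    by apply: continuous_compact_integrable; [exact: segment_compact|exact: continuous_subspaceT].
  move/integrable_mkcond : iab => /(_ (measurable_itv _)).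
  congr (_.-integrable _ _); apply/funext => t; rewrite patchE.
  case: ifPn => // /negP tab; rewrite /= rho0//; apply/negP => /andP[at_ tb]; apply: tab.
  by rewrite inE/= in_itv/= !ltW.
have dG (t : R) : is_derive t 1 G (rho t).
  have tt1 : t < t + 1 by rewrite ltrDl.
  have it : mu.-integrable `]-oo, (t + 1)] (EFin \o rho).
    by apply: integrableS irho => //; exact: measurable_itv.
  have [|d1 d2] := continuous_FTC1 tt1 it _ (crho t); first by rewrite ltNye.
  by apply: (DeriveDef d1); rewrite -derive1E; exact: d2.
exists G; split => //.
- move=> t ta; rewrite /G /Rintegral integral0_eq// => x; rewrite /= in_itv/= => xt.
  by rewrite rho0//; apply/negP => /andP[ax _]; move: (lt_le_trans ax xt); rewrite ltNge ta.
- move=> t bt; apply/esym/(derive0_cst bt dG) => s /andP[bs _].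
  by rewrite rho0//; apply/negP => /andP[_]; rewrite ltNge bs.
Qed.

Lemma Csmooth_antiderivative rho G : Csmooth setT rho -> (forall t : R, is_derive t 1 G (rho t)) ->
  Csmooth setT G.
Proof. by move=> srho dG [//|n]; exists rho. Qed.

Lemma supported_ge rho alpha beta t : supported rho alpha beta -> beta <= t -> rho t = 0.
Proof. by move=> rho0 bt; apply: rho0; apply/negP => /andP[_]; rewrite ltNge bt. Qed.

(** With [psi] the antiderivative of [rho] that vanishes beyond [beta], [mono m.+1 0 rho] is the zb
    derivative of [mono m 0 psi]. Near 0 [psi] is constant but perhaps nonzero, which a test
    function allows. *)
Lemma moment_holo_pos u u' m rho alpha beta : (forall z, D z -> wdiff u z (u' z) 0) ->
  Csmooth setT rho -> supported rho alpha beta -> beta < 1 ->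
  cint D (fun z => u z * mono m.+1 0 rho z) = 0.
Proof.
move=> du srho rho0 b1; have [G [dG _ Gb]] := antiderivative srho rho0.
have dpsi (t : R) : is_derive t 1 (fun t => G t - G beta) (rho t).
  rewrite -[rho t]subr0; exact: (is_deriveB (dG t) (is_derive_cst (G beta) t 1)).
have spsi := Csmooth_antiderivative srho dpsi.
have psi0 t : beta <= t -> G t - G beta = 0 by move=> bt; rewrite Gb ?subrr.
rewrite -(weak_zbar du (tf_mono m 0 b1 psi0 spsi)); apply: eq_cint => z _.
by rewrite (wdiff_partial_zbar (wdiff_mono m 0 z dpsi)) mul0r add0r.
Qed.

(** To write zb^m tau as the zb derivative of zb^(m+1) rho one solves (m + 1) rho + t rho' = tau,
    that is (t^(m+1) rho)' = t^m tau. The solution t^-(m+1) G is a test profile because [G] vanishes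
    outside the interval, in particular near 0. *)
Lemma moment_holo_neg u u' m tau G alpha beta : (forall z, D z -> wdiff u z (u' z) 0) ->
  Csmooth setT tau -> supported tau alpha beta -> 0 < alpha -> beta < 1 ->
  (forall t : R, is_derive t 1 G (t ^+ m * tau t)) -> supported G alpha beta ->
  cint D (fun z => u z * mono 0 m tau z) = 0.
Proof.
move=> du stau tau0 a0 b1 dG G0.
have sT : Csmooth setT (fun t : R => t ^+ m * tau t).
  by move=> n; apply: CderM => //; apply: CderX; exact: Cder_id.
have sG := Csmooth_antiderivative sT dG.
pose rho t := t^-1 ^+ m.+1 * G t.
have srho : Csmooth setT rho.
  apply: (@Csmooth_cutoff _ [set t | 0 < t] _ _ alpha beta) => //.
  - by move=> t; rewrite /= in_itv/= => /andP[+ _]; exact: lt_le_trans.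
  - by move=> n; apply: CderX; exact: Cder_inv.
have rho0 t : beta <= t -> rho t = 0 by move=> bt; rewrite /rho (supported_ge G0)// mulr0.
have [rho' drho _] := Csmooth_deriv srho.
have rG t : t ^+ m.+1 * rho t = G t.
  have [->|t0] := eqVneq t 0; last by rewrite /rho mulrA -exprMn divff// expr1n mul1r.
  by rewrite expr0n mul0r G0//; apply/negP => /andP[+ _]; rewrite ltNge ltW.
have key t : 0 <= t -> m.+1%:R * rho t + t * rho' t = tau t.
  rewrite le_eqVlt => /orP[/eqP <-|t0].
    rewrite mul0r addr0 tau0; last by apply/negP => /andP[+ _]; rewrite ltNge ltW.
    by rewrite /rho G0 ?mulr0//; apply/negP => /andP[+ _]; rewrite ltNge ltW.
  have dX := is_deriveM (is_deriveX m.+1 (is_derive_id t 1)) (drho t).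
  have [_ e1] := dX; have [_ e2] := dG t.
  have eG : (id ^+ m.+1 : R -> R) * rho = G.
    by apply/funext => s; rewrite -rG/=; congr (_ * _); elim: m.+1 => [|k ih]//; rewrite ?exprS ?fctE -?ih.
  have tm : t ^+ m != 0 by rewrite expf_neq0// gt_eqF.
  apply: (mulfI tm); rewrite -e2 -eG e1 exprfctE /= /GRing.scale/= exprS; ring.
rewrite -(weak_zbar du (tf_mono 0 m.+1 b1 rho0 srho)); apply: eq_cint => z _.
rewrite (wdiff_partial_zbar (wdiff_mono 0 m.+1 z drho)) /=; congr (_ * _).
rewrite !monoE expr0 mul1r expr1; have <- := key _ (sqr_ge0 (cmod z)).
rewrite rcD (rcM _ (rho _)) (rcM _ (rho' _)) (rmorph_nat (real_complex R)) -mulJ_cmod (exprS (conjc z)); ring.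
Qed.

(* The functional [tau |-> int u zb^m tau(|z|^2)] only depends on [int t^m tau]. *)
Lemma moment_holo_proportional u u' v v' m tau1 tau2 alpha beta :
  (forall z, D z -> wdiff u z (u' z) 0) -> (forall z, D z -> wdiff v z (v' z) 0) ->
  Csmooth setT tau1 -> Csmooth setT tau2 ->
  supported tau1 alpha beta -> supported tau2 alpha beta -> 0 < alpha -> beta < 1 ->
  cint D (fun z => u z * mono 0 m tau1 z) * cint D (fun z => v z * mono 0 m tau2 z) =
  cint D (fun z => u z * mono 0 m tau2 z) * cint D (fun z => v z * mono 0 m tau1 z).
Proof.
move=> du dv s1 s2 p1 p2 a0 b1.
have sT tau : Csmooth setT tau -> Csmooth setT (fun t : R => t ^+ m * tau t).
  by move=> stau n; apply: CderM => //; apply: CderX; exact: Cder_id.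
have pT tau : supported tau alpha beta -> supported (fun t : R => t ^+ m * tau t) alpha beta.
  by move=> ptau t /ptau ->; rewrite mulr0.
have [G1 [dG1 G1a G1b]] := antiderivative (sT _ s1) (pT _ p1).
have [G2 [dG2 G2a G2b]] := antiderivative (sT _ s2) (pT _ p2).
have int_mono (g g' : R[i] -> R[i]) tau : (forall z, D z -> wdiff g z (g' z) 0) -> Csmooth setT tau ->
    supported tau alpha beta -> cintble D (fun z => g z * mono 0 m tau z).
  move=> dw stau ptau; apply: cintble_cont => z; apply: tf_mulcont.
    by move=> y yd; exact: wdiff_cont (dw y yd).
  by apply: tf_mono stau; [exact: b1|move=> t; exact: (supported_ge ptau)].
(* [G1 beta] and [G2 beta] are the total integrals of t^m tau1 and t^m tau2; in the combination
   below they cancel, so its antiderivative vanishes on both sides of the interval. *)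
have key (g g' : R[i] -> R[i]) : (forall z, D z -> wdiff g z (g' z) 0) ->
    (G2 beta)%:C * cint D (fun z => g z * mono 0 m tau1 z) =
    (G1 beta)%:C * cint D (fun z => g z * mono 0 m tau2 z).
  move=> dw.
  have i1 := int_mono _ _ _ dw s1 p1; have i2 := int_mono _ _ _ dw s2 p2.
  apply/eqP; rewrite -subr_eq0 -!cintZ// -cintB//; try exact: cintbleZ.
  apply/eqP; transitivity (cint D (fun z => g z * mono 0 m (fun t => G2 beta * tau1 t - G1 beta * tau2 t) z)).
    by apply: eq_cint => z _; rewrite !monoE rcB !rcM; ring.
  apply: (@moment_holo_neg g g' m (fun t => G2 beta * tau1 t - G1 beta * tau2 t)
      (fun t => G2 beta * G1 t - G1 beta * G2 t) alpha beta) => //.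
  - by move=> n; apply: CderB; exact: CderZ.
  - by move=> t pt; rewrite p1// p2// !mulr0 subrr.
  - move=> t; have := is_deriveB (is_deriveZ (G2 beta) (dG1 t)) (is_deriveZ (G1 beta) (dG2 t)).
    by congr (is_derive _ _ _ _); rewrite /GRing.scale/=; ring.
  - move=> t; rewrite negb_and -!leNgt => /orP[ta|bt].
      by rewrite (G1a _ ta) (G2a _ ta) !mulr0 subrr.
    by rewrite (G1b _ bt) (G2b _ bt) mulrC subrr.
have z0 (g g' : R[i] -> R[i]) tau G : (forall z, D z -> wdiff g z (g' z) 0) -> Csmooth setT tau ->
    supported tau alpha beta -> (forall t : R, is_derive t 1 G (t ^+ m * tau t)) ->
    (forall t, t <= alpha -> G t = 0) -> (forall t, beta <= t -> G t = G beta) -> G beta = 0 ->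
    cint D (fun z => g z * mono 0 m tau z) = 0.
  move=> dw stau ptau dG Ga Gb G0; apply: (moment_holo_neg dw stau ptau a0 b1 dG).
  by move=> t; rewrite negb_and -!leNgt => /orP[/Ga//|/Gb ->].
(* If the first total integral is 0, each product contains a vanishing factor; otherwise it can be
   cancelled. *)
have [G10|G10] := eqVneq (G1 beta) 0.
  by rewrite (z0 u u' tau1 G1)// (z0 v v' tau1 G1)// mul0r mulr0.
have C0 : (G1 beta)%:C != 0 by rewrite -[0]/(0%:C) (inj_eq (@complexI R)).
have ku := key _ _ du; have kv := key _ _ dv.
apply: (mulfI C0); by rewrite mulrCA -kv mulrCA mulrA ku -mulrA.
Qed.

Lemma Rint_box (F : R * R -> R) (k a b s : R) : 0 < s -> 0 <= k -> mu2.-integrable (pre D) (EFin \o F) ->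
  (forall q : R * R, pre D q -> 0 <= F q) -> hitv a s `*` hitv b s `<=` pre D ->
  (forall x y, hitv a s x -> hitv b s y -> k <= F (x, y)) ->
  k * s ^+ 2 <= Rintegral mu2 (pre D) F.
Proof.
move=> s0 k0 iF F0 sub kF.
have mF : @measurable_fun _ _ P2 R (pre D) F by move/measurable_int/measurable_EFinP: iF.
have mB : @measurable _ P2 (hitv a s `*` hitv b s).
  by apply: measurableX; exact: measurable_itv.
rewrite -lee_fin /Rintegral fineK; last exact: integrable_fin_num.
apply: (@le_trans _ _ (\int[mu2]_(p in hitv a s `*` hitv b s) (F p)%:E)%E); last first.
  apply: ge0_subset_integral => //.
  by apply/measurable_EFinP; exact: mF.
rewrite (_ : (k * s ^+ 2)%:E = \int[mu2]_(p in hitv a s `*` hitv b s) (cst k%:E p))%E; last first.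
  transitivity (k%:E * mu2 (hitv a s `*` hitv b s))%E; last exact/esym/integral_cst.
  by rewrite square_measure// -EFinM expr2.
apply: ge0_le_integral => //.
- by apply/measurable_EFinP; apply: measurable_funS mF.
- by move=> [x y] [/= hx hy]; rewrite lee_fin; exact: kF.
Qed.

Lemma geometric_dominates (q Q A B : R) : 0 < q -> q < Q -> 0 < A -> exists N, B * q ^+ N < A * Q ^+ N.
Proof.
move=> q0 qQ A0; have Q0 := lt_trans q0 qQ.
have q1 : `|q / Q| < 1 by rewrite ger0_norm ?divr_ge0 ?ltW// ltr_pdivrMr// mul1r.
have := @cvg_geometric R B _ q1; move/cvgrPdist_lt/(_ _ A0)/filter_ex => [N].
rewrite /geometric/= sub0r normrN => /(le_lt_trans (ler_norm _)) h; exists N.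
by rewrite -ltr_pdivrMr ?exprn_gt0// -mulrA -expr_div_n.
Qed.

(** For [z] and [p] in the disc |z - p| < 2, so that division by 4 keeps the kernel positive; its
    maximum 1 is attained at [z = p] only. *)
Definition landau p z : R[i] := (1 - cmod (z - p) ^+ 2 / 4)%:C.

Lemma landau_poly p z : landau p z = 1 - (z - p) * conjc (z - p) / 4.
Proof.
rewrite /landau mulJ_cmod rcB rcM rcV; congr (_ - _ / _); exact: (rmorph_nat (real_complex R)).
Qed.

Lemma landau_cont p z : ccont (landau p) z.
Proof.
apply: (@ccont_near _ (fun z => 1 - (z - p) * conjc (z - p) / 4)).
  by exists 1 => // w _; rewrite landau_poly.
apply: ccontB; first exact: ccont_cst.
have h : ccont (fun w => w - p) z by apply: ccontB; [exact: ccont_id|exact: ccont_cst].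
by apply: ccontM; [apply: ccontM => //; exact: ccontJ|exact: ccont_cst].
Qed.

(* The powers of the Landau kernel concentrate at [p], so a continuous function
   orthogonal to all of them vanishes there. *)
Lemma landau_concentration v p : (forall z, ccont v z) -> D p ->
  (forall N, cint D (fun z => v z * landau p z ^+ N) = 0) -> v p = 0.
Proof.
move=> cv pd vN; apply/eqP/negPn/negP => vp0.
(* Multiplication by conj (v p) makes the value at [p] a positive real number, after which only real
   parts matter. *)
pose g z := conjc (v p) * v z; pose s z := Re (g z).
have cg z : ccont g z by apply: ccontM; [exact: ccont_cst|exact: cv].
pose c := cmod (v p) ^+ 2; have c0 : 0 < c by rewrite exprn_gt0// cmod_gt0.
have sp : s p = c by rewrite /s /g mulrC mulJ_cmod.
have c2 : 0 < c / 2 by rewrite divr_gt0.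
have [d' d'0 d'P] := cg p _ c2.
have p1 : cmod p < 1 := pd.
pose d := Order.min d' (1 - cmod p).
have d0 : 0 < d by rewrite lt_min d'0 subr_gt0.
have dd' : d <= d' by rewrite ge_min lexx.
have dp : d <= 1 - cmod p by rewrite ge_min lexx orbT.
have d1 : d <= 1 by apply: le_trans dp _; rewrite gerBl cmod_ge0.
have snear z : cmod (z - p) < d -> c / 2 <= s z.
  move=> zp; have := d'P z (lt_le_trans zp dd'); have := le_Re_cmod (g z - g p).
  by rewrite ReB -/(s z) -/(s p) sp ler_norml => /andP[h _]; lra.
have [M M0 MP] : exists2 M, 0 < M & forall z, D z -> `|s z| <= M.
  have [M MP] := @bounded_continuous2 _ (re_plane g) (-1) 1 (-1) 1 (ccont_plane cg).1.
  exists (`|M| + 1); first by rewrite ltr_wpDl.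
  move=> z zd; apply: le_trans (_ : M <= _); last by rewrite (le_trans (ler_norm M))// lerDl.
  have h1 : -1 <= Re z <= 1 by rewrite -ler_norml (le_trans (le_Re_cmod z))// ltW.
  have h2 : -1 <= Im z <= 1 by rewrite -ler_norml (le_trans (le_Im_cmod z))// ltW.
  have := MP _ _ h1 h2; rewrite /re_plane (_ : of_plane (Re z, Im z) = z)//; by case: (z).
(* The kernel is at most [q] beyond distance [d] of [p] and at least [Q] within distance [d / 2]; as
   q < Q, the inner contribution wins for a large power. *)
pose q := 1 - d ^+ 2 / 4; pose Q := 1 - (d / 2) ^+ 2 / 4.
have dsq : d ^+ 2 <= 1 by rewrite exprn_ile1// ltW.
have q0 : 0 < q by rewrite /q; move: dsq; lra.
have qQ : q < Q.
  have : 0 < d ^+ 2 by rewrite exprn_gt0.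
  by rewrite /q /Q expr_div_n; lra.
have Q0 : 0 <= Q by rewrite ltW// (lt_trans q0).
(* A square of side [d / 4] with corner [p] stays within distance [d / 2] of [p]. *)
pose eta := d / 4; have eta0 : 0 < eta by rewrite divr_gt0.
pose K := Re (cint D (fun=> 1)).
have A0 : 0 < c / 2 * eta ^+ 2 by rewrite mulr_gt0// exprn_gt0.
have [N NP] := geometric_dominates (M * K) q0 qQ A0.
(* The added constant makes the real part nonnegative on the whole disc, so that its integral may be
   bounded below by that over a small square. *)
pose Phi z := g z * landau p z ^+ N + (M * q ^+ N)%:C.
have iL : cintble D (fun z => v z * landau p z ^+ N).
  by apply: cintble_cont => z; apply: ccontM; [exact: cv|apply: ccontX; exact: landau_cont].
have iPhi : cintble D Phi.
  apply: (cintbleD mD); last by apply: cintble_cont => z; exact: ccont_cst.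
  by apply: cintble_cont => z; apply: ccontM; [exact: cg|apply: ccontX; exact: landau_cont].
have PhiE z : Re (Phi z) = s z * (1 - cmod (z - p) ^+ 2 / 4) ^+ N + M * q ^+ N.
  by rewrite /Phi ReD /landau -rcX ReMr.
have intPhi : Rintegral mu2 (pre D) (re_plane Phi) = M * q ^+ N * K.
  rewrite -[LHS]/(Re (cint D Phi)).
  have -> : cint D Phi = conjc (v p) * cint D (fun z => v z * landau p z ^+ N) +
      cint D (fun=> 1) * (M * q ^+ N)%:C.
    rewrite [X in _ + X]mulrC -!cintZ// -?cintD//.
    - by apply: eq_cint => z _; rewrite mulr1 mulrA.
    - exact: (cintbleZ mD).
    - by apply/(cintbleZ mD)/cintble_cont => z; exact: ccont_cst.
    - by apply: cintble_cont => z; exact: ccont_cst.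
  by rewrite vN mulr0 add0r ReMr mulrC.
have kD z : D z -> 0 <= 1 - cmod (z - p) ^+ 2 / 4.
  move=> zd; have : cmod (z - p) <= 2.
    by apply: le_trans (le_cmodD _ _) _; rewrite cmodN; move: (zd : cmod z < 1); lra.
  move=> h; have : cmod (z - p) ^+ 2 <= 2 ^+ 2 by rewrite lerXn2r// ?nnegrE ?cmod_ge0.
  by rewrite [2 ^+ 2](_ : _ = 4); [lra|ring].
have boxp x y : hitv (Re p) eta x -> hitv (Im p) eta y -> cmod (x +i* y - p) < d / 2.
  rewrite /hitv/= !in_itv/= => /andP[x1 x2] /andP[y1 y2].
  apply: le_lt_trans (cmod_le _) _; rewrite ReB ImB [Re (x +i* y)]/= [Im (x +i* y)]/=.
  by rewrite !ger0_norm ?subr_ge0//; move: x2 y2; rewrite /eta; lra.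
have Mq0 : 0 <= M * q ^+ N by rewrite mulr_ge0 ?exprn_ge0// ltW.
have : c / 2 * Q ^+ N * eta ^+ 2 <= Rintegral mu2 (pre D) (re_plane Phi).
  apply: (@Rint_box _ _ (Re p) (Im p)) => //.
  - by rewrite mulr_ge0 ?exprn_ge0// ltW.
  - exact: iPhi.1.
  - move=> x xd; rewrite /re_plane PhiE; set z := of_plane x.
    have zd : D z := xd; have k0 := kD z zd.
    have [zp|zp] := ltP (cmod (z - p)) d.
      by rewrite addr_ge0// mulr_ge0 ?exprn_ge0// (le_trans _ (snear z zp))// ltW.
    have kq : (1 - cmod (z - p) ^+ 2 / 4) ^+ N <= q ^+ N.
      apply: lerXn2r; rewrite ?nnegrE ?(ltW q0)// /q lerD2l lerN2 ler_pM2r//.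
      by apply: lerXn2r; rewrite ?nnegrE ?cmod_ge0// ltW.
    have h : `|s z * (1 - cmod (z - p) ^+ 2 / 4) ^+ N| <= M * q ^+ N.
      by rewrite normrM (ger0_norm (exprn_ge0 _ k0)) ler_pM// ?exprn_ge0// MP.
    by move: h; rewrite ler_norml => /andP[h _]; rewrite -(addNr (M * q ^+ N)) lerD2r.
  - move=> [x y] [/= hx hy]; have h := boxp _ _ hx hy.
    apply: le_lt_trans (_ : cmod ((x +i* y - p) + p) < 1); first by rewrite subrK.
    by apply: le_lt_trans (le_cmodD _ _) _; lra.
  - move=> x y hx hy; have h := boxp _ _ hx hy; rewrite /re_plane PhiE -[leLHS]addr0.
    rewrite -[of_plane _]/(x +i* y); apply: lerD => //.
    have hd : cmod (x +i* y - p) < d by lra.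
    apply: ler_pM; rewrite ?exprn_ge0// ?(ltW c2)//; first exact: snear.
    have kQ : Q <= 1 - cmod (x +i* y - p) ^+ 2 / 4.
      rewrite /Q lerD2l lerN2 ler_pM2r//.
      by apply: lerXn2r; rewrite ?nnegrE ?cmod_ge0 ?divr_ge0 ?(ltW d0)// ltW.
    by apply: lerXn2r; rewrite ?nnegrE// (le_trans Q0).
rewrite intPhi leNgt => /negP; apply.
by rewrite (mulrAC M) (mulrAC (c / 2)).
Qed.

End Moments.

(** * Uniqueness of weak derivatives almost everywhere *)

Section DuBoisReymond.
Variable R : realType.
Notation mu2 := (leb2 R).
Notation mR := (measurableTypeR R).
Notation P2 := (mR * mR)%type.
Local Notation pre A := (of_plane @^-1` A).
Local Notation D := (disc R).
Let mD := measurable_disc R.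
Implicit Types (f g w phi : R[i] -> R[i]) (z : R[i]).

(** The sets with vanishing integral form a Dynkin system. Stated for preimages under [f] inside a
    fixed set [C], this serves for either coordinate alone and for the plane. *)
Lemma dynkin_integral (d : measure_display) (T : measurableType d) (f : P2 -> T) (G : set (set T))
    (C : set P2) (F : P2 -> \bar R) :
  measurable_fun setT f -> measurable C -> mu2.-integrable setT F ->
  @measurable d T = <<s G >> -> setI_closed G ->
  (forall A, G A -> \int[mu2]_(x in f @^-1` A `&` C) F x = 0)%E -> (\int[mu2]_(x in C) F x = 0)%E ->
  forall A, measurable A -> (\int[mu2]_(x in f @^-1` A `&` C) F x = 0)%E.
Proof.
move=> mf mC iF mG GI G0 C0.
pose H := [set A | measurable A /\ (\int[mu2]_(x in f @^-1` A `&` C) F x = 0)%E].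
have mA A : measurable A -> measurable (f @^-1` A `&` C).
  by move=> mA; apply: measurableI => //; rewrite -[f @^-1` A]setTI; exact: mf.
have iS B : measurable B -> mu2.-integrable B F.
  by move=> mB; apply: integrableS iF.
have dH : dynkin H.
  split.
  - by split; [exact: measurableT|rewrite preimage_setT setTI].
  - move=> A [mA' A0]; split; first exact: measurableC.
    have mA1 := mA _ mA'; have mA2 := mA _ (measurableC mA').
    have CE : C = (f @^-1` A `&` C) `|` (f @^-1` (~` A) `&` C).
      by rewrite -setIUl -preimage_setU setUCr preimage_setT setTI.
    move: C0; rewrite {1}CE integral_setU//.
    + by rewrite A0 add0e.
    + by rewrite -CE; exact: measurable_int (iS _ mC).
    + rewrite disj_set2E -setIIl -preimage_setI setICr preimage_set0 set0I.
      exact/eqP.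
  - move=> A tA HA; split; first by apply: bigcup_measurable => k _; case: (HA k).
    rewrite preimage_bigcup setI_bigcupl integral_bigcup//.
    + by rewrite eseries0// => k _ _; case: (HA k).
    + move=> i j _ _ [x [[xi _] [xj _]]]; apply: tA => //; by exists (f x).
    + by move=> k; apply: mA; case: (HA k).
    + apply: iS; apply: bigcup_measurable => k _; apply: mA; case: (HA k) => //.
move=> A; rewrite mG -setI_closed_g_dynkin_g_sigma_algebra//.
suff : <<d G >> `<=` H by move=> GH /GH[].
apply: smallest_sub => // B GB; split; last exact: G0.
by rewrite mG; exact: sub_gen_smallest.
Qed.

Lemma setI_closed_opens : setI_closed (RGenOpens.G (R:=R)).
Proof.
move=> _ _ [a [b ->]] [c [d ->]]; exists (Order.max a c), (Order.min b d).
apply/seteqP; split=> x /=; rewrite !in_itv/= gt_max lt_min.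
  by move=> [/andP[-> ->] /andP[-> ->]].
by move=> /andP[/andP[-> ->] /andP[-> ->]].
Qed.

Let J : set mR := `]-2, 2[%classic.

(** Dynkin's argument is used three times: for the first side of a box, for the second, and for the
    product sigma-algebra. As [F] vanishes outside a bounded box, integrals over unbounded strips
    reduce to integrals over bounded ones. *)
Lemma boxes_integral0 (F : P2 -> R) : mu2.-integrable setT (EFin \o F) ->
  (forall p, ~ (J `*` J) p -> F p = 0) ->
  (forall a b c d, \int[mu2]_(x in (`]a, b[%classic : set mR) `*` (`]c, d[%classic : set mR)) (F x)%:E = 0)%E ->
  forall E : set P2, measurable E -> (\int[mu2]_(x in E) (F x)%:E = 0)%E.
Proof.
move=> iF F0 box0.
have mJ : measurable J by exact: measurable_itv.
have supp (A B : set P2) : measurable A -> measurable B -> A `&` (J `*` J) = B `&` (J `*` J) ->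
    (\int[mu2]_(x in A) (F x)%:E = \int[mu2]_(x in B) (F x)%:E)%E.
  move=> mA mB AB; rewrite integral_mkcond [RHS]integral_mkcond; apply: eq_integral => p _.
  rewrite !patchE; have [pJ|pJ] := pselect ((J `*` J) p); last by rewrite F0//; case: ifP; case: ifP.
  rewrite (_ : (p \in A) = (p \in B))//; apply/idP/idP; rewrite !inE => h.
    by have [] : (B `&` (J `*` J)) p by rewrite -AB.
  by have [] : (A `&` (J `*` J)) p by rewrite AB.
have mO (a b : R) : measurable (`]a, b[%classic : set mR) by exact: measurable_itv.
have fstE (A B : set mR) : (@fst mR mR) @^-1` A `&` (setT `*` B) = A `*` B.
  by apply/seteqP; split=> -[x y] /=; [move=> [? [_ ?]]|move=> [? ?]].
have sndE (A B : set mR) : (@snd mR mR) @^-1` B `&` (A `*` setT) = A `*` B.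
  by apply/seteqP; split=> -[x y] /=; [move=> [? [? _]]|move=> [? ?]].
have stepA (A : set mR) c d : measurable A ->
    (\int[mu2]_(x in A `*` (`]c, d[%classic : set mR)) (F x)%:E = 0)%E.
  move=> mA; rewrite -fstE.
  apply: (dynkin_integral measurable_fst _ iF (RGenOpens.measurableE R) setI_closed_opens) => //.
  - exact: measurableX.
  - by move=> _ [a [b ->]]; rewrite fstE box0.
  - rewrite -(box0 (-2) 2 c d); apply: supp; try exact: measurableX.
    by apply/seteqP; split=> -[x y] [[/= h1 h2] [h3 h4]].
have stepB (A B : set mR) : measurable A -> measurable B ->
    (\int[mu2]_(x in A `*` B) (F x)%:E = 0)%E.
  move=> mA mB; rewrite -sndE.
  apply: (dynkin_integral measurable_snd _ iF (RGenOpens.measurableE R) setI_closed_opens) => //.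
  - exact: measurableX.
  - by move=> _ [a [b ->]]; rewrite sndE stepA.
  - rewrite -(stepA A (-2) 2 mA); apply: supp; try exact: measurableX.
    by apply/seteqP; split=> -[x y] [[/= h1 h2] [h3 h4]].
move=> E mE; rewrite -[E]setIT -[E]/(id @^-1` E).
apply: (dynkin_integral (@measurable_id _ P2 setT) _ iF (measurable_prod_measurableType mR mR)) => //.
- move=> _ _ [A mA [B mB <-]] [A' mA' [B' mB' <-]]; rewrite -setXI.
  by exists (A `&` A'); [exact: measurableI|exists (B `&` B') => //; exact: measurableI].
- by move=> _ [A mA [B mB <-]]; rewrite preimage_id setIT stepB.
- rewrite -(box0 (-2) 2 (-2) 2); apply: supp => //; first exact: measurableX.
  by apply/seteqP; split=> -[x y] [h1 h2].
Qed.

Definition box_ind (a b c d : R) z : R[i] := if (a < Re z < b) && (c < Im z < d) then 1 else 0.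

(** [smoothC] composes with real parts only, hence Im z enters as the real part of [- Ci R * z]. *)
Lemma box_test (a b c d : R) n : smoothC (fun z : R[i] =>
  (win a b n.+1%:R (Re z))%:C * (win c d n.+1%:R (Re (- Ci R * z)))%:C).
Proof.
apply: smC_M; first by apply: (smC_comp (Csmooth_win a b n.+1%:R) (smC_id R)).
by apply: (smC_comp (Csmooth_win c d n.+1%:R)); apply: smC_Z; exact: smC_id.
Qed.

Lemma Re_NCi z : Re (- Ci R * z) = Im z.
Proof. by rewrite ReM ReN ImN /Ci/=; ring. Qed.

Lemma null_box g (r : R) : r < 1 -> cintble D g -> (forall z, r < cmod z -> g z = 0) ->
  (forall phi, smoothC phi -> cint D (fun z => g z * phi z) = 0) ->
  forall a b c d, cint D (fun z => g z * box_ind a b c d z) = 0.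
Proof.
move=> r1 ig g0 gphi a b c d; have mg := cintble_meas ig.
have neg0 : mu2.-negligible set0 by exact: negligible_set0.
have bphi n z : 0 <= win a b n.+1%:R (Re z) * win c d n.+1%:R (Re (- Ci R * z)) <= 1.
  by rewrite mulr_ge0 ?win_ge0//= mulr_ile1 ?win_ge0 ?win_le1.
have lim z : ccvg (fun n => g z * ((win a b n.+1%:R (Re z))%:C * (win c d n.+1%:R (Re (- Ci R * z)))%:C))
    (g z * box_ind a b c d z).
  apply: ccvgZ; rewrite /box_ind Re_NCi; case: ifPn => [/andP[h1 h2]|].
    have noo : n.+1%:R @[n --> \oo] --> (+oo : set_system R).
      by rewrite (cvg_shiftS (fun n => n%:R : R)); exact: cvgr_idn.
    have c1 : win a b n.+1%:R (Re z) @[n --> \oo] --> (1 : R) by apply: win_cvg noo h1; exact: cvg_cst.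
    have c2 : win c d n.+1%:R (Im z) @[n --> \oo] --> (1 : R) by apply: win_cvg noo h2; exact: cvg_cst.
    have c12 : win a b n.+1%:R (Re z) * win c d n.+1%:R (Im z) @[n --> \oo] --> (1 : R).
      by rewrite -[X in _ --> X]mulr1; exact: cvgM.
    apply/ccvgP => e e0.
    move/cvgrPdist_lt/(_ _ e0) : c12; apply: filterS => n.
    by rewrite -rcM -[X in cmod (_ - X)]/(1%:C) -rcB cmod_real distrC.
  rewrite negb_and => h; apply: ccvg_ext (ccvg_cst 0) => n; rewrite -rcM.
  by case/orP: h => h; rewrite (@win_eq0 _ _ _ n.+1%:R _ _ h)// ?mulr0 ?mul0r.
have mlim : cmeasurable D (fun z => g z * box_ind a b c d z).
  apply: (@cmeas_lim _ D (fun n z => g z * ((win a b n.+1%:R (Re z))%:C * (win c d n.+1%:R (Re (- Ci R * z)))%:C))).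
    by move=> n; apply: cmeasM => //; apply: cmeas_cont => z; exact: smC_cont (box_test a b c d n).
  by move=> z _; exact: lim.
have mn n : cmeasurable D (fun z => g z * ((win a b n.+1%:R (Re z))%:C * (win c d n.+1%:R (Re (- Ci R * z)))%:C)).
  by apply: cmeasM => //; apply: cmeas_cont => z; exact: smC_cont (box_test a b c d n).
apply: ccvg_uniq (@cint_dct _ _ mD _ _ (fun z => cmod (g z)) _ neg0 mn mlim (cintble_cmod mD ig) _ _) _.
- move=> n z _; rewrite cmodM -rcM cmod_real; have /andP[h0 h1] := bphi n z.
  by rewrite ger0_norm// ler_piMr ?cmod_ge0.
- by move=> z _ _; exact: lim.
- by apply: ccvg_ext (ccvg_cst 0) => n; rewrite gphi//; exact: box_test.
Qed.

Lemma null_smooth g (r : R) : r < 1 -> cintble D g -> (forall z, r < cmod z -> g z = 0) ->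
  (forall phi, smoothC phi -> cint D (fun z => g z * phi z) = 0) ->
  mu2.-negligible [set p | pre D p /\ g (of_plane p) != 0].
Proof.
move=> r1 ig g0 gphi; have gbox := null_box r1 ig g0 gphi.
have key (h : R * R -> R) : mu2.-integrable (pre D) (EFin \o h) ->
    (forall a b c d, Rintegral mu2 (pre D) (fun p => h p * Re (box_ind a b c d (of_plane p))) = 0) ->
    mu2.-negligible [set p | pre D p /\ h p != 0].
  move=> ih hbox; pose F (p : P2) : R := if p \in pre D then h p else 0.
  have iF : mu2.-integrable setT (EFin \o F).
    move/integrable_mkcond : ih => /(_ mD); congr (_.-integrable _ _).
    by apply/funext => p; rewrite patchE /F/=; case: ifP.
  have F0 p : ~ ((`]-2, 2[%classic : set mR) `*` (`]-2, 2[%classic : set mR)) p -> F p = 0.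
    move=> nJ; rewrite /F; case: ifPn => // pd; exfalso; apply: nJ; move: pd; rewrite inE => pd.
    have p1 : cmod (of_plane p) < 1 := pd.
    have := le_lt_trans (le_Re_cmod _) p1; have := le_lt_trans (le_Im_cmod _) p1.
    by rewrite !ltr_norml /of_plane/= => /andP[h1 h2] /andP[h3 h4]; split; rewrite /= in_itv/=; lra.
  have box0 a b c d : (\int[mu2]_(x in (`]a, b[%classic : set mR) `*` (`]c, d[%classic : set mR)) (F x)%:E = 0)%E.
    set B := _ `*` _.
    have mB : @measurable _ P2 B by apply: measurableX; exact: measurable_itv.
    have E : (\int[mu2]_(x in B) (F x)%:E =
        \int[mu2]_(p in pre D) (h p * Re (box_ind a b c d (of_plane p)))%:E)%E.
      rewrite integral_mkcond [RHS]integral_mkcond; apply: eq_integral => p _.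
      rewrite !patchE /F; have -> : (p \in B) = (a < p.1 < b) && (c < p.2 < d).
        by apply/idP/idP; [rewrite inE => -[/=]; rewrite !in_itv/= => -> ->
          |move=> /andP[h1 h2]; rewrite inE; split; rewrite /= in_itv].
      by rewrite /box_ind /of_plane/=; case: (p \in _); case: (_ && _); rewrite /= ?mulr1 ?mulr0.
    have fin : (\int[mu2]_(x in B) (F x)%:E)%E \is a fin_num.
      by apply: integrable_fin_num => //; apply: integrableS iF.
    by rewrite -(fineK fin) E; congr EFin; exact: hbox.
  have /negligibleS : mu2.-negligible (~` [set p : P2 | setT p -> (EFin \o F) p = cst 0%E p]).
    apply: (integral_ae_eq measurableT iF) => [|E _ mE]; first exact: measurable_cst.
    by rewrite integral0; exact: boxes_integral0.
  apply => p [pd hp] /= /(_ I); rewrite /F ifT ?inE// => -[h0].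
  by rewrite h0 eqxx in hp.
have [i1 i2] := ig.
have boxE a b c d z : box_ind a b c d z = (Re (box_ind a b c d z))%:C by rewrite /box_ind; case: ifP.
have n1 := key _ i1 _; have n2 := key _ i2 _.
have : mu2.-negligible ([set p | pre D p /\ re_plane g p != 0] `|` [set p | pre D p /\ im_plane g p != 0]).
  apply: negligibleU; [apply: n1|apply: n2] => a b c d.
    have := congr1 (@complex.Re R) (gbox a b c d) => /= <-; apply: eq_Rintegral => p _.
    by rewrite /re_plane [in RHS]boxE ReMr.
  have := congr1 (@complex.Im R) (gbox a b c d) => /= <-; apply: eq_Rintegral => p _.
  by rewrite /im_plane [in RHS]boxE ImMr.
apply: negligibleS => p [pd gp]; have [r0|] := eqVneq (re_plane g p) 0; last by left.
right; split => //; apply: contra gp => /eqP j0; apply/eqP; exact: eqC.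
Qed.

(** [w] is only locally integrable, so it is first multiplied by cut-offs [psi j] that leave an
    integrable function. At each point of the punctured disc some [psi j] is nonzero, and the origin
    is a null set. *)
Lemma weak_null w : Defs.locally_integrable w ->
  (forall phi, test_function phi -> cint D (fun z => w z * phi z) = 0) ->
  mu2.-negligible [set p | pre D p /\ w (of_plane p) != 0].
Proof.
move=> lw wphi.
pose psi j : R[i] -> R[i] := mono 0 0 (chi j).
have tpsi j : test_function (psi j).
  apply: (tf_mono 0 0 (chi_bounds R j).2) => [t jt|]; last exact: Csmooth_win.
  by apply: chi_supp; apply/negP => /andP[_]; rewrite ltNge jt.
have nj j : mu2.-negligible [set p | pre D p /\ w (of_plane p) * psi j (of_plane p) != 0].
  have [r /andP[r0 r1] psi0] := tf_radius (tpsi j).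
  apply: (null_smooth (g := fun z => w z * psi j z) r1).
  - exact: cintble_tf.
  - by move=> z rz; rewrite psi0 ?mulr0.
  - move=> phi sphi; rewrite -(wphi (fun z => psi j z * phi z)).
      by apply: eq_cint => z _; rewrite mulrA.
    apply: (smC_tf r1); first by move=> z rz; rewrite psi0 ?mul0r.
    by apply: smC_M => //; apply: smC_mono; exact: Csmooth_win.
apply: negligibleS (negligibleU (origin_negligible R) (negligible_bigcup nj)) => p [pd wp].
have [p0|p0] := eqVneq (of_plane p) 0; first by left; move: p0; case: (p) => x y [-> ->].
have zpos : 0 < cmod (of_plane p) ^+ 2 < 1.
  by rewrite exprn_gt0 ?cmod_gt0//= expr_lt1// cmod_ge0.
have := chi_cvg zpos; move/cvgrPdist_lt/(_ _ ltr01)/filter_ex => [j hj].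
right; exists j => //; split => //; rewrite mulf_neq0// /psi monoE !expr0 !mul1r.
rewrite -[0]/(0%:C) (inj_eq (@complexI R)); apply: contraTneq hj => ->.
by rewrite subr0 normr1 ltxx.
Qed.

(** [wderiv] selects an unspecified weak derivative; this allows any known one to take its place in
    the norm. *)
Lemma weak_derivative_unique b1 b2 f g g' : weak_derivative b1 b2 f g -> weak_derivative b1 b2 f g' ->
  mu2.-negligible [set p | pre D p /\ g (of_plane p) != g' (of_plane p)].
Proof.
move=> [lf lg gphi] [_ lg' g'phi].
have lB : Defs.locally_integrable (fun z => g z - g' z).
  have [mg ig] := lg; have [mg' ig'] := lg'; split; first exact: cmeasB.
  move=> K cK KD.
  have mK := measurable_compactC cK.
  have mgK := cmeasS mD KD mg; have mgK' := cmeasS mD KD mg'.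
  apply: (@le_lt_trans _ _ (eint K (fun z => cmod (g z)) + eint K (fun z => cmod (g' z)))%E).
    rewrite /eint -ge0_integralD//.
    - apply: ge0_le_integral => //.
      + by move=> p _; rewrite lee_fin cmod_ge0.
      + by apply/measurable_EFinP; exact: (cmeas_cmod_leb (cmeasB mgK mgK')).
      + by apply: emeasurable_funD; apply/measurable_EFinP; exact: cmeas_cmod_leb.
      + by move=> p _; rewrite -EFinD lee_fin -[X in (_ <= _ + X)%R]cmodN; exact: le_cmodD.
    - by move=> p _; rewrite lee_fin cmod_ge0.
    - by apply/measurable_EFinP; exact: cmeas_cmod_leb.
    - by move=> p _; rewrite lee_fin cmod_ge0.
    - by apply/measurable_EFinP; exact: cmeas_cmod_leb.
  by apply: lte_add_pinfty; [exact: ig|exact: ig'].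
have := weak_null lB; set N := [set p | _]; move=> H.
apply: negligibleS (H _) => [p [pd gp]|phi tphi]; first by split; rewrite // subr_eq0.
under eq_cint do rewrite mulrBl.
rewrite (cintB mD (cintble_tf lg tphi) (cintble_tf lg' tphi)); apply/eqP; rewrite subr_eq0; apply/eqP.
apply: (@mulfI _ ((-1) ^+ (b1 + b2))); first by rewrite expf_neq0// oppr_eq0 oner_eq0.
by rewrite -gphi// -g'phi.
Qed.

End DuBoisReymond.

(** * Iterated Wirtinger derivatives and the rotation identity *)

Section WirtingerIterates.
Variable R : realType.
Implicit Types (f g phi : R[i] -> R[i]) (z c : R[i]).

Lemma smC_partial_lin f g c : smoothC f -> smoothC g ->
  partial_z (fun z => f z + c * g z) = (fun z => partial_z f z + c * partial_z g z) /\
  partial_zbar (fun z => f z + c * g z) = (fun z => partial_zbar f z + c * partial_zbar g z).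
Proof.
move=> /smC_partial[_ _ df _] /smC_partial[_ _ dg _].
have d z := wdiffD (df z) (wdiffZ c (dg z)).
by split; apply/funext => z; [exact: wdiff_partial_z (d z)|exact: wdiff_partial_zbar (d z)].
Qed.

Lemma smC_iter_zbar q f : smoothC f -> smoothC (iter q partial_zbar f).
Proof. by move=> sf; elim: q => [//|q ih]; have [] := smC_partial ih. Qed.

Lemma smC_iter_z p f : smoothC f -> smoothC (iter p partial_z f).
Proof. by move=> sf; elim: p => [//|p ih]; have [] := smC_partial ih. Qed.

Lemma wirtinger_lin p q f g c : smoothC f -> smoothC g ->
  wirtinger p q (fun z => f z + c * g z) = (fun z => wirtinger p q f z + c * wirtinger p q g z).
Proof.
move=> sf sg; rewrite /wirtinger.
have -> : iter q partial_zbar (fun z => f z + c * g z) =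
    (fun z => iter q partial_zbar f z + c * iter q partial_zbar g z).
  elim: q => [//|q ih]; rewrite iterS ih; exact: (smC_partial_lin c (smC_iter_zbar q sf) (smC_iter_zbar q sg)).2.
have sf' := smC_iter_zbar q sf; have sg' := smC_iter_zbar q sg.
elim: p => [//|p ih]; rewrite iterS ih; exact: (smC_partial_lin c (smC_iter_z p sf') (smC_iter_z p sg')).1.
Qed.

Lemma wirtinger_zbar p q f : wirtinger p q (partial_zbar f) = wirtinger p q.+1 f.
Proof. by rewrite /wirtinger iterSr. Qed.

Lemma wirtinger_z p q f : smoothC f -> wirtinger p q (partial_z f) = wirtinger p.+1 q f.
Proof.
move=> sf; rewrite /wirtinger iterSr; congr (iter p _ _).
elim: q => [//|q ih]; rewrite !iterS ih.
by have [_ _ _ ->] := smC_partial (smC_iter_zbar q sf).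
Qed.

Lemma tf_iter_zbar q phi : test_function phi -> test_function (iter q partial_zbar phi).
Proof. by move=> tphi; elim: q => [//|q ih]; exact: tf_partial_zbar. Qed.

Lemma tf_wirtinger p q phi : test_function phi -> test_function (wirtinger p q phi).
Proof.
move=> tphi; rewrite /wirtinger; elim: p => [|p ih]; first exact: tf_iter_zbar.
exact: tf_partial_z.
Qed.

(** On z^p zb^(q+N) rho the rotation field has eigenvalue q + N - p, so N is that eigenvalue plus p
    - q. One factor N thus costs one more derivative, and the exponents grow along with the orders,
    which keeps the pattern [mono p (q + N)]. *)
Lemma wirtinger_mono p q N rho z : Csmooth setT rho ->
  N%:R * wirtinger p q (mono p (q + N) rho) z =
  wirtinger p q.+1 (mono p (q.+1 + N) rho) z + (-1) * wirtinger p.+1 q (mono p.+1 (q + N) rho) z +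
  (p%:R - q%:R) * wirtinger p q (mono p (q + N) rho) z.
Proof.
move=> srho; have s a b := smC_mono a b srho.
have [_ s1 _ _] := smC_partial (s p (q.+1 + N)%N); have [s2 _ _ _] := smC_partial (s p.+1 (q + N)%N).
have E : (fun z => N%:R * mono p (q + N) rho z) = (fun z => (partial_zbar (mono p (q.+1 + N) rho) z +
    (-1) * partial_z (mono p.+1 (q + N) rho) z) + (p%:R - q%:R) * mono p (q + N) rho z).
  apply/funext => w; have := rotation_mono p (q + N) w srho; rewrite mulN1r => ->.
  by rewrite natrD; ring.
have := congr1 (fun f => wirtinger p q f z) E.
have -> : (fun z => N%:R * mono p (q + N) rho z) = (fun z => 0 + N%:R * mono p (q + N) rho z).
  by apply/funext => w; rewrite add0r.
have z0 : wirtinger p q (fun=> 0) z = 0 :> R[i].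
  have := wirtinger_lin p q (-1) (smC_cst 0) (smC_cst (0 : R[i])).
  by rewrite mulr0 addr0 => /(congr1 (fun f => f z)); rewrite mulN1r => ->; rewrite subrr.
rewrite (wirtinger_lin _ _ _ (smC_cst 0) (s _ _)) z0 add0r.
rewrite (wirtinger_lin _ _ _ (smC_D s1 (smC_Z (-1) s2)) (s _ _)) (wirtinger_lin _ _ (-1) s1 s2).
by rewrite wirtinger_zbar wirtinger_z.
Qed.

End WirtingerIterates.

(** * The weighted L2 space and its inner product *)

Section WeightedL2.
Variable R : realType.
Notation mu2 := (leb2 R).
Notation P2 := (measurableTypeR R * measurableTypeR R)%type.
Local Notation pre A := (of_plane @^-1` A).
Local Notation D := (disc R).
Let mD := measurable_disc R.
Variable lam : R -> R.
Hypotheses (lam_weight : radial_weight lam) (lam_integrable : integrable_weight lam)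
  (lam_nonvanishing : forall r : R, 0 <= r < 1 -> lam r != 0).
Local Notation W := (on_disc lam).
Implicit Types (f g h : R[i] -> R[i]) (z w c : R[i]).

Lemma lam_gt0 r : 0 <= r < 1 -> 0 < lam r.
Proof. by move=> r01; rewrite lt_def lam_nonvanishing//=; apply: lam_weight.2. Qed.

Lemma W_gt0 z : D z -> 0 < W z.
Proof. by move=> zd; apply: lam_gt0; rewrite cmod_ge0. Qed.

Lemma W_cmeas : cmeasurable D (fun z => (W z)%:C).
Proof.
apply: cmeas_real.
have ml : measurable_fun ([set` `[0, 1[] : set R) lam.
  by apply: subspace_continuous_measurable_fun; [exact: measurable_itv|exact: lam_weight.1].
apply: (@measurable_comp _ _ _ _ _ _ ([set` `[0, 1[] : set R) lam _ (fun p : R * R => cmod (of_plane p)) _ _ ml).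
- exact: measurable_itv.
- move=> _ [p pd <-]; suff : cmod (of_plane p) \in `[0, 1[ by [].
  by rewrite in_itv; apply/andP; split; [exact: cmod_ge0|exact: pd].
- by apply: measurable_funTS; exact: measurable_cmod.
Qed.

Lemma W_bounds r : 0 <= r < 1 -> exists2 c, 0 < c & forall z, cmod z <= r -> c <= W z.
Proof.
move=> /andP[r0 r1].
have cl : {within [set` `[0, r]], continuous lam}.
  by apply: continuous_subspaceW lam_weight.1 => x /=; rewrite !in_itv/= => /andP[-> /le_lt_trans]; apply.
have [c] := EVT_min r0 cl; rewrite in_itv/= => /andP[c0 cr] cP.
exists (lam c); first by apply: lam_gt0; rewrite c0 (le_lt_trans cr).
by move=> z zr; apply: cP; rewrite in_itv/= cmod_ge0.
Qed.

Lemma integrableW : mu2.-integrable (pre D) (fun p => (W (of_plane p))%:E).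
Proof.
have [mW _] := cmeas_leb W_cmeas.
apply/integrableP; split; first exact/measurable_EFinP.
apply: le_lt_trans lam_integrable; apply: ge0_le_integral => //.
- by apply/measurable_EFinP; exact: measurableT_comp.
- exact/measurable_EFinP.
- by move=> p pd; rewrite lee_fin ger0_norm// ltW// W_gt0.
Qed.

Lemma sqW_ge0 f z : D z -> 0 <= cmod (f z) ^+ 2 * W z.
Proof. by move=> zd; rewrite mulr_ge0 ?sqr_ge0// ltW// W_gt0. Qed.

Lemma sqW_meas f : cmeasurable D f ->
  @measurable_fun _ _ P2 R (pre D) (fun p => cmod (f (of_plane p)) ^+ 2 * W (of_plane p)).
Proof.
move=> mf; have [mW _] := cmeas_leb W_cmeas.
apply: measurable_funM => //; apply: measurable_funX; exact: cmeas_cmod_leb.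
Qed.

Lemma L2P f : L2 lam f <-> cmeasurable D f /\
  mu2.-integrable (pre D) (fun p => (cmod (f (of_plane p)) ^+ 2 * W (of_plane p))%:E).
Proof.
split=> [] [mf fi]; split => //.
  apply/integrableP; split; first by apply/measurable_EFinP; exact: sqW_meas.
  apply: le_lt_trans fi; apply: ge0_le_integral => //.
  - by apply/measurable_EFinP; apply: measurableT_comp => //; exact: sqW_meas.
  - by apply/measurable_EFinP; exact: sqW_meas.
  - by move=> p pd; rewrite lee_fin ger0_norm// sqW_ge0.
move/integrableP : fi => [_]; apply: le_lt_trans; apply: ge0_le_integral => //.
- by move=> p pd; rewrite lee_fin sqW_ge0.
- by apply/measurable_EFinP; exact: sqW_meas.
- by apply/measurable_EFinP; apply: measurableT_comp => //; exact: sqW_meas.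
- by move=> p pd; rewrite lee_fin ler_norm.
Qed.

Lemma eq_L2 f g : (forall z, D z -> f z = g z) -> L2 lam f -> L2 lam g.
Proof.
move=> fg /L2P[mf fi]; apply/L2P; split; first exact: eq_cmeas mf.
by apply: eq_integrable fi => // p; rewrite inE => pd; rewrite fg.
Qed.

Lemma L2_bounded f M : cmeasurable D f -> (forall z, D z -> cmod (f z) <= M) -> L2 lam f.
Proof.
move=> mf fM; apply/L2P; split => //.
apply: (le_integrable mD _ _ (integrableZl mD (M ^+ 2) integrableW)).
  by apply/measurable_EFinP; exact: sqW_meas.
move=> p pd; rewrite /= lee_fin ger0_norm ?sqW_ge0// ger0_norm.
  rewrite ler_wpM2r ?(ltW (W_gt0 _))// lerXn2r ?nnegrE ?cmod_ge0//; last exact: fM.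
  exact: le_trans (cmod_ge0 _) (fM _ pd).
by rewrite mulr_ge0 ?sqr_ge0// ltW// W_gt0.
Qed.

Lemma cmodD_sqr z w : cmod (z + w) ^+ 2 <= 2 * cmod z ^+ 2 + 2 * cmod w ^+ 2.
Proof.
apply: (@le_trans _ _ ((cmod z + cmod w) ^+ 2)).
  by rewrite lerXn2r ?nnegrE ?addr_ge0 ?cmod_ge0// le_cmodD.
have := sqr_ge0 (cmod z - cmod w); rewrite !expr2; lra.
Qed.

Lemma L2D f g : L2 lam f -> L2 lam g -> L2 lam (fun z => f z + g z).
Proof.
move=> /L2P[mf fi] /L2P[mg gi]; apply/L2P; split; first exact: cmeasD.
apply: (le_integrable mD _ _ (integrableD mD (integrableZl mD 2 fi) (integrableZl mD 2 gi))).
  by apply/measurable_EFinP; apply: (@sqW_meas (fun z => f z + g z)); exact: cmeasD.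
move=> p pd; rewrite -!EFinM -EFinD !abse_EFin lee_fin.
rewrite ger0_norm ?(sqW_ge0 (fun z => f z + g z))// ger0_norm; last first.
  by rewrite addr_ge0// mulr_ge0// sqW_ge0.
by rewrite (mulrA 2 (_ ^+ 2)) (mulrA 2 (_ ^+ 2)) -mulrDl ler_wpM2r ?cmodD_sqr// ltW// W_gt0.
Qed.

Lemma L2Z c f : L2 lam f -> L2 lam (fun z => c * f z).
Proof.
move=> /L2P[mf fi]; apply/L2P; split; first exact: cmeasZ.
have := integrableZl mD (cmod c ^+ 2) fi; apply: eq_integrable => // p _.
by rewrite /= cmodM exprMn -EFinM mulrA.
Qed.

Lemma L2B f g : L2 lam f -> L2 lam g -> L2 lam (fun z => f z - g z).
Proof.
move=> Lf Lg; have := L2D Lf (L2Z (-1) Lg).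
by under [X in L2 _ X]eq_fun do rewrite mulN1r.
Qed.

Lemma L2_0 : L2 lam (fun=> 0).
Proof. by apply: (@L2_bounded _ 0); [exact: cmeas_cst|move=> z _; rewrite cmod0]. Qed.

Lemma L2_sum (I : Type) (s : seq I) (F : I -> R[i] -> R[i]) :
  (forall i, L2 lam (F i)) -> L2 lam (fun z => \sum_(i <- s) F i z).
Proof.
move=> LF; elim: s => [|i s ih].
  by under [X in L2 _ X]eq_fun do rewrite big_nil; exact: L2_0.
by under [X in L2 _ X]eq_fun do rewrite big_cons; exact: L2D.
Qed.

Lemma L2_mul_bounded f g M : cmeasurable D f -> (forall z, D z -> cmod (f z) <= M) ->
  L2 lam g -> L2 lam (fun z => f z * g z).
Proof.
move=> mf fM /L2P[mg gi]; apply/L2P; split; first exact: cmeasM.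
apply: (le_integrable mD _ _ (integrableZl mD (M ^+ 2) gi)).
  by apply/measurable_EFinP; apply: (@sqW_meas (fun z => f z * g z)); exact: cmeasM.
move=> p pd; rewrite -!EFinM !abse_EFin lee_fin.
rewrite ger0_norm ?(sqW_ge0 (fun z => f z * g z))// ger0_norm.
  rewrite cmodM exprMn -mulrA ler_wpM2r ?sqW_ge0// lerXn2r ?nnegrE ?cmod_ge0//; last exact: fM.
  exact: le_trans (cmod_ge0 _) (fM _ pd).
by rewrite mulr_ge0 ?sqr_ge0// sqW_ge0.
Qed.

(** On a compact subset of the disc the weight is at least some c > 0, and there |f| <= 1 + |f|^2 <=
    c^-1 (W + |f|^2 W), which is integrable. *)
Lemma L2_locint f : L2 lam f -> Defs.locally_integrable f.
Proof.
move=> Lf; have [mf fi] := Lf; split => // K cK KD.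
have [r r01 Kr] := compact_radius cK KD; have [c c0 cW] := W_bounds r01.
have mK := measurable_compactC cK.
have [_ fi'] := (L2P f).1 Lf.
have fD := integrableZl mD c^-1 (integrableD mD integrableW fi').
have KD' : pre K `<=` pre D by move=> p /KD.
have /integrableP[mfK fK] := integrableS mD mK KD' fD.
apply: le_lt_trans fK; apply: ge0_le_integral => //.
- by move=> p _; rewrite lee_fin cmod_ge0.
- apply/measurable_EFinP; apply: cmeas_cmod_leb; exact: cmeasS mf.
- exact: measurableT_comp.
move=> p Kp; rewrite -EFinD -EFinM lee_fin; have pd := KD _ Kp.
have W0 := W_gt0 pd.
rewrite ger0_norm; last first.
  by rewrite mulr_ge0 ?invr_ge0 ?(ltW c0)// addr_ge0 ?sqW_ge0// ltW.
rewrite mulrC ler_pdivlMr// -[X in X + _]mul1r -mulrDl.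
apply: (@le_trans _ _ ((1 + cmod (f (of_plane p)) ^+ 2) * c)).
  rewrite ler_wpM2r ?(ltW c0)//; have := sqr_ge0 (cmod (f (of_plane p)) - 1).
  have := cmod_ge0 (f (of_plane p)); rewrite !expr2; nra.
by rewrite ler_wpM2l ?addr_ge0 ?sqr_ge0//; apply: cW; exact: Kr.
Qed.

Definition n2 f := fine (eint D (fun z => cmod (f z) ^+ 2 * W z)).

Lemma n2E f : n2 f = Rintegral mu2 (pre D) (fun p => cmod (f (of_plane p)) ^+ 2 * W (of_plane p)).
Proof. by []. Qed.

Lemma n2_ge0 f : 0 <= n2 f.
Proof. by apply: Rintegral_ge0 => p pd; exact: sqW_ge0. Qed.

Lemma eq_n2 f g : (forall z, D z -> f z = g z) -> n2 f = n2 g.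
Proof. by move=> fg; apply: eq_Rintegral => p; rewrite inE => pd; rewrite fg. Qed.

Lemma n2_fin f : L2 lam f -> eint D (fun z => cmod (f z) ^+ 2 * W z) = (n2 f)%:E.
Proof. by move=> /L2P[mf fi]; rewrite /n2 fineK//; exact: integrable_fin_num. Qed.

Lemma ip_cintble f g : L2 lam f -> L2 lam g ->
  cintble D (fun z => f z * conjc (g z) * (W z)%:C).
Proof.
move=> /L2P[mf fi] /L2P[mg gi].
apply: (@cintble_dom _ _ mD _ (fun z => cmod (f z) ^+ 2 * W z + cmod (g z) ^+ 2 * W z)).
- by apply: cmeasM W_cmeas; apply: cmeasM => //; exact: cmeasJ.
- by have := integrableD mD fi gi; apply: eq_integrable => // p _; rewrite -EFinD.
move=> z zd; rewrite !cmodM cmodJ cmod_real ger0_norm ?(ltW (W_gt0 _))// -mulrDl.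
rewrite ler_wpM2r ?(ltW (W_gt0 _))//.
have := sqr_ge0 (cmod (f z) - cmod (g z)).
have := cmod_ge0 (f z); have := cmod_ge0 (g z); rewrite !expr2; nra.
Qed.

Lemma eq_inner f g f' g' : (forall z, D z -> f z = f' z) -> (forall z, D z -> g z = g' z) ->
  inner lam f g = inner lam f' g'.
Proof. by move=> ff gg; apply: eq_cint => z zd; rewrite ff ?gg. Qed.

Lemma innerDl f g h : L2 lam f -> L2 lam g -> L2 lam h ->
  inner lam (fun z => f z + g z) h = inner lam f h + inner lam g h.
Proof.
move=> Lf Lg Lh; rewrite /inner -cintD//; try exact: ip_cintble.
by apply: eq_cint => z _; rewrite !mulrDl.
Qed.

Lemma innerZl c f h : L2 lam f -> L2 lam h ->
  inner lam (fun z => c * f z) h = c * inner lam f h.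
Proof.
move=> Lf Lh; rewrite /inner -cintZ//; last exact: ip_cintble.
by apply: eq_cint => z _; rewrite !mulrA.
Qed.

Lemma innerBl f g h : L2 lam f -> L2 lam g -> L2 lam h ->
  inner lam (fun z => f z - g z) h = inner lam f h - inner lam g h.
Proof.
move=> Lf Lg Lh; rewrite /inner -cintB//; try exact: ip_cintble.
by apply: eq_cint => z _; rewrite !mulrBl.
Qed.

Lemma innerJ f g : L2 lam f -> L2 lam g -> inner lam g f = conjc (inner lam f g).
Proof.
move=> Lf Lg; rewrite /inner -cintJ//; last exact: ip_cintble.
by apply: eq_cint => z _; rewrite !cjM conjcK conjc_real [conjc _ * _]mulrC.
Qed.

Lemma inner0l h : inner lam (fun=> 0) h = 0.
Proof. rewrite -[RHS](@cint0 R D); apply: eq_cint => z _; by rewrite !mul0r. Qed.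

Lemma inner_suml (I : Type) (s : seq I) (F : I -> R[i] -> R[i]) h :
  (forall i, L2 lam (F i)) -> L2 lam h ->
  inner lam (fun z => \sum_(i <- s) F i z) h = \sum_(i <- s) inner lam (F i) h.
Proof.
move=> LF Lh; elim: s => [|i s ih].
  rewrite big_nil -[RHS](inner0l h); apply: eq_inner => // z _; by rewrite big_nil.
rewrite big_cons -ih -innerDl//; last exact: L2_sum.
by apply: eq_inner => // z _; rewrite big_cons.
Qed.

Lemma inner_self f : L2 lam f -> inner lam f f = (n2 f)%:C.
Proof.
move=> Lf; apply: eqC => /=.
  apply: eq_Rintegral => p _; rewrite /re_plane ReMr mulJ_cmod/=.
  by rewrite sqr_cmod.
rewrite /Rintegral integral0_eq// => p _.
by rewrite /im_plane ImMr mulJ_cmod/= mul0r.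
Qed.

Lemma innerBr f g h : L2 lam f -> L2 lam g -> L2 lam h ->
  inner lam h (fun z => f z - g z) = inner lam h f - inner lam h g.
Proof.
move=> Lf Lg Lh; rewrite (innerJ (L2B Lf Lg) Lh) innerBl// cjB.
by rewrite -!innerJ.
Qed.

Lemma innerZr c f h : L2 lam f -> L2 lam h ->
  inner lam h (fun z => c * f z) = conjc c * inner lam h f.
Proof. by move=> Lf Lh; rewrite (innerJ (L2Z c Lf) Lh) innerZl// cjM -innerJ. Qed.

Lemma n2B f g : L2 lam f -> L2 lam g -> n2 (fun z => f z - g z) =
  n2 f - 2 * Re (inner lam f g) + n2 g.
Proof.
move=> Lf Lg; have LB := L2B Lf Lg; apply: complexI.
rewrite -inner_self// innerBl// !innerBr// !inner_self// rcD rcB rcM.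
by rewrite [inner lam g f]innerJ// (_ : 2%:C = 2) -?addcJ; [ring|rewrite -natr1 rcD].
Qed.

Lemma n2Z c f : L2 lam f -> n2 (fun z => c * f z) = cmod c ^+ 2 * n2 f.
Proof.
move=> Lf; apply: complexI; rewrite -inner_self; last exact: L2Z.
rewrite innerZl//; last exact: L2Z.
rewrite -[inner lam f _]conjcK -innerJ//; last exact: L2Z.
by rewrite innerZl// inner_self// cjM conjc_real rcM -mulJ_cmod mulrA.
Qed.

Lemma n2_sqrle f g M : L2 lam f -> L2 lam g -> (forall z, D z -> cmod (f z) ^+ 2 <= M * cmod (g z) ^+ 2) ->
  n2 f <= M * n2 g.
Proof.
move=> /L2P[mf fi] /L2P[mg gi] fg; rewrite !n2E -RintegralZl//.
apply: le_Rintegral => //.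
  by have := integrableZl mD M gi; apply: eq_integrable.
by move=> p pd; rewrite mulrA ler_wpM2r ?(ltW (W_gt0 _))// fg.
Qed.

Lemma n2D_le f g : L2 lam f -> L2 lam g -> n2 (fun z => f z + g z) <= 2 * n2 f + 2 * n2 g.
Proof.
move=> Lf Lg; have LD := L2D Lf Lg; have LN := L2Z (-1) Lg.
have -> : n2 (fun z => f z + g z) = n2 f + 2 * Re (inner lam f g) + n2 g.
  have -> : n2 (fun z => f z + g z) = n2 (fun z => f z - (-1) * g z).
    by apply: eq_n2 => z _; rewrite mulN1r opprK.
  rewrite n2B// n2Z// cmodN cmod_real normr1 expr1n mul1r.
  by rewrite innerZr// cjN conjc1 mulN1r ReN; ring.
by have := n2_ge0 (fun z => f z - g z); rewrite n2B//; lra.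
Qed.

(** Young's inequality in place of the Cauchy-Schwarz inequality; the free parameter [s] is adjusted
    where the bound is applied. *)
Lemma inner_bound f g (s : R) : 0 < s -> L2 lam f -> L2 lam g ->
  cmod (inner lam f g) <= s * n2 f + s^-1 * n2 g.
Proof.
move=> s0 Lf Lg; have [mf fi] := (L2P f).1 Lf; have [mg gi] := (L2P g).1 Lg.
pose h z := (s / 2) * (cmod (f z) ^+ 2 * W z) + (s^-1 / 2) * (cmod (g z) ^+ 2 * W z).
have i1 := integrableZl mD (s / 2) fi; have i2 := integrableZl mD (s^-1 / 2) gi.
have ih : mu2.-integrable (pre D) (fun p => (h (of_plane p))%:E).
  by have := integrableD mD i1 i2; apply: eq_integrable.
have := cmod_cint mD (ip_cintble Lf Lg) ih; rewrite -/(inner lam f g) => H.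
have -> : s * n2 f + s^-1 * n2 g = 2 * Rintegral mu2 (pre D) (fun p => h (of_plane p)).
  rewrite /h RintegralD//= !RintegralZl// -!n2E; field; rewrite gt_eqF//.
apply: H => z zd; rewrite !cmodM cmodJ cmod_real ger0_norm ?(ltW (W_gt0 _))// /h.
rewrite (mulrA _ (cmod (f z) ^+ 2)) (mulrA _ (cmod (g z) ^+ 2)) -mulrDl ler_wpM2r ?(ltW (W_gt0 _))//.
have -> : s / 2 * cmod (f z) ^+ 2 + s^-1 / 2 * cmod (g z) ^+ 2 =
  cmod (f z) * cmod (g z) + (s / 2) * (cmod (f z) - s^-1 * cmod (g z)) ^+ 2.
  by field; rewrite gt_eqF.
by rewrite lerDl mulr_ge0 ?sqr_ge0// divr_ge0// ltW.
Qed.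

(** * Inner products with monomials, and the moments of the weight *)

Implicit Types (u : R[i] -> R[i]) (rho : R -> R).

(** The weight in the variable t = |z|^2, cut off; [mono 0 n (lamchi j)] is then conj (z^n) times
    the weight and the cut-off, so that integrating [f] against it gives a cut-off inner product. *)
Definition lamchi (j : nat) t := lam (Num.sqrt t) * chi j t.

Lemma L2_monomial n : L2 lam (fun z => z ^+ n).
Proof.
apply: (@L2_bounded _ 1).
  by apply: cmeas_cont => z; apply: ccontX; exact: ccont_id.
by move=> z zd; rewrite cmodX exprn_ile1 ?cmod_ge0// ltW.
Qed.

Lemma L2_monomul a b f : L2 lam f -> L2 lam (fun z => z ^+ a * conjc z ^+ b * f z).
Proof.
move=> Lf; apply: (@L2_mul_bounded _ _ 1) => //.
  by apply: cmeas_cont => z; apply: ccontM; apply: ccontX; [exact: ccont_id|exact/ccontJ/ccont_id].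
move=> z zd; rewrite cmodM !cmodX cmodJ mulr_ile1 ?exprn_ge0 ?cmod_ge0// exprn_ile1 ?cmod_ge0// ltW//.
Qed.

Lemma inner_lim f n : L2 lam f ->
  ccvg (fun j => cint D (fun z => f z * mono 0 n (lamchi j) z)) (inner lam f (fun z => z ^+ n)).
Proof.
move=> Lf; have := cutoff_lim (ip_cintble Lf (L2_monomial n)).
apply: ccvg_ext => j; apply: eq_cint => z zd.
rewrite monoE /lamchi rcM cjX expr0 mul1r sqrtr_sqr ger0_norm ?cmod_ge0//.
by rewrite !mulrA.
Qed.

Lemma n2_box f k a b s : 0 < s -> 0 <= k -> L2 lam f -> hitv a s `*` hitv b s `<=` pre D ->
  (forall x y, hitv a s x -> hitv b s y -> k <= cmod (f (x +i* y)) ^+ 2 * W (x +i* y)) ->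
  k * s ^+ 2 <= n2 f.
Proof.
move=> s0 k0 Lf sub kf; rewrite n2E; apply: (Rint_box s0 k0 _ _ sub) => //.
- exact: ((L2P _).1 Lf).2.
- by move=> q qd; exact: sqW_ge0.
Qed.

(** On a fixed square inside the annulus r <= |z| <= (1 + r) / 2 the weight is bounded below and
    |z^n|^2 >= r^(2n). *)
Lemma moment_lower r : 0 <= r < 1 ->
  exists2 c, 0 < c & forall n, c * r ^+ 2 ^+ n <= n2 (fun z => z ^+ n).
Proof.
move=> /andP[r0 r1].
have R01 : 0 <= (1 + r) / 2 < 1 by apply/andP; split; lra.
have [c c0 cW] := W_bounds R01.
(* The square has corner [(r, 0)], and r + 2 s = (1 + r) / 2. *)
pose s := (1 - r) / 4; have s0 : 0 < s by rewrite /s; lra.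
exists (c * s ^+ 2); first by rewrite mulr_gt0// exprn_gt0.
move=> n; rewrite mulrAC.
have box x y : hitv r s x -> hitv 0 s y -> r <= cmod (x +i* y) /\ cmod (x +i* y) <= (1 + r) / 2.
  rewrite /hitv/= !in_itv/= => /andP[rx xs] /andP[y0 ys].
  have x0 := le_trans r0 rx; split; first by apply: (le_trans rx); apply: le_trans (le_Re_cmod (x +i* y)); rewrite /= ger0_norm.
  apply: le_trans (cmod_le (x +i* y)) _; rewrite /= !ger0_norm//.
  by move: xs ys; rewrite /s; lra.
apply: (n2_box (a := r) (b := 0)) => //.
- by rewrite mulr_ge0 ?exprn_ge0 ?(ltW c0).
- exact: L2_monomial.
- by move=> [x y] [/= hx hy]; have [_ h] := box _ _ hx hy; apply: le_lt_trans h _; case/andP: R01.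
- move=> x y hx hy; have [h1 h2] := box _ _ hx hy; rewrite mulrC; apply: ler_pM.
  + by rewrite !exprn_ge0.
  + exact: ltW.
  + rewrite cmodX -[leRHS]exprM mulnC exprM; apply: lerXn2r; rewrite ?nnegrE ?sqr_ge0//.
    by apply: lerXn2r; rewrite ?nnegrE ?cmod_ge0.
  + exact: cW.
Qed.

Lemma moment_gt0 n : 0 < n2 (fun z => z ^+ n).
Proof.
have h : 0 <= (2^-1 : R) < 1 by apply/andP; split; lra.
have [c c0 cm] := moment_lower h; apply: lt_le_trans (cm n).
by rewrite mulr_gt0// exprn_gt0// exprn_gt0.
Qed.

(** Where |z|^2 >= 1/2 one has |z|^(2n) <= 2 |z|^(2n+2). Elsewhere |z|^(2n) <= 2^-n, and
    [moment_lower] with r^2 = 1/2 bounds 2^-n by a multiple of the next moment. *)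
Lemma moment_ratio : exists2 C, 0 < C & forall n, n2 (fun z => z ^+ n) <= C * n2 (fun z => z ^+ n.+1).
Proof.
have h : 0 <= (Num.sqrt 2^-1 : R) < 1.
  by rewrite sqrtr_ge0/= -[ltRHS]sqrtr1 ltr_sqrt//; lra.
have [c c0 cm] := moment_lower h; pose M := n2 (fun=> 1).
have M0 : 0 <= M by exact: n2_ge0.
exists (2 + 2 * M / c); first by rewrite ltr_pwDl// divr_ge0// ?mulr_ge0// ltW.
move=> n; have L1 : L2 lam (fun=> 1) := L2_monomial 0.
have [ml il] := (L2P _).1 (L2_monomial n).
have [mr ir] := (L2P _).1 (L2_monomial n.+1).
have [m1 i1] := (L2P _).1 L1.
have : n2 (fun z => z ^+ n) <= 2 * n2 (fun z => z ^+ n.+1) + 2^-1 ^+ n * M.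
  rewrite /M !n2E -!RintegralZl//.
  have j1 : mu2.-integrable (pre D) (EFin \o fun p => 2 * (cmod (of_plane p ^+ n.+1) ^+ 2 * W (of_plane p))).
    by have := integrableZl mD 2 ir; apply: eq_integrable.
  have j2 : mu2.-integrable (pre D) (EFin \o fun p => 2^-1 ^+ n * (cmod (1 : R[i]) ^+ 2 * W (of_plane p))).
    by have := integrableZl mD (2^-1 ^+ n) i1; apply: eq_integrable.
  rewrite -RintegralD//; apply: le_Rintegral => //.
    by have := integrableD mD j1 j2; apply: eq_integrable.
  move=> p pd; rewrite (mulrA 2 (cmod _ ^+ 2)) (mulrA (2^-1 ^+ n) (cmod _ ^+ 2)) -mulrDl ler_wpM2r ?(ltW (W_gt0 pd))//.
  have -> : cmod (1 : R[i]) = 1 by rewrite -[1]/(1%:C) cmod_real normr1.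
  rewrite !cmodX -!exprM !(mulnC _ 2) !exprM expr1n mulr1.
  set x := cmod _ ^+ 2; have x0 : 0 <= x by exact: sqr_ge0.
  have [x2|x2] := leP x 2^-1.
    apply: (@le_trans _ _ (2^-1 ^+ n)); last by rewrite lerDr mulr_ge0// exprn_ge0.
    by rewrite lerXn2r ?nnegrE.
  rewrite exprS mulrA; apply: (@le_trans _ _ (2 * x * x ^+ n)).
    by apply: ler_peMl; [exact: exprn_ge0|rewrite -ler_pdivrMl// mulr1 ltW].
  by rewrite lerDl exprn_ge0.
have := cm n.+1; rewrite sqr_sqrtr// => c1 c2; apply: le_trans c2 _.
rewrite [leRHS](mulrDl 2 (2 * M / c)) lerD2l.
have : 2^-1 ^+ n <= 2 / c * n2 (fun z => z ^+ n.+1).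
  rewrite mulrAC ler_pdivlMr//; apply: le_trans (_ : 2 * (c * 2^-1 ^+ n.+1) <= _); last by rewrite ler_pM2l.
  by rewrite exprS mulrCA (mulrA 2) divff// mul1r mulrC.
move/(ler_wpM2r M0)/le_trans; apply.
by rewrite le_eqVlt; apply/orP; left; apply/eqP; ring.
Qed.

Hypothesis lam_smooth : smooth_on D (fun z => (W z)%:C).

Lemma Csmooth_lamchi j : Csmooth setT (lamchi j).
Proof.
have [c0 c1] := chi_bounds R j.
apply: (@Csmooth_cutoff _ `]0, 1[%classic _ _ j.+2%:R^-1 (1 - j.+2%:R^-1)).
- exact: interval_open.
- by move=> t /=; rewrite !in_itv/= => /andP[h1 h2]; rewrite (lt_le_trans c0)// (le_lt_trans h2).
- move=> n; apply: (@Cder_comp _ [set t | 0 < t < 1]).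
  + move=> t; rewrite /= in_itv/= => /andP[t0 t1]; rewrite sqrtr_gt0 t0/=.
    by rewrite -[ltRHS]sqrtr1 ltr_sqrt.
  + apply: (@Cder_eq _ _ _ (fun t => Re ((W t%:C)%:C))); last exact: (Cn_axis (lam_smooth n)).
    * by rewrite -set_itvoo; exact: interval_open.
    * by move=> t /andP[t0 t1]; rewrite /on_disc cmod_real gtr0_norm.
  + by apply: Cder_sub (Cder_sqrt R n) => t; rewrite /= in_itv/= => /andP[].
- exact: Csmooth_win.
- exact: chi_supp.
Qed.

Lemma lamchi_out j t : 1 - j.+2%:R^-1 <= t -> lamchi j t = 0.
Proof.
by move=> jt; rewrite /lamchi chi_supp ?mulr0//; apply/negP => /andP[_]; rewrite ltNge jt.
Qed.

Lemma tf_lamchi a b j : test_function (mono a b (lamchi j)).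
Proof. exact: tf_mono (chi_bounds R j).2 (@lamchi_out j) (Csmooth_lamchi j). Qed.

Lemma inner_monomial n m : n != m -> inner lam (fun z => z ^+ n) (fun z => z ^+ m) = 0.
Proof.
move=> nm; apply: ccvg_uniq (inner_lim m (L2_monomial n)) _.
apply: ccvg_ext (ccvg_cst 0) => j; apply/esym.
rewrite -(mono_int0 (chi_bounds R j).2 (@lamchi_out j) (Csmooth_lamchi j) nm).
by apply: eq_cint => z _; rewrite /mono expr0 mul1r mulrA.
Qed.

(** * Expansions in monomials: Bessel's inequality and convergence *)

Implicit Types (a : nat -> R[i]).

Definition moment n := n2 (fun z => z ^+ n).
Definition coef f n := inner lam f (fun z => z ^+ n) / (moment n)%:C.
Definition energy a N := \sum_(i < N) cmod (a i) ^+ 2 * moment i.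

Lemma momentC_neq0 n : (moment n)%:C != 0.
Proof. by rewrite -[0]/(0%:C) (inj_eq (@complexI R)) gt_eqF// moment_gt0. Qed.

Lemma inner_coef f n : inner lam f (fun z => z ^+ n) = coef f n * (moment n)%:C.
Proof. by rewrite /coef divfK// momentC_neq0. Qed.

Lemma L2_psum a N : L2 lam (psum a N).
Proof. by apply: L2_sum => i; apply: L2Z; exact: L2_monomial. Qed.

Lemma psumS a N z : psum a N.+1 z = psum a N z + a N * z ^+ N.
Proof. by rewrite /psum big_ord_recr. Qed.

Lemma inner_psum a N n : inner lam (psum a N) (fun z => z ^+ n) = if (n < N)%N then a n * (moment n)%:C else 0.
Proof.
have Lz := L2_monomial; elim: N => [|N ih].
  by rewrite ltn0 -[RHS](inner0l (fun z => z ^+ n)); apply: eq_inner => // z _; rewrite /psum big_ord0.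
rewrite (@eq_inner _ _ (fun z => psum a N z + a N * z ^+ N) (fun z => z ^+ n))//; last first.
  by move=> z _; rewrite psumS.
rewrite innerDl//; [|exact: L2_psum|exact: L2Z].
rewrite innerZl// ih ltnS; have [->|nN] := eqVneq n N.
  by rewrite ltnn leqnn add0r (inner_self (Lz N)).
rewrite inner_monomial//; last by rewrite eq_sym.
by rewrite mulr0 addr0 ltn_neqAle nN.
Qed.

Lemma n2_psumB a M N : n2 (fun z => psum a (N + M) z - psum a M z) = energy a (N + M) - energy a M.
Proof.
have Lz := L2_monomial; have LB k : L2 lam (fun z => psum a (k + M) z - psum a M z).
  by apply: L2B; exact: L2_psum.
elim: N => [|N ih].
  rewrite add0n subrr; have := n2Z 0 L2_0; rewrite cmod0 expr2 !mul0r => <-.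
  by apply: eq_n2 => z _; rewrite subrr.
rewrite (@eq_n2 _ (fun z => (psum a (N + M) z - psum a M z) - (- a (N + M)%N) * z ^+ (N + M))); last first.
  by move=> z _; rewrite addSn psumS; ring.
rewrite n2B//; last exact: L2Z.
rewrite innerZr// innerBl//; [|exact: L2_psum..].
rewrite !inner_psum ltnn ltnNge leq_addl/= subrr mulr0 mulr0 subr0 ih n2Z// cmodN.
by rewrite addSn {3}/energy big_ord_recr /= -/(energy a (N + M)) /moment; ring.
Qed.

Lemma bessel_eq f N : L2 lam f -> n2 (fun z => f z - psum (coef f) N z) = n2 f - energy (coef f) N.
Proof.
move=> Lf; have Lz := L2_monomial; have LB k : L2 lam (fun z => f z - psum (coef f) k z).
  by apply: L2B => //; exact: L2_psum.
elim: N => [|N ih].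
  by rewrite /energy big_ord0 subr0; apply: eq_n2 => z _; rewrite /psum big_ord0 subr0.
rewrite (@eq_n2 _ (fun z => (f z - psum (coef f) N z) - coef f N * z ^+ N)); last first.
  by move=> z _; rewrite psumS; ring.
rewrite n2B//; last exact: L2Z.
rewrite innerZr// innerBl//; last exact: L2_psum.
rewrite inner_psum ltnn subr0 inner_coef ih n2Z// mulrA (mulrC (conjc _)) mulJ_cmod -rcM/=.
by rewrite /energy big_ord_recr /= /moment; ring.
Qed.

Lemma bessel f N : L2 lam f -> energy (coef f) N <= n2 f.
Proof. by move=> Lf; rewrite -subr_ge0 -bessel_eq// n2_ge0. Qed.

(** The moments decay no faster than r^(2n), so bounded energy bounds (|a n| r^n)^2 by B / c; the
    summand 1 comes from x <= 1 + x^2. *)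
Lemma energy_admissible a B : (forall N, energy a N <= B) -> admissible a.
Proof.
move=> aB r r01; have [c c0 cm] := moment_lower r01.
have r0 : 0 <= r by case/andP: r01.
have e0 N : 0 <= energy a N by apply: sumr_ge0 => i _; rewrite mulr_ge0 ?sqr_ge0// n2_ge0.
exists (1 + B / c) => n.
have : (cmod (a n) * r ^+ n) ^+ 2 <= B / c.
  rewrite ler_pdivlMr//; apply: le_trans (aB n.+1).
  rewrite /energy big_ord_recr/= -[leLHS]add0r; apply: lerD; first exact: e0.
  rewrite exprMn -mulrA ler_wpM2l ?sqr_ge0//; apply: le_trans (cm n).
  by rewrite mulrC -!exprM mulnC.
move: (_ * _) => x; have [x1|x1] := leP x 1 => h.
  by apply: le_trans x1 _; rewrite lerDl (le_trans _ h)// sqr_ge0.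
rewrite -[leLHS]add0r lerD//; apply: le_trans h; rewrite expr2 ler_peMr// ltW// (lt_trans _ x1)//.
Qed.

(** Membership of a power series in L2 comes from pointwise convergence of bounded partial sums,
    instead of completeness of the space. *)
Lemma n2_fatou (u : nat -> R[i] -> R[i]) g B : (forall N, L2 lam (u N)) -> cmeasurable D g ->
  (forall z, D z -> ccvg (u^~ z) (g z)) -> (forall N, n2 (u N) <= B) -> L2 lam g /\ n2 g <= B.
Proof.
move=> Lu mg ug uB.
have key : (eint D (fun z => (cmod (g z) ^+ 2 * W z)%R) <= B%:E)%E.
  rewrite /eint; apply: (@le_trans _ _ (\int[mu2]_(p in pre D)
     limn_einf (fun N => (cmod (u N (of_plane p)) ^+ 2 * W (of_plane p))%:E))%E).
    rewrite le_eqVlt; apply/orP; left; apply/eqP; apply: eq_integral => p; rewrite inE => pd.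
    have c1 : cmod (u N (of_plane p)) @[N --> \oo] --> cmod (g (of_plane p)).
      apply/cvgrPdist_lt => e e0; have /ccvgP/(_ _ e0) := ug _ pd; apply: filterS => N.
      apply: le_lt_trans; rewrite ler_norml; apply/andP; split.
        rewrite lerNl opprB lerBlDr -{1}[u N _](subrK (g (of_plane p))); exact: le_cmodD.
      rewrite lerBlDr cmodB -{1}[g (of_plane p)](subrK (u N (of_plane p))); exact: le_cmodD.
    have c2 : (cmod (u N (of_plane p)) ^+ 2 * W (of_plane p))%:E @[N --> \oo] -->
        (cmod (g (of_plane p)) ^+ 2 * W (of_plane p))%:E.
      apply: cvg_EFin; first exact: nearW.
      by apply: (cvgM _ (cvg_cst _)); exact: (cvgM c1 c1).
    by rewrite (cvg_limn_einf_sup c2).1.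
  apply: le_trans (fatou mu2 mD _ _) _.
  - by move=> N; apply/measurable_EFinP; apply: sqW_meas; case: (Lu N).
  - by move=> N p pd; rewrite lee_fin sqW_ge0.
  rewrite limn_einf_lim; apply: lime_le; first exact: is_cvg_einfs.
  apply: nearW => N; apply: le_trans (_ : (n2 (u N))%:E <= _)%E; last by rewrite lee_fin.
  by rewrite -n2_fin//; apply: ereal_inf_lbound; exists N => /=.
have Lg : L2 lam g by split => //; apply: le_lt_trans key _; rewrite ltry.
by split => //; rewrite -lee_fin -n2_fin.
Qed.

Lemma L2_ps a B : (forall N, energy a N <= B) ->
  [/\ L2 lam (ps a), n2 (ps a) <= B & n2 (fun z => psum a M z - ps a z) @[M --> \oo] --> (0 : R)].
Proof.
move=> aB; have adm := energy_admissible aB.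
have key M B' : (forall N, energy a N <= B') ->
    L2 lam (fun z => ps a z - psum a M z) /\ n2 (fun z => ps a z - psum a M z) <= B' - energy a M.
  move=> aB'; apply: (@n2_fatou (fun N z => psum a (N + M) z - psum a M z)).
  - by move=> N; apply: L2B; exact: L2_psum.
  - by apply: cmeasB; [exact: cmeas_ps|apply: cmeas_cont => z; exact: psum_cont].
  - move=> z zd; have := ccvgD (ccvg_shift M (ps_cvg adm zd)) (ccvg_cst (- psum a M z)).
    by apply: ccvg_ext.
  - by move=> N; rewrite n2_psumB lerD2r.
have [L0 n0] := key 0%N B aB.
have e0 : energy a 0 = 0 by rewrite /energy big_ord0.
have p0 z : psum a 0 z = 0 by rewrite /psum big_ord0.
split.
- by apply: eq_L2 L0 => z _; rewrite p0 subr0.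
- by rewrite (@eq_n2 _ (fun z => ps a z - psum a 0 z)) ?(le_trans n0) ?e0 ?subr0// => z _; rewrite p0 subr0.
have nd : {homo energy a : n m / (n <= m)%N >-> n <= m}.
  apply/nondecreasing_seqP => n; rewrite /energy big_ord_recr/= lerDl.
  by rewrite mulr_ge0 ?sqr_ge0// n2_ge0.
have bd : has_ubound (range (energy a)) by exists B => _ [n _ <-].
have ec := nondecreasing_cvgn nd bd.
(* With the best bound [S] in place of [B], the tail is at most [S - energy a M], which tends to
   0. *)
set S := sup _ in ec; have aS N : energy a N <= S by apply: ub_le_sup => //; exists N.
apply/cvgrPdist_lt => e e0'; move/cvgrPdist_lt/(_ _ e0') : ec; apply: filterS => M.
rewrite sub0r normrN (ger0_norm (n2_ge0 _)); apply: le_lt_trans.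
rewrite ger0_norm ?subr_ge0//; apply: le_trans (key M S aS).2.
rewrite (@eq_n2 _ (fun z => (-1) * (ps a z - psum a M z))); last by move=> z _; ring.
rewrite n2Z; last exact: (key M S aS).1.
by rewrite cmodN cmod_real normr1 expr1n mul1r.
Qed.

Lemma inner_ps_lim a B h : (forall N, energy a N <= B) -> L2 lam h ->
  ccvg (fun N => inner lam (psum a N) h) (inner lam (ps a) h).
Proof.
move=> aB Lh; have [Lp _ nc] := L2_ps aB; apply/ccvgP => e e0.
(* This makes s^-1 n2 h at most e / 2; the summand 1 covers h of norm 0. *)
pose s := 2 * (n2 h + 1) / e; have nh := n2_ge0 h.
have nh1 : 0 < n2 h + 1 by rewrite ltr_wpDl.
have s0 : 0 < s by rewrite divr_gt0// mulr_gt0.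
have d0 : 0 < e / 2 / s by rewrite divr_gt0// divr_gt0.
move/cvgrPdist_lt/(_ _ d0) : nc; apply: filterS => N.
rewrite sub0r normrN (ger0_norm (n2_ge0 _)) => nN.
rewrite -innerBl//; last exact: L2_psum.
apply: le_lt_trans (inner_bound s0 (L2B (L2_psum a N) Lp) Lh) _.
rewrite [e]splitr; apply: ltr_leD; first by rewrite mulrC -ltr_pdivlMr.
rewrite /s invf_div mulrAC ler_pdivrMr ?mulr_gt0//.
rewrite (_ : e / 2 * (2 * (n2 h + 1)) = e * (n2 h + 1)); last by field.
by rewrite ler_pM2l// lerDl.
Qed.

Lemma inner_ps a B n : (forall N, energy a N <= B) ->
  inner lam (ps a) (fun z => z ^+ n) = a n * (moment n)%:C.
Proof.
move=> aB; apply: ccvg_uniq (ccvg_shift n.+1 (inner_ps_lim aB (L2_monomial n))) _.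
by apply: ccvg_ext (ccvg_cst _) => N; rewrite inner_psum addnS ltnS leq_addl.
Qed.

Lemma inner_ps_eq0 a B h : (forall N, energy a N <= B) -> L2 lam h ->
  (forall n, inner lam h (fun z => z ^+ n) = 0) -> inner lam (ps a) h = 0.
Proof.
move=> aB Lh h0; apply: ccvg_uniq (inner_ps_lim aB Lh) _; apply: ccvg_ext (ccvg_cst 0) => N.
rewrite inner_suml//; last by move=> i; apply: L2Z; exact: L2_monomial.
rewrite big1// => i _; rewrite innerZl//; last exact: L2_monomial.
by rewrite (innerJ Lh (L2_monomial i)) h0 conjc0 mulr0.
Qed.

(** * Completeness of the monomials in A2 *)

Lemma lamchi_supported j : supported (lamchi j) j.+2%:R^-1 (1 - j.+2%:R^-1).
Proof. by move=> t jt; rewrite /lamchi chi_supp ?mulr0. Qed.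

Lemma supported_widen rho (a b a' b' : R) : a' <= a -> b <= b' -> supported rho a b -> supported rho a' b'.
Proof.
move=> aa bb rho0 t; rewrite negb_and -!leNgt => h; apply: rho0.
by rewrite negb_and -!leNgt; case/orP: h => h; [rewrite (le_trans h)|rewrite (le_trans bb h) orbT].
Qed.

Definition null_moments u := forall n, inner lam u (fun z => z ^+ n) = 0.

(** By proportionality [tau] is compared with the cut-off weights and [u] with z^m. As the cut-off
    is removed, one side tends to [E] times the positive moment of z^m and the other to a multiple
    of <u, z^m> = 0. *)
Lemma moment_neg0 u u' m tau (alpha beta : R) : (forall z, D z -> wdiff u z (u' z) 0) -> L2 lam u ->
  null_moments u -> Csmooth setT tau -> supported tau alpha beta -> 0 < alpha -> beta < 1 ->
  cint D (fun z => u z * mono 0 m tau z) = 0.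
Proof.
move=> du Lu u0 stau ptau a0 b1.
set E := cint _ _.
have key j : E * cint D (fun z => z ^+ m * mono 0 m (lamchi j) z) =
    cint D (fun z => z ^+ m * mono 0 m tau z) * cint D (fun z => u z * mono 0 m (lamchi j) z).
  have [j0 j1] := chi_bounds R j.
  pose a' := Order.min alpha j.+2%:R^-1; pose b' := Order.max beta (1 - j.+2%:R^-1).
  rewrite [RHS]mulrC; apply: (@moment_holo_proportional _ u u' _ _ m _ _ a' b' du (fun z _ => wdiffX m z)).
  - exact: stau.
  - exact: Csmooth_lamchi.
  - by apply: supported_widen ptau; rewrite /a' /b' ?ge_min ?le_max lexx.
  - by apply: supported_widen (@lamchi_supported j); rewrite /a' /b' ?ge_min ?le_max lexx ?orbT.
  - by rewrite lt_min a0.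
  - by rewrite gt_max b1.
have l1 := ccvgZ E (inner_lim m (L2_monomial m)).
have l2 := ccvgZ (cint D (fun z => z ^+ m * mono 0 m tau z)) (inner_lim m Lu).
rewrite u0 mulr0 in l2.
have : E * (moment m)%:C = 0.
  by rewrite /moment -inner_self; [apply: ccvg_uniq l1 (ccvg_ext _ l2) => j; rewrite key|exact: L2_monomial].
by move/eqP; rewrite mulf_eq0 (negbTE (momentC_neq0 m)) orbF => /eqP.
Qed.

Lemma mono_reduce_le (a b : nat) rho z : (a <= b)%N -> mono a b rho z = mono 0 (b - a) (fun t => t ^+ a * rho t) z.
Proof.
move=> ab; rewrite !monoE rcM rcX -mulJ_cmod exprMn -{1}(subnK ab) exprD expr0; ring.
Qed.

Lemma mono_reduce_ge (a b : nat) rho z : (b <= a)%N -> mono a b rho z = mono (a - b) 0 (fun t => t ^+ b * rho t) z.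
Proof.
move=> ab; rewrite !monoE rcM rcX -mulJ_cmod exprMn -{1}(subnK ab) exprD expr0; ring.
Qed.

(** Common powers of z and zb are absorbed into the radial factor. A remaining power of z gives 0
    for every holomorphic [u]; a power of zb, possibly of exponent 0, gives 0 by the vanishing
    moments. *)
Lemma moment_mono0 u u' (a b : nat) rho (alpha beta : R) : (forall z, D z -> wdiff u z (u' z) 0) -> L2 lam u ->
  null_moments u -> Csmooth setT rho -> supported rho alpha beta -> 0 < alpha -> beta < 1 ->
  cint D (fun z => u z * mono a b rho z) = 0.
Proof.
move=> du Lu u0 srho prho a0 b1.
have sT k : Csmooth setT (fun t : R => t ^+ k * rho t).
  by move=> n; apply: CderM => //; apply: CderX; exact: Cder_id.
have pT k : supported (fun t : R => t ^+ k * rho t) alpha beta by move=> t /prho ->; rewrite mulr0.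
have [ab|ba] := leqP a b.
  under eq_cint do rewrite (mono_reduce_le _ _ ab).
  exact: (moment_neg0 _ du Lu u0 (sT a) (pT a)).
under eq_cint do rewrite (mono_reduce_ge _ _ (ltnW ba)) -(ltn_predK (_ : 0 < a - b)%N) ?subn_gt0//.
exact: (moment_holo_pos _ du (sT b) (pT b)).
Qed.

(** At p different from 0, [u] times a window in |z|^2 is continuous on the plane and orthogonal to
    all powers of the Landau kernel at [p]. The window must avoid 0, so the origin is reached by
    continuity. *)
Lemma holo_null u u' : (forall z, D z -> wdiff u z (u' z) 0) -> L2 lam u ->
  null_moments u -> forall z, D z -> u z = 0.
Proof.
move=> du Lu u0.
have nz p : D p -> p != 0 -> u p = 0.
  move=> pd p0; pose t0 := cmod p ^+ 2.
  have t00 : 0 < t0 by rewrite exprn_gt0// cmod_gt0.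
  have t01 : t0 < 1 by rewrite expr_lt1// cmod_ge0.
  (* The end points are the midpoints between 0, [t0] and 1. *)
  pose rho := win (t0 / 2) ((1 + t0) / 2) 1.
  have prho : supported rho (t0 / 2) ((1 + t0) / 2) by move=> t; exact: win_eq0.
  have srho : Csmooth setT rho := @Csmooth_win _ _ _ _.
  have b1 : (1 + t0) / 2 < 1 by lra.
  have tf (a b : nat) := tf_mono a b b1 (fun t => supported_ge prho) srho.
  have a0 : 0 < t0 / 2 by lra.
  have cu z : D z -> ccont u z by move=> zd; exact: wdiff_cont (du z zd).
  have mom (a b : nat) := moment_mono0 a b du Lu u0 srho prho a0 b1.
  have cuf (a b : nat) z : ccont (fun z => u z * mono a b rho z) z by exact: tf_mulcont.
  have cf (a b N : nat) z : ccont (fun z => u z * mono a b rho z * landau p z ^+ N) z.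
    by apply: ccontM => //; apply: ccontX; exact: landau_cont.
  (* Expanding one factor of the kernel raises [a] and [b] by at most one, so the induction on [N]
     runs over all exponents at once. *)
  have momN (N a b : nat) : cint D (fun z => u z * mono a b rho z * landau p z ^+ N) = 0.
    elim: N a b => [|N ih] a b; first by rewrite -[RHS](mom a b); apply: eq_cint => z _; rewrite expr0 mulr1.
    pose G (c d : nat) z := u z * mono c d rho z * landau p z ^+ N.
    have iG (c d : nat) : cintble D (G c d) by apply: cintble_cont => z; exact: cf.
    transitivity (cint D (fun z => ((1 - p * conjc p / 4) * G a b z + (- (1 / 4)) * G a.+1 b.+1 z) +
        ((p / 4) * G a b.+1 z + (conjc p / 4) * G a.+1 b z))).
      apply: eq_cint => z _; rewrite /G (exprS (landau p z)) {1}landau_poly /mono cjB !exprS.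
      by field; exact: isT.
    rewrite !cintD//; try (by do ?apply: cintbleD => //; exact: cintbleZ).
    by rewrite !cintZ// !ih !mulr0 !addr0.
  have : u p * mono 0 0 rho p = 0.
    by apply: (landau_concentration (v := fun z => u z * mono 0 0 rho z)) => //; exact: momN.
  rewrite monoE !expr0 !mul1r => /eqP; rewrite mulf_eq0 => /orP[/eqP//|].
  rewrite -[0]/(0%:C) (inj_eq (@complexI R)) => /eqP w0.
  have : 0 < rho (cmod p ^+ 2) by rewrite win_gt0//; apply/andP; rewrite -/t0; split; lra.
  by rewrite w0 ltxx.
(* A nonzero value at the origin would persist at the small positive real point [r], where [u]
   vanishes. *)
move=> z zd; have [->|] := eqVneq z 0; last exact: nz.
apply/eqP/negPn/negP => u00.
have d0 : D 0 by rewrite /disc/mkset cmod0.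
have e0 : 0 < cmod (u 0) by rewrite cmod_gt0.
have [d dpos dP] := wdiff_cont (du 0 d0) e0.
pose r := Order.min (d / 2) (1 / 2); have r0 : 0 < r by rewrite lt_min !divr_gt0.
have rd : r <= d / 2 by rewrite ge_min lexx.
have r1 : r <= 1 / 2 by rewrite ge_min lexx orbT.
have := dP r%:C; rewrite subr0 cmod_real (gtr0_norm r0) nz; last 2 first.
- by rewrite /disc/mkset cmod_real gtr0_norm//; lra.
- by rewrite -[0]/(0%:C) (inj_eq (@complexI R)) gt_eqF.
have rd' : r < d by lra.
by move=> /(_ rd'); rewrite sub0r cmodN ltxx.
Qed.

(** * The Bergman projection as a power series *)

Lemma A2_ps a (B : R) : (forall N, energy a N <= B) -> A2 lam (ps a).
Proof.
move=> aB; have [Lp _ _] := L2_ps aB; have adm := energy_admissible aB.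
by split => // z zd; apply/holomorphicP; exists (ps (pder a) z); exact: wdiff_ps.
Qed.

Lemma A2_null u : A2 lam u -> null_moments u -> forall z, D z -> u z = 0.
Proof.
move=> [Lu hu] u0.
have /choice[u' du] : forall z, exists c, D z -> wdiff u z c 0.
  move=> z; have [zd|nzd] := pselect (D z); last by exists 0.
  by have [a da] := (holomorphicP u z).1 (hu z zd); exists a.
exact: (holo_null du Lu u0).
Qed.

Lemma A2_B f g : A2 lam f -> A2 lam g -> A2 lam (fun z => f z - g z).
Proof.
move=> [Lf hf] [Lg hg]; split; first exact: L2B.
move=> z zd; apply/holomorphicP.
have [a da] := (holomorphicP f z).1 (hf z zd); have [b db] := (holomorphicP g z).1 (hg z zd).
exists (a + (-1) * b); have := wdiffD da (wdiffZ (-1) db); rewrite mulr0 addr0; apply: wdiff_near.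
by exists 1 => // w _; rewrite mulN1r.
Qed.

(** [h] and its series have the same inner products with all monomials, so completeness applies to
    the difference. *)
Lemma A2_expansion h : A2 lam h -> forall z, D z -> h z = ps (coef h) z.
Proof.
move=> Ah z zd; have Lh := Ah.1; have B := @bessel h ^~ Lh.
have [Lp _ _] := L2_ps B.
apply/eqP; rewrite -subr_eq0; apply/eqP.
apply: (A2_null (A2_B Ah (A2_ps B)) _ zd) => n.
by rewrite innerBl ?(inner_ps _ B) ?inner_coef ?subrr//; exact: L2_monomial.
Qed.

Lemma projection_ps f : L2 lam f -> orthogonal_projection_on_A2 lam f (ps (coef f)).
Proof.
move=> Lf; have B := @bessel f ^~ Lf; have [Lp _ _] := L2_ps B.
split; first exact: A2_ps B.
move=> h Ah; have Lh := Ah.1; have LB := L2B Lf Lp.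
rewrite (innerJ Lh LB) (eq_inner (A2_expansion Ah) (fun z _ => erefl)).
rewrite (inner_ps_eq0 (@bessel h ^~ Lh))//; first exact: conjc0.
by move=> n; rewrite innerBl ?(inner_ps _ B) ?inner_coef ?subrr//; exact: L2_monomial.
Qed.

Lemma bergman_projection f : L2 lam f -> orthogonal_projection_on_A2 lam f (bergman lam f).
Proof. by move=> Lf; apply: (xgetPex (fun=> 0)); exists (ps (coef f)); exact: projection_ps. Qed.

(** [bergman] selects an unspecified orthogonal projection. The monomials lie in A2, so every such
    projection has the coefficients of [f], and its own expansion determines it on the disc. *)
Lemma bergman_ps f : L2 lam f -> forall z, D z -> bergman lam f z = ps (coef f) z.
Proof.
move=> Lf z zd; have [Ab ob] := bergman_projection Lf.
rewrite (A2_expansion Ab zd); congr (ps _ z); apply/funext => n.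
have An : A2 lam (fun z => z ^+ n).
  by split; [exact: L2_monomial|move=> w _; apply/holomorphicP; exists (n%:R * w ^+ n.-1); exact: wdiffX].
have := ob _ An; rewrite innerBl//; [|exact: Ab.1|exact: L2_monomial].
by move/eqP; rewrite subr_eq0 => /eqP; rewrite /coef => ->.
Qed.

(** * Trading powers of the index for weak derivatives *)

Definition bounded_derivatives k f (S : R) := forall p q, (p + q <= k)%N ->
  exists g, [/\ weak_derivative p q f g, L2 lam g & n2 g <= S].

Lemma n2_comb3 f g h (c : R[i]) : L2 lam f -> L2 lam g -> L2 lam h ->
  n2 (fun z => f z + (-1) * g z + c * h z) <= 4 * n2 f + 4 * n2 g + 2 * cmod c ^+ 2 * n2 h.
Proof.
move=> Lf Lg Lh; have Lg' := L2Z (-1) Lg; have Lh' := L2Z c Lh.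
apply: le_trans (n2D_le (L2D Lf Lg') Lh') _; rewrite (n2Z c Lh) (mulrA 2 (cmod c ^+ 2)) lerD2r.
have := n2D_le Lf Lg'; rewrite n2Z// cmodN cmod_real normr1 expr1n mul1r; lra.
Qed.

(* The powers of [N] are traded for derivatives of [f] one at a time, moving the
   rotation field from the test function to [f]. *)
Lemma weighted_moment k j p q : (p + q + j <= k)%N -> exists2 C, 0 <= C &
  forall f S, bounded_derivatives k f S -> exists F, [/\ L2 lam F, n2 F <= C * S &
    forall N i, N%:R ^+ j * cint D (fun z => f z * wirtinger p q (mono p (q + N) (lamchi i)) z) =
      cint D (fun z => F z * mono 0 N (lamchi i) z)].
Proof.
elim: j p q => [|j ih] p q; rewrite ?addn0 => pq.
  exists 1 => // f S /(_ p q pq)[g [wg Lg gS]]; rewrite mul1r.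
  (* All derivatives now fall on [f]. The factor z^p zb^q of the test function joins [F]; its
     modulus is at most 1 on the disc. *)
  exists (fun z => (-1) ^+ (p + q) * (z ^+ p * conjc z ^+ q * g z)).
  have Lm := L2_monomul p q Lg; split; first exact: L2Z.
    rewrite n2Z// cmodX cmodN cmod_real normr1 !expr1n mul1r; apply: le_trans gS.
    rewrite -[leRHS]mul1r; apply: n2_sqrle => // z zd; rewrite mul1r.
    apply: lerXn2r; rewrite ?nnegrE ?cmod_ge0// cmodM ler_piMl ?cmod_ge0//.
    by rewrite cmodM !cmodX cmodJ mulr_ile1 ?exprn_ge0 ?cmod_ge0// exprn_ile1 ?cmod_ge0// ltW.
  move=> N i; rewrite expr0 mul1r; have [_ _ ->] := wg; last exact: tf_lamchi.
  rewrite -cintZ//; last by apply: cintble_tf; [exact: L2_locint|exact: tf_lamchi].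
  apply: eq_cint => z _; rewrite -(addn0 p) -mono_mul addn0; ring.
have h1 : (p + q.+1 + j <= k)%N by rewrite addnS addSn -addnS.
have h2 : (p.+1 + q + j <= k)%N by rewrite !addSn -addnS.
have h3 : (p + q + j <= k)%N by apply: leq_trans pq; rewrite leq_add2l.
have [C1 C10 P1] := ih _ _ h1; have [C2 C20 P2'] := ih _ _ h2; have [C3 C30 P3] := ih _ _ h3.
pose c : R[i] := p%:R - q%:R.
(* The weights are those of [n2_comb3]; [c] is the correction p - q in [wirtinger_mono]. *)
exists (4 * C1 + 4 * C2 + 2 * cmod c ^+ 2 * C3).
  apply: addr_ge0; first by apply: addr_ge0; rewrite mulr_ge0.
  by rewrite mulr_ge0// mulr_ge0// sqr_ge0.
move=> f S bf; have [F1 [L1 n1 E1]] := P1 f S bf; have [F2 [L2' n2' E2]] := P2' f S bf.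
have [F3 [L3 n3 E3]] := P3 f S bf.
have Lc := L2D (L2D L1 (L2Z (-1) L2')) (L2Z c L3).
exists (fun z => F1 z + (-1) * F2 z + c * F3 z); split => //.
  apply: le_trans (n2_comb3 c L1 L2' L3) _.
  have c0 : 0 <= 2 * cmod c ^+ 2 by rewrite mulr_ge0 ?sqr_ge0.
  rewrite [leRHS](_ : _ = 4 * (C1 * S) + 4 * (C2 * S) + 2 * cmod c ^+ 2 * (C3 * S)); last by ring.
  by apply: lerD; [apply: lerD|]; rewrite ler_wpM2l.
move=> N i.
have [g [[lf _ _] _ _]] := bf 0%N 0%N (leq0n k).
have it (a b c' d : nat) : cintble D (fun z => f z * wirtinger a b (mono c' d (lamchi i)) z).
  by apply: cintble_tf => //; apply: tf_wirtinger; exact: tf_lamchi.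
have iF G : L2 lam G -> cintble D (fun z => G z * mono 0 N (lamchi i) z).
  by move=> LG; apply: cintble_tf; [exact: L2_locint|exact: tf_lamchi].
transitivity (cint D (fun z => F1 z * mono 0 N (lamchi i) z) +
  (-1) * cint D (fun z => F2 z * mono 0 N (lamchi i) z) + c * cint D (fun z => F3 z * mono 0 N (lamchi i) z)).
  rewrite -E1 -E2 -E3 exprSr -mulrA -cintZ//.
  have -> : cint D (fun z => N%:R * (f z * wirtinger p q (mono p (q + N) (lamchi i)) z)) =
      cint D (fun z => f z * wirtinger p q.+1 (mono p (q.+1 + N) (lamchi i)) z +
       (-1) * (f z * wirtinger p.+1 q (mono p.+1 (q + N) (lamchi i)) z) +
       c * (f z * wirtinger p q (mono p (q + N) (lamchi i)) z)).
    apply: eq_cint => z _; rewrite mulrCA wirtinger_mono; last exact: Csmooth_lamchi.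
    rewrite -/c; ring.
  rewrite !cintD ?cintZ//; try exact: cintbleZ; try (by apply: cintbleD => //; exact: cintbleZ).
  ring.
have i1 := iF _ L1; have i2 := iF _ L2'; have i3 := iF _ L3.
rewrite -(cintZ mD (-1) i2) -(cintZ mD c i3) -(cintD mD i1 (cintbleZ mD (-1) i2)).
rewrite -(cintD mD (cintbleD mD i1 (cintbleZ mD (-1) i2)) (cintbleZ mD c i3)).
by apply: eq_cint => z _; ring.
Qed.

(** The limit of the cut-offs is taken on both sides. [F] was fixed before [N] and the cut-off
    index, so one function serves for all coefficients and Bessel's inequality can be applied to
    it. *)
Lemma weighted_coef k j : (j <= k)%N -> exists2 C, 0 <= C &
  forall f S, L2 lam f -> bounded_derivatives k f S -> exists F, [/\ L2 lam F, n2 F <= C * S &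
    forall N, coef F N = N%:R ^+ j * coef f N].
Proof.
move=> jk; have [C C0 CP] := @weighted_moment k j 0 0 jk; exists C => // f S Lf bf.
have [F [LF nF EF]] := CP f S bf; exists F; split => // N.
rewrite /coef mulrA; congr (_ / _); apply: ccvg_uniq (inner_lim N LF) _.
by apply: ccvg_ext (ccvgZ (N%:R ^+ j) (inner_lim N Lf)) => i; rewrite EF.
Qed.

(** The b-fold derivative multiplies by a product of b consecutive integers, none above n + b. *)
Lemma cmod_iter_pder a b n : cmod (iter b (@pder R) a n) <= (n + b)%:R ^+ b * cmod (a (n + b)%N).
Proof.
elim: b n => [|b ih] n; first by rewrite expr0 mul1r addn0.
rewrite iterS /pder cmodM cmod_nat exprS -mulrA addnS -addSn.
apply: ler_pM; rewrite ?cmod_ge0//; by rewrite ler_nat addSn ltnS leq_addr.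
Qed.

Lemma moment_ratio_iter b : exists2 C, 0 < C & forall n, moment n <= C * moment (n + b).
Proof.
have [C C0 CP] := moment_ratio; exists (C ^+ b); first exact: exprn_gt0.
elim: b => [|b ih] n; first by rewrite expr0 mul1r addn0.
apply: le_trans (ih n) _; rewrite exprSr -mulrA ler_pM2l ?exprn_gt0// addnS; exact: CP.
Qed.

(** Differentiating b times shifts the index by b; [moment_ratio_iter] pays for replacing the moment
    at n by that at n + b. *)
Lemma energy_iter_pder k b : (b <= k)%N -> exists2 C, 0 <= C &
  forall f S, L2 lam f -> bounded_derivatives k f S ->
    forall N, energy (iter b (@pder R) (coef f)) N <= C * S.
Proof.
move=> bk; have [C C0 CP] := weighted_coef bk; have [C' C'0 C'P] := moment_ratio_iter b.
exists (C' * C); first by rewrite mulr_ge0// ltW.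
move=> f S Lf bf N; have [F [LF nF FE]] := CP f S Lf bf.
have term n : cmod (iter b (@pder R) (coef f) n) ^+ 2 * moment n <=
    C' * (cmod (coef F (n + b)) ^+ 2 * moment (n + b)).
  rewrite mulrCA; apply: ler_pM; rewrite ?sqr_ge0//; first exact: n2_ge0.
    apply: lerXn2r; rewrite ?nnegrE ?cmod_ge0//.
    by rewrite FE cmodM cmodX cmod_nat; exact: cmod_iter_pder.
apply: (@le_trans _ _ (C' * energy (coef F) (N + b))).
  elim: N => [|N ih].
    by rewrite /energy big_ord0 mulr_ge0 ?(ltW C'0)// sumr_ge0// => i _; rewrite mulr_ge0 ?sqr_ge0// n2_ge0.
  by rewrite addSn /energy !big_ord_recr/= mulrDr lerD.
by rewrite -mulrA ler_pM2l//; apply: le_trans nF; exact: bessel.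
Qed.

(** * Weak derivatives of the projection and the Sobolev estimate *)

Lemma weak_ps a b1 b2 phi : admissible a -> test_function phi ->
  cint D (fun z => ps a z * wirtinger b1 b2 phi z) =
  (-1) ^+ (b1 + b2) * cint D (fun z => (if b2 == 0%N then ps (iter b1 (@pder R) a) z else 0) * phi z).
Proof.
move=> adm tphi.
have step (b : nat) (c : nat -> R[i]) psi : admissible c -> test_function psi ->
    cint D (fun z => ps c z * iter b partial_z psi z) =
    (-1) ^+ b * cint D (fun z => ps (iter b (@pder R) c) z * psi z).
  elim: b c => [|b ih] c admc tpsi; first by rewrite expr0 mul1r.
  have ti : test_function (iter b partial_z psi).
    by elim: b {ih} => [//|b ihb]; exact: tf_partial_z.
  have := weak_z (fun z zd => wdiff_ps admc zd) (fun z zd => ps_cont (admissible_pder admc) zd) ti.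
  rewrite iterS => ->; rewrite ih//; last exact: admissible_pder.
  by rewrite -iterSr exprS mulN1r mulNr.
rewrite /wirtinger step//; last exact: tf_iter_zbar.
case: b2 => [|b2]; first by rewrite addn0.
(* One zb derivative on the test function already makes the integral vanish, the series being
   holomorphic. *)
rewrite iterS (weak_zbar (fun z zd => wdiff_ps (admissible_iter b1 adm) zd)); last exact: tf_iter_zbar.
rewrite mulr0; apply/esym; rewrite [X in _ * X](_ : _ = 0) ?mulr0// -[RHS](@cint0 R D).
by apply: eq_cint => z _; rewrite mul0r.
Qed.

Lemma n2_wderiv p q f g : weak_derivative p q f g -> L2 lam g -> n2 (wderiv p q f) = n2 g.
Proof.
move=> wg Lg; have ww : weak_derivative p q f (wderiv p q f).
  by apply: (xgetPex (fun=> 0) (P := [set g | weak_derivative p q f g])); exists g.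
have neg := weak_derivative_unique ww wg; have [_ [mw _] _] := ww; have [mg _] := Lg.
congr fine; apply: ge0_ae_eq_integral => //.
- by apply/measurable_EFinP; exact: sqW_meas.
- by apply/measurable_EFinP; exact: sqW_meas.
- by move=> x xd; rewrite lee_fin sqW_ge0.
- by move=> x xd; rewrite lee_fin sqW_ge0.
apply: negligibleS neg => x /= /not_implyP[xd ne]; split => //.
by apply: contra_notN ne => /eqP ->.
Qed.

Definition sobolev_sqr k f :=
  \sum_(b : 'I_k.+1 * 'I_k.+1 | (b.1 + b.2 <= k)%N) n2 (wderiv b.1 b.2 f).

Lemma sobolev_normE k f : sobolev_norm k lam f = Num.sqrt (sobolev_sqr k f).
Proof. by []. Qed.

Lemma sobolev_bounded k f : sobolev k lam f -> bounded_derivatives k f (sobolev_sqr k f).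
Proof.
move=> [Lf wf] p q pq; have [g wg Lg] := wf p q pq; exists g; split => //.
have pk : (p < k.+1)%N by rewrite ltnS (leq_trans _ pq)// leq_addr.
have qk : (q < k.+1)%N by rewrite ltnS (leq_trans _ pq)// leq_addl.
rewrite /sobolev_sqr (bigD1 (Ordinal pk, Ordinal qk))//= (n2_wderiv wg Lg) lerDl.
by apply: sumr_ge0 => b _; exact: n2_ge0.
Qed.

Lemma bergman_weak_derivative k f p q (B : R) : L2 lam f -> (p + q <= k)%N ->
  (forall N, energy (iter p (@pder R) (coef f)) N <= B) -> 0 <= B ->
  exists g, [/\ weak_derivative p q (bergman lam f) g, L2 lam g & n2 g <= B].
Proof.
move=> Lf pq eB B0; have [[Lb _] _] := bergman_projection Lf.
pose g z := if q == 0%N then ps (iter p (@pder R) (coef f)) z else 0.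
have [Lg nB] : L2 lam g /\ n2 g <= B.
  rewrite /g; case: (q == 0%N); first by have [] := L2_ps eB.
  split; first exact: L2_0.
  by have := n2Z 0 L2_0; rewrite cmod0 expr2 !mul0r => ->.
exists g; split => //; split; [exact: L2_locint|exact: L2_locint|move=> phi tphi].
rewrite -weak_ps//; last exact: energy_admissible (@bessel f ^~ Lf).
by apply: eq_cint => z zd; rewrite bergman_ps.
Qed.

Lemma bergman_exactly_regular : exactly_regular lam.
Proof.
move=> k.
have /choice[C CP] : forall b, exists C, 0 <= C /\ ((b <= k)%N ->
    forall f S, L2 lam f -> bounded_derivatives k f S ->
    forall N, energy (iter b (@pder R) (coef f)) N <= C * S).
  move=> b; have [bk|_] := leqP b k; last by exists 0.
  by have [C C0 CP] := energy_iter_pder bk; exists C.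
(* The constant depends on the z order only; derivatives of the projection that involve zb are 0 and
   obey the same bound. *)
pose M := \sum_(b : 'I_k.+1 * 'I_k.+1 | (b.1 + b.2 <= k)%N) C b.1.
have M0 : 0 <= M by apply: sumr_ge0 => b _; case: (CP b.1).
(* The summand 1 keeps the constant positive when [M] is 0. *)
exists (Num.sqrt M + 1); first by rewrite ltr_wpDl// sqrtr_ge0.
move=> f sf; have Lf := sf.1; have bf := sobolev_bounded sf.
rewrite (sobolev_normE k f) (sobolev_normE k (bergman lam f)).
move: (sobolev_sqr k f) bf => S bf.
have S0 : 0 <= S by have [g [_ _ /(le_trans (n2_ge0 g))]] := bf 0%N 0%N (leq0n k).
have wd p q : (p + q <= k)%N -> exists g, [/\ weak_derivative p q (bergman lam f) g, L2 lam g & n2 g <= C p * S].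
  move=> pq; have [C0 Cp] := CP p.
  apply: (bergman_weak_derivative Lf pq); last by rewrite mulr_ge0.
  by apply: Cp => //; apply: leq_trans pq; exact: leq_addr.
split.
  split; first by have [[]] := bergman_projection Lf.
  by move=> p q /wd[g [wg Lg _]]; exists g.
apply: (@le_trans _ _ (Num.sqrt (M * S))).
  rewrite ler_sqrt ?mulr_ge0// /M /sobolev_sqr mulr_suml; apply: ler_sum => b bk.
  by have [g [wg Lg nS]] := wd _ _ bk; rewrite (n2_wderiv wg Lg).
by rewrite sqrtrM// ler_wpM2r ?sqrtr_ge0// lerDl.
Qed.

End WeightedL2.

(** The first clause certifies that [bergman] is the orthogonal projection on all of L2, so that the
    estimate does not concern the default value of [xget]. *)
Theorem theorem1 (R : realType) (lam : R -> R)
  (lam_weight : radial_weight lam)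
  (lam_integrable : integrable_weight lam)
  (lam_nonvanishing : forall r : R, 0 <= r < 1 -> lam r != 0)
  (lam_smooth : smooth_on (disc R) (fun z : R[i] => (on_disc lam z)%:C)) :
  (forall f : R[i] -> R[i], L2 lam f ->
     orthogonal_projection_on_A2 lam f (bergman lam f)) /\
  exactly_regular lam.
Proof.
split; first by move=> f; exact: bergman_projection.
exact: bergman_exactly_regular.
Qed.
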